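(* Let $G$ be a discrete group, let $(\mathcal A, G, \delta)$ be a cosystem with spectral subspaces $\mathcal A_g$ ($g\in G$), and let $\iota : \mathcal A \to \mathrm{C}^*_{\mathrm{env}}(\mathcal A)$ be the natural inclusion of $\mathcal A$ in its (usual) C*-envelope. Let $\mathrm{C}^*(\iota(a_g)\otimes u_g \mid g\in G)$ denote the C*-subalgebra of $\mathrm{C}^*_{\mathrm{env}}(\mathcal A)\otimes \mathrm{C}^*(G)$ generated by all elements $\iota(a)\otimes u_g$ with $a\in \mathcal A_g$, $g\in G$. Then the triple $$\left( \mathrm{C}^*(\iota(a_g) \otimes u_g \mid g \in G),\ (\iota \otimes \mathrm{id}_{\mathrm{C}^*(G)})\, \delta,\ \mathrm{id} \otimes \Delta \right)$$ is (isomorphic to) the C*-envelope of the cosystem $(\mathcal A, G, \delta)$.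
   Context: Operator algebras are norm-closed subalgebras of some $\mathcal B(H)$, possibly nonselfadjoint and nonunital; $\otimes$ is the spatial (minimal) tensor product. $u_g$ ($g\in G$) are the canonical unitary generators of the full group C*-algebra $\mathrm{C}^*(G)$, and $\Delta:\mathrm{C}^*(G)\to \mathrm{C}^*(G)\otimes \mathrm{C}^*(G)$ is the faithful $*$-homomorphism with $\Delta(u_g)=u_g\otimes u_g$. Coaction and cosystem: a coaction of $G$ on an operator algebra $\mathcal A$ is a completely isometric homomorphism $\delta:\mathcal A\to\mathcal A\otimes \mathrm{C}^*(G)$ such that $\sum_{g}\mathcal A_g$ is norm-dense in $\mathcal A$, where $\mathcal A_g:=\{a\in\mathcal A\mid \delta(a)=a\otimes u_g\}$ are the spectral subspaces. The triple $(\mathcal A,G,\delta)$ is then called a cosystem. A map $\phi:\mathcal A\to\mathcal A'$ between cosystems $(\mathcal A,G,\delta)$, $(\mathcal A',G,\delta')$ is equivariant if $\delta'\phi=(\phi\otimes\mathrm{id})\delta$. A C*-cover of an operator algebra $\mathcal A$ is a pair $(C,\iota)$ with $\iota:\mathcal A\to C$ a completely isometric homomorphism into a C*-algebra and $C=\mathrm{C}^*(\iota(\mathcal A))$. The C*-envelope $(\mathrm{C}^*_{\mathrm{env}}(\mathcal A),\iota)$ is the C*-cover such that for every C*-cover $(C',\iota')$ there is a $*$-epimorphism $\phi:C'\to \mathrm{C}^*_{\mathrm{env}}(\mathcal A)$ with $\phi\iota'=\iota$. A C*-cover of a cosystem $(\mathcal A,G,\delta)$ is a triple $(C',\iota',\delta')$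 such that $(C',G,\delta')$ is a cosystem, $(C',\iota')$ is a C*-cover of $\mathcal A$ and $\iota'$ is equivariant. The C*-envelope of $(\mathcal A,G,\delta)$ is a C*-cover $(\mathrm{C}^*_{\mathrm{env}}(\mathcal A,G,\delta),\iota_{\mathrm{env}},\delta_{\mathrm{env}})$ of the cosystem such that for every C*-cover $(C',\iota',\delta')$ of $(\mathcal A,G,\delta)$ there is an equivariant $*$-epimorphism $\phi:C'\to \mathrm{C}^*_{\mathrm{env}}(\mathcal A,G,\delta)$ with $\phi\iota'=\iota_{\mathrm{env}}$. It is unique up to equivariant $*$-isomorphism intertwining the embeddings of $\mathcal A$. *)

(* Defs.v *)
From HB Require Import structures.
From mathcomp Require Import all_boot all_order all_algebra.
From mathcomp Require Import complex.
From mathcomp Require Import all_classical all_reals all_analysis.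
Set Implicit Arguments.
Unset Strict Implicit.
Unset Printing Implicit Defensive.
Import Order.TTheory GRing.Theory Num.Theory.
Import numFieldNormedType.Exports.
Local Open Scope classical_set_scope.
Local Open Scope ring_scope.

(* Operator algebras are represented concretely, as sets of functions H -> H
   on a complex Hilbert space H.  A map between operator algebras on H and K is
   a function (H -> H) -> (K -> K) of which only the values on the source
   algebra matter. *)

Record hilbert (R : realType) := Hilbert {
  hs_sort :> completeNormedModType R[i];
  inner : {dot hs_sort for (@Num.conj R[i])};
  hs_normE : forall x : hs_sort, `|x| ^+ 2 = inner x x }.

Notation op H := (hs_sort H -> hs_sort H).

Section Operators.
Variable R : realType.
Implicit Types H K : hilbert R.

(* The norm of a normedModType over R[i] takes values in R[i]. *)
Definition hnorm H (x : H) : R := complex.Re `|x|.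

Definition bounded_op H : set (op H) := [set a | linear a /\ continuous a].

(* Only meaningful for bounded a, otherwise sup returns 0. *)
Definition opnorm H (a : op H) : R :=
  sup [set hnorm (a x) | x in [set x | hnorm x <= 1]].

(* The norm of M_n(B(H)) = B(H^n), with H^n the Hilbert space direct sum. *)
Definition mxopnorm H n (a : 'M[op H]_n) : R :=
  sup [set Num.sqrt (\sum_i hnorm (\sum_j a i j (x j)) ^+ 2)
      | x in [set x : 'I_n -> H | \sum_j hnorm (x j) ^+ 2 <= 1]].

(* b = a^*; for a in B(H), such a b exists, is unique and is in B(H). *)
Definition is_adjoint H (a b : op H) : Prop :=
  forall x y : H, inner H (a x) y = inner H x (b y).

Definition unitary_op H (a : op H) : Prop :=
  bounded_op a /\ exists b, [/\ is_adjoint a b, a \o b = id & b \o a = id].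

Definition lspan (V : lmodType R[i]) (S : set V) : set V :=
  [set v | exists n (c : 'I_n -> R[i]) (s : 'I_n -> V),
    (forall i, S (s i)) /\ v = \sum_i c i *: s i].

Definition opclosure H (S : set (op H)) : set (op H) :=
  [set a | bounded_op a /\
     forall e : R, 0 < e -> exists2 s, S s & opnorm (a - s) < e].

Definition operator_algebra H (A : set (op H)) : Prop :=
  [/\ A `<=` @bounded_op H,
      A 0 /\ (forall (c : R[i]) a b, A a -> A b -> A (c *: a + b)),
      forall a b, A a -> A b -> A (a \o b)
    & opclosure A `<=` A].

Definition cstar_algebra H (A : set (op H)) : Prop :=
  operator_algebra A /\ forall a b, A a -> is_adjoint a b -> A b.

Definition cstar_gen H (S : set (op H)) : set (op H) :=
  smallest (@cstar_algebra H) S.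

Definition linear_on H K (A : set (op H)) (phi : op H -> op K) : Prop :=
  forall (c : R[i]) a b, A a -> A b -> phi (c *: a + b) = c *: phi a + phi b.

Definition alg_hom H K (A : set (op H)) (B : set (op K))
    (phi : op H -> op K) : Prop :=
  [/\ set_fun A B phi, linear_on A phi
    & forall a b, A a -> A b -> phi (a \o b) = phi a \o phi b].

Definition completely_isometric H K (A : set (op H))
    (phi : op H -> op K) : Prop :=
  forall n (a : 'M[op H]_n), (forall i j, A (a i j)) ->
    mxopnorm (map_mx phi a) = mxopnorm a.

Definition star_hom H K (A : set (op H)) (B : set (op K))
    (phi : op H -> op K) : Prop :=
  alg_hom A B phi /\
  forall a b, A a -> A b -> is_adjoint a b -> is_adjoint (phi a) (phi b).

Definition star_epi H K (A : set (op H)) (B : set (op K))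
    (phi : op H -> op K) : Prop :=
  star_hom A B phi /\ set_surj A B phi.

Definition cstar_cover H K (A : set (op H)) (C : set (op K))
    (iota : op H -> op K) : Prop :=
  [/\ cstar_algebra C, alg_hom A C iota, completely_isometric A iota
    & C = cstar_gen (iota @` A)].

Definition cstar_envelope H K (A : set (op H)) (C : set (op K))
    (iota : op H -> op K) : Prop :=
  cstar_cover A C iota /\
  forall (K' : hilbert R) (C' : set (op K')) (iota' : op H -> op K'),
    cstar_cover A C' iota' ->
    exists2 phi : op K' -> op K, star_epi C' C phi
      & forall a, A a -> phi (iota' a) = iota a.

End Operators.

(* The Hilbert space tensor product of H and K, which these properties
   determine up to a unique compatible unitary. *)
Record hilbert_tensor (R : realType) (H K : hilbert R) := HilbertTensor {
  ht_space :> hilbert R;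
  tens : H -> K -> ht_space;
  tens_linearl : forall y, linear (tens^~ y);
  tens_linearr : forall x, linear (tens x);
  tens_inner : forall x x' y y',
    inner ht_space (tens x y) (tens x' y') = inner H x x' * inner K y y';
  tens_dense : closure (lspan [set tens p.1 p.2 | p in [set: H * K]]) = setT }.

Section Tensor.
Variable R : realType.
(* A choice of Hilbert space tensor product for each pair of spaces. *)
Variable tp : forall H K : hilbert R, hilbert_tensor H K.
Implicit Types H K L : hilbert R.

(* a (x) b for bounded a and b, for which the operator described exists and is
   unique. *)
Definition optens H K (a : op H) (b : op K) : op (tp H K) :=
  xget 0 [set t : op (tp H K) | bounded_op t /\
    forall x y, t (tens (tp H K) x y) = tens (tp H K) (a x) (b y)].

Definition spatial H K (A : set (op H)) (B : set (op K)) :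
    set (op (tp H K)) :=
  opclosure (lspan [set t | exists a b, [/\ A a, B b & t = optens a b]]).

(* phi (x) psi on the spatial tensor product of A and B: the bounded linear
   extension of a (x) b |-> phi a (x) psi b.  It exists whenever phi and psi are
   completely bounded, and its values on spatial A B are then unique. *)
Definition maptens H H' K K' (A : set (op H)) (B : set (op K))
    (phi : op H -> op H') (psi : op K -> op K') :
    op (tp H K) -> op (tp H' K') :=
  xget (fun=> 0) [set Phi : op (tp H K) -> op (tp H' K') |
    [/\ set_fun (spatial A B) (@bounded_op R (tp H' K')) Phi,
        linear_on (spatial A B) Phi,
        exists M : R, forall t, spatial A B t ->
          opnorm (Phi t) <= M * opnorm t
      & forall a b, A a -> B b ->
          Phi (optens a b) = optens (phi a) (psi b)]].

(* The canonical unitary H (x) (K (x) L) -> (H (x) K) (x) L and its inverse. *)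
Definition tassoc H K L : tp H (tp K L) -> tp (tp H K) L :=
  xget (fun=> 0) [set W : tp H (tp K L) -> tp (tp H K) L |
    [/\ linear W, continuous W
      & forall x y z, W (tens (tp H (tp K L)) x (tens (tp K L) y z)) =
          tens (tp (tp H K) L) (tens (tp H K) x y) z]].

Definition tassoc_inv H K L : tp (tp H K) L -> tp H (tp K L) :=
  xget (fun=> 0) [set W : tp (tp H K) L -> tp H (tp K L) |
    [/\ linear W, continuous W
      & forall x y z, W (tens (tp (tp H K) L) (tens (tp H K) x y) z) =
          tens (tp H (tp K L)) x (tens (tp K L) y z)]].

Variable G : groupType.

Definition unitary_rep H (u : G -> op H) : Prop :=
  (forall g, unitary_op (u g)) /\ forall g h, u (g * h)%g = u g \o u h.

Definition group_cstar K (u : G -> op K) : set (op K) := cstar_gen (range u).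

(* group_cstar u is the full group C*-algebra of G, faithfully and
   nondegenerately represented on K, with canonical generators u g. *)
Definition full_group_rep K (u : G -> op K) : Prop :=
  unitary_rep u /\
  forall (L : hilbert R) (v : G -> op L), unitary_rep v ->
    exists2 pi : op K -> op L, star_hom (group_cstar u) (@bounded_op R L) pi
      & forall g, pi (u g) = v g.

Definition comultiplication K (u : G -> op K)
    (Delta : op K -> op (tp K K)) : Prop :=
  [/\ star_hom (group_cstar u) (spatial (group_cstar u) (group_cstar u)) Delta,
      set_inj (group_cstar u) Delta
    & forall g, Delta (u g) = optens (u g) (u g)].

Section Cosystems.
Variables (K : hilbert R) (u : G -> op K).

Definition spectral H (A : set (op H)) (delta : op H -> op (tp H K)) (g : G) :
    set (op H) :=
  [set a | A a /\ delta a = optens a (u g)].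

Definition cosystem H (A : set (op H)) (delta : op H -> op (tp H K)) : Prop :=
  [/\ operator_algebra A, alg_hom A (spatial A (group_cstar u)) delta,
      completely_isometric A delta
    & A `<=` opclosure (lspan (\bigcup_g spectral A delta g))].

Definition equivariant H H' (A : set (op H)) (delta : op H -> op (tp H K))
    (delta' : op H' -> op (tp H' K)) (phi : op H -> op H') : Prop :=
  forall a, A a -> delta' (phi a) = maptens A (group_cstar u) phi id (delta a).

Definition cosystem_cover H H' (A : set (op H)) (delta : op H -> op (tp H K))
    (C' : set (op H')) (iota' : op H -> op H')
    (delta' : op H' -> op (tp H' K)) : Prop :=
  [/\ cosystem C' delta', cstar_cover A C' iota'
    & equivariant A delta delta' iota'].

Definition cosystem_envelope H E (A : set (op H)) (delta : op H -> op (tp H K))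
    (C : set (op E)) (iota : op H -> op E)
    (delta_env : op E -> op (tp E K)) : Prop :=
  cosystem_cover A delta C iota delta_env /\
  forall (H' : hilbert R) (C' : set (op H')) (iota' : op H -> op H')
      (delta' : op H' -> op (tp H' K)),
    cosystem_cover A delta C' iota' delta' ->
    exists phi : op H' -> op E,
      [/\ star_epi C' C phi, equivariant C' delta' delta_env phi
        & forall a, A a -> phi (iota' a) = iota a].

(* id (x) Delta on C (x) C*(G), with its values transported from operators on
   E (x) (K (x) K) to operators on (E (x) K) (x) K. *)
Definition id_tens_comult E (C : set (op E)) (Delta : op K -> op (tp K K))
    (t : op (tp E K)) : op (tp (tp E K) K) :=
  @tassoc E K K \o maptens C (group_cstar u) id Delta t \o @tassoc_inv E K K.

(* C*(iota(a_g) (x) u_g | g in G) *)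
Definition spectral_cstar H E (A : set (op H)) (delta : op H -> op (tp H K))
    (iota : op H -> op E) : set (op (tp E K)) :=
  cstar_gen [set t | exists g a,
    spectral A delta g a /\ t = optens (iota a) (u g)].

End Cosystems.
End Tensor.

(* Main.v *)
(** Write [E] for the Hilbert space of the C*-envelope of [A], [K] for that of
    C*(G), [u] for the generating unitaries and [pi : C*(G) -> C] for the trivial
    representation.  The map iota (x) id is completely isometric on [A] (x) C*(G),
    because the norm of an operator on [H] (x) [K] is determined by its compressions
    to orthonormal families of [K], which are matrices over [A].  Hence
    (iota (x) id) delta embeds [A] completely isometrically.  The coaction id (x) Delta
    is a star-homomorphism with the completely contractive left inverse
    id (x) id (x) [pi], so it is completely isometric.

    For the universal property, let [(C', iota', delta')] be a cover of the cosystem.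
    A contractive homomorphism of a C*-algebra preserves adjoints, so delta' does,
    and the star-epimorphism [phi0] from [C'] onto the C*-envelope gives the
    star-homomorphism [phi] = ([phi0] (x) id) delta'.  It maps iota' [a] to
    iota [a] (x) [u g] for [a] in the [g]-th spectral subspace; as the range of a
    star-homomorphism is a C*-algebra, [phi] is onto.

    That star-homomorphisms are contractive with closed range is derived without
    spectral theory, from the substitution x = 2 w (1 + w^2)^-1. *)
From HB Require Import structures.
Require Import Defs.
From mathcomp Require Import all_boot all_order all_algebra.
From mathcomp Require Import complex.
From mathcomp Require Import all_classical all_reals all_analysis.
From mathcomp Require Import ring lra.
Set Implicit Arguments.
Unset Strict Implicit.
Unset Printing Implicit Defensive.
Import Order.TTheory GRing.Theory Num.Theory.
Import numFieldNormedType.Exports.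
Local Open Scope classical_set_scope.
Local Open Scope ring_scope.

(** * Hilbert spaces and bounded operators *)

(** Three obstacles shape the development. Maps such as iota (x) id come from a choice operator, and
    a tensor has many expansions. A map is therefore obtained as the norm closure of a linear
    relation: a single estimate, complete contractivity of that relation, makes the closure
    single-valued, defined everywhere and bounded, and the same estimate for the converse relation
    gives the isometry. Algebras need not be unital. Banach's fixed-point theorem in closed sets of
    operators takes the place of functional calculus, and the substitution in [w] is chosen because
    2 v (1 + v^2)^-1 has norm at most 1 however large the self-adjoint [v] is; this controls norms
    of images and of preimages alike. A coaction on a cover is only a completely isometric
    homomorphism, possibly degenerate. The numerical-range argument for unital maps is run with an
    approximate unit; it reaches only vectors in the range, so the orthogonal complement of the
    range needs an argument of its own. *)

Lemma ler_sq (R : realType) (x y : R) : 0 <= x -> 0 <= y ->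
  (x ^+ 2 <= y ^+ 2) = (x <= y).
Proof. by move=> x0 y0; rewrite ler_pXn2r ?nnegrE. Qed.

Section ComplexModulus.
Variable R : realType.
Implicit Types c d : R[i].

Definition cabs c : R := complex.Re `|c|.

Lemma cabsE c : `|c| = (cabs c)%:C%C.
Proof. by rewrite /cabs RRe_real// normr_real. Qed.

Lemma cabs_ge0 c : 0 <= cabs c.
Proof. by rewrite -ler0c -cabsE normr_ge0. Qed.

Lemma cabsM c d : cabs (c * d) = cabs c * cabs d.
Proof. by apply: (@complexI R); rewrite rmorphM/= -!cabsE normrM. Qed.

Lemma cabs_real (r : R) : cabs r%:C%C = `|r|.
Proof. by rewrite /cabs normc_def/= expr0n addr0 sqrtr_sqr. Qed.

Lemma cabsN c : cabs (- c) = cabs c.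
Proof. by rewrite /cabs normrN. Qed.

Lemma cabs_i : cabs ('i%C : R[i]) = 1.
Proof. by rewrite /cabs normc_def /= expr0n expr1n add0r sqrtr1. Qed.

Lemma cRe_le_cabs c : complex.Re c <= cabs c.
Proof.
rewrite (le_trans (ler_norm _))// -lecR -cabsE.
exact: normc_ge_Re.
Qed.

Lemma cabs_sqr c : c * c^* = (cabs c ^+ 2)%:C%C.
Proof. by rewrite rmorphXn/= -cabsE normCK. Qed.

Lemma cReD c d : complex.Re (c + d) = complex.Re c + complex.Re d.
Proof. by case: c; case: d. Qed.

Lemma cReN c : complex.Re (- c) = - complex.Re c.
Proof. by case: c. Qed.

Lemma cRe_conj c : complex.Re c^* = complex.Re c.
Proof. by case: c. Qed.

Lemma cReZ (r : R) c : complex.Re (r%:C%C * c) = r * complex.Re c.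
Proof. by case: c => a b /=; rewrite mul0r subr0. Qed.

Lemma cReMi c : complex.Re ('i%C * c) = - complex.Im c.
Proof. by case: c => a b /=; rewrite mul0r mul1r add0r. Qed.

Lemma cRe_sum I (s : seq I) (P : pred I) (F : I -> R[i]) :
  complex.Re (\sum_(i <- s | P i) F i) = \sum_(i <- s | P i) complex.Re (F i).
Proof. exact: (big_morph _ cReD). Qed.

Lemma complex_eq c d : complex.Re c = complex.Re d ->
  complex.Im c = complex.Im d -> c = d.
Proof. by case: c; case: d => a b a' b' /= -> ->. Qed.

Lemma conj_realC (r : R) : (r%:C%C)^* = r%:C%C :> R[i].
Proof. by apply: complex_eq => //=; rewrite oppr0. Qed.

Lemma scale_halfD (V : lmodType R[i]) (v : V) :
  (2^-1 : R)%:C%C *: v + (2^-1 : R)%:C%C *: v = v.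
Proof. by rewrite -scalerDl -rmorphD/= -[2^-1]mul1r -splitr scale1r. Qed.

End ComplexModulus.

Section Hilbert.
Variable R : realType.
Implicit Types (H : hilbert R) (c : R[i]).

Lemma innerDl H (x y z : H) : inner H (x + y) z = inner H x z + inner H y z.
Proof. by rewrite linearDl. Qed.
Lemma innerDr H (x y z : H) : inner H x (y + z) = inner H x y + inner H x z.
Proof. by rewrite linearDr. Qed.
Lemma innerZl H c (x y : H) : inner H (c *: x) y = c * inner H x y.
Proof. by rewrite linearZl_LR. Qed.
Lemma innerZr H c (x y : H) : inner H x (c *: y) = c^* * inner H x y.
Proof. by rewrite linearZr_LR. Qed.
Lemma inner0l H (x : H) : inner H 0 x = 0. Proof. by rewrite linear0l. Qed.
Lemma inner0r H (x : H) : inner H x 0 = 0. Proof. by rewrite linear0r. Qed.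
Lemma innerNl H (x y : H) : inner H (- x) y = - inner H x y.
Proof. by rewrite linearNl. Qed.
Lemma innerNr H (x y : H) : inner H x (- y) = - inner H x y.
Proof. by rewrite linearNr. Qed.
Lemma innerBl H (x y z : H) : inner H (x - y) z = inner H x z - inner H y z.
Proof. by rewrite innerDl innerNl. Qed.
Lemma innerBr H (x y z : H) : inner H x (y - z) = inner H x y - inner H x z.
Proof. by rewrite innerDr innerNr. Qed.
Lemma inner_suml H I (s : seq I) (P : pred I) (F : I -> H) z :
  inner H (\sum_(i <- s | P i) F i) z = \sum_(i <- s | P i) inner H (F i) z.
Proof. by rewrite linear_sumlz. Qed.
Lemma inner_sumr H I (s : seq I) (P : pred I) (F : I -> H) z :
  inner H z (\sum_(i <- s | P i) F i) = \sum_(i <- s | P i) inner H z (F i).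
Proof. by rewrite linear_sumr. Qed.
Lemma innerC H (x y : H) : inner H y x = (inner H x y)^*.
Proof. by rewrite (hermC (inner H)) expr0 mul1r. Qed.

Lemma hnormC H (x : H) : `|x| = (hnorm x)%:C%C.
Proof. by rewrite /hnorm RRe_real// normr_real. Qed.

Lemma hnormE H (x : H) : inner H x x = (hnorm x ^+ 2)%:C%C.
Proof. by rewrite -hs_normE hnormC rmorphXn. Qed.

Lemma hnorm_sqr H (x : H) : hnorm x ^+ 2 = complex.Re (inner H x x).
Proof. by rewrite hnormE. Qed.

Lemma hnorm_ge0 H (x : H) : 0 <= hnorm x.
Proof. by rewrite -ler0c -hnormC normr_ge0. Qed.

Lemma hnorm0 H : hnorm (0 : H) = 0.
Proof. by rewrite /hnorm normr0. Qed.

Lemma hnorm_eq0 H (x : H) : hnorm x = 0 -> x = 0.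
Proof. by move=> x0; apply/normr0_eq0; rewrite hnormC x0. Qed.

Lemma hnorm_gt0 H (x : H) : (0 < hnorm x) = (x != 0).
Proof.
rewrite lt_neqAle hnorm_ge0 andbT eq_sym; congr (~~ _).
by apply/eqP/eqP => [/hnorm_eq0|->]; last exact: hnorm0.
Qed.

Lemma hnormZ H c (x : H) : hnorm (c *: x) = cabs c * hnorm x.
Proof. by apply: (@complexI R); rewrite rmorphM/= -!hnormC -cabsE normrZ. Qed.

Lemma hnormD H (x y : H) : hnorm (x + y) <= hnorm x + hnorm y.
Proof. by rewrite -lecR rmorphD/= -!hnormC ler_normD. Qed.

Lemma hnormN H (x : H) : hnorm (- x) = hnorm x.
Proof. by rewrite /hnorm normrN. Qed.

Lemma hnormBC H (x y : H) : hnorm (x - y) = hnorm (y - x).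
Proof. by rewrite /hnorm distrC. Qed.

Lemma hnormB H (x y : H) : hnorm (x - y) <= hnorm x + hnorm y.
Proof. by rewrite (le_trans (hnormD _ _))// hnormN. Qed.

Lemma hnorm_sum H I (s : seq I) (P : pred I) (F : I -> H) :
  hnorm (\sum_(i <- s | P i) F i) <= \sum_(i <- s | P i) hnorm (F i).
Proof.
elim/big_rec2: _ => [|i y x _ h]; first by rewrite hnorm0.
by rewrite (le_trans (hnormD _ _))// lerD.
Qed.

Lemma hnormD2 H (x y : H) :
  hnorm (x + y) ^+ 2 = hnorm x ^+ 2 + hnorm y ^+ 2 + complex.Re (inner H x y) *+ 2.
Proof.
rewrite !hnorm_sqr innerDl !innerDr !cReD (innerC x y) cRe_conj; ring.
Qed.

Lemma hnormB2 H (x y : H) :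
  hnorm (x - y) ^+ 2 = hnorm x ^+ 2 + hnorm y ^+ 2 - complex.Re (inner H x y) *+ 2.
Proof. by rewrite hnormD2 hnormN innerNr cReN mulNrn. Qed.

Lemma CauchySchwarz_hnorm H (x y : H) : cabs (inner H x y) <= hnorm x * hnorm y.
Proof.
have [y0|yn0] := eqVneq (hnorm y) 0.
  by rewrite (hnorm_eq0 y0) inner0r hnorm0 mulr0 /cabs normr0.
have yp : 0 < hnorm y ^+ 2 by rewrite exprn_gt0// lt_neqAle eq_sym yn0 hnorm_ge0.
rewrite -ler_sq ?cabs_ge0 ?mulr_ge0 ?hnorm_ge0//.
set a := inner H x y.
(* The vector is [|y|^2] times the component of [x] orthogonal to [y]; this scaling avoids
   division. *)
have := sqr_ge0 (hnorm (((hnorm y ^+ 2)%:C%C) *: x - a *: y)).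
rewrite hnormB2 !hnormZ !exprMn innerZl innerZr -/a.
have -> : (hnorm y ^+ 2)%:C%C * (a^* * a) = (hnorm y ^+ 2 * cabs a ^+ 2)%:C%C.
  by rewrite mulrC (mulrC a^*) cabs_sqr [RHS]rmorphM [RHS]mulrC.
rewrite /= cabs_real (ger0_norm (ltW yp)).
set X := hnorm x; set Y := hnorm y; set A := cabs a.
have -> : (Y ^+ 2) ^+ 2 * X ^+ 2 + A ^+ 2 * Y ^+ 2 - (Y ^+ 2 * A ^+ 2) *+ 2 =
  Y ^+ 2 * (X ^+ 2 * Y ^+ 2 - A ^+ 2) by ring.
by rewrite pmulr_rge0 // subr_ge0.
Qed.

Lemma cRe_inner_le H (x y : H) : complex.Re (inner H x y) <= hnorm x * hnorm y.
Proof. exact: le_trans (cRe_le_cabs _) (CauchySchwarz_hnorm _ _). Qed.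

Lemma inner_extr H (x x' : H) : (forall y, inner H y x = inner H y x') -> x = x'.
Proof.
move=> h; apply/eqP; rewrite -subr_eq0; apply/eqP/hnorm_eq0/eqP.
by rewrite -sqrf_eq0 hnorm_sqr innerBr h subrr eqxx.
Qed.

Lemma inner_extl H (x x' : H) : (forall y, inner H x y = inner H x' y) -> x = x'.
Proof. by move=> h; apply: inner_extr => y; rewrite innerC h -innerC. Qed.

Lemma closure_hnormP H (S : set H) x :
  closure S x <-> forall e : R, 0 < e -> exists2 y, S y & hnorm (x - y) < e.
Proof.
split=> [cS e e0|h B /nbhs_ballP[[e ei]/=]].
  have e0' : 0 < e%:C%C by rewrite ltcR.
  have [y [Sy xy]] := cS _ (nbhsx_ballx x _ e0').
  by exists y => //; move: xy; rewrite -ball_normE/= hnormC ltcR.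
rewrite ltcE => /=/andP[/eqP ei0 e0] sB; have [y Sy xy] := h e e0.
exists y; split=> //; apply: sB; rewrite -ball_normE/= hnormC.
by move: ei0 => ->; rewrite ltcR.
Qed.

Definition cvs H (s : nat -> H) l := forall e : R, 0 < e ->
  exists N, forall n, (N <= n)%N -> hnorm (s n - l) < e.

Lemma hilbert_complete H (s : nat -> H) :
  (forall e : R, 0 < e -> exists N, forall m n, (N <= m)%N -> (N <= n)%N ->
    hnorm (s m - s n) < e) -> exists l, cvs s l.
Proof.
move=> cs.
have /cauchy_cvg/cvg_ex[l sl] : cauchy (s @ \oo).
  apply/cauchy_ballP => -[e ei]; rewrite ltcE/= => /andP[/eqP ei0 e0].
  have [N sN] := cs e e0.
  have near_N : \forall x \near s @ \oo, exists2 n, (N <= n)%N & x = s n.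
    by exists N => // n /= Nn; exists n.
  exists ([set x | exists2 n, (N <= n)%N & x = s n],
          [set x | exists2 n, (N <= n)%N & x = s n]) => //=.
  move=> [x y] /= [[n Nn ->] [m Nm ->]].
  by rewrite -ball_normE/= hnormC ei0 ltcR sN.
exists l => e e0; move/cvgrPdist_lt : sl => /(_ e%:C%C).
rewrite ltcR => /(_ e0)[N _ hN]; exists N => n Nn.
by have := hN n Nn; rewrite hnormC ltcR hnormBC.
Qed.

Lemma cvs_unique H (s : nat -> H) l l' : cvs s l -> cvs s l' -> l = l'.
Proof.
move=> sl sl'; apply/eqP; rewrite -subr_eq0; apply/eqP/hnorm_eq0/eqP.
rewrite eq_le hnorm_ge0 andbT; apply/ler_addgt0Pl => e e0; rewrite addr0.
have e2 : 0 < e / 2 by rewrite divr_gt0.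
have [N hN] := sl _ e2; have [N' hN'] := sl' _ e2.
have h := hN _ (leq_maxl N N'); have h' := hN' _ (leq_maxr N N').
rewrite -(subrKA (s (maxn N N'))) (le_trans (hnormD _ _))// hnormBC.
by rewrite [leRHS](splitr e) lerD// ltW.
Qed.

Lemma hnormZD_close H c (x y x' y' : H) (e : R) :
  hnorm (x - x') < e / 2 / (cabs c + 1) -> hnorm (y - y') < e / 2 ->
  hnorm (c *: x + y - (c *: x' + y')) < e.
Proof.
move=> h h'; have c1 : 0 < cabs c + 1 by rewrite ltr_wpDl ?cabs_ge0.
rewrite opprD addrACA -scalerBr (le_lt_trans (hnormD _ _))// hnormZ.
rewrite [ltRHS]splitr ler_ltD//.
move: h; rewrite ltr_pdivlMr// mulrC => /ltW/(le_trans _); apply.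
by rewrite ler_wpM2r ?hnorm_ge0// lerDl.
Qed.

Lemma cvsZD H c (s t : nat -> H) l m : cvs s l -> cvs t m ->
  cvs (fun n => c *: s n + t n) (c *: l + m).
Proof.
move=> sl tm e e0.
have c1 : 0 < cabs c + 1 by rewrite ltr_wpDl ?cabs_ge0.
have e2 : 0 < e / 2 by rewrite divr_gt0.
have [N hN] := sl _ (divr_gt0 e2 c1); have [N' hN'] := tm _ e2.
exists (maxn N N') => n; rewrite geq_max => /andP[Nn N'n].
by apply: hnormZD_close; [exact: hN|exact: hN'].
Qed.

End Hilbert.

(* An identity between vectors is checked after pairing with a vector, where it
   becomes a ring identity in the complex numbers. *)
Ltac hring :=
  apply: inner_extl => ?; rewrite !(innerDl, innerNl, innerZl, inner0l); ring.

Section BoundedMaps.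
Variable R : realType.
Implicit Types (H K L : hilbert R) (c : R[i]).

Definition bmap H K (f : H -> K) : Prop :=
  linear f /\ exists M : R, forall x, hnorm (f x) <= M * hnorm x.

Lemma linear_fD H K (f : H -> K) : linear f -> forall x y, f (x + y) = f x + f y.
Proof. by move=> lf x y; rewrite -[x]scale1r lf !scale1r. Qed.

Lemma linear_f0 H K (f : H -> K) : linear f -> f 0 = 0.
Proof.
by move=> lf; apply: (@addrI _ (f 0)); rewrite addr0 -(linear_fD lf) addr0.
Qed.

Lemma linear_fZ H K (f : H -> K) : linear f -> forall c x, f (c *: x) = c *: f x.
Proof. by move=> lf c x; rewrite -[c *: x]addr0 lf (linear_f0 lf) addr0. Qed.

Lemma linear_fN H K (f : H -> K) : linear f -> forall x, f (- x) = - f x.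
Proof. by move=> lf x; rewrite -scaleN1r (linear_fZ lf) scaleN1r. Qed.

Lemma linear_fB H K (f : H -> K) : linear f -> forall x y, f (x - y) = f x - f y.
Proof. by move=> lf x y; rewrite (linear_fD lf) (linear_fN lf). Qed.

Lemma linear_fsum H K (f : H -> K) : linear f ->
  forall I (s : seq I) (P : pred I) F,
  f (\sum_(i <- s | P i) F i) = \sum_(i <- s | P i) f (F i).
Proof.
move=> lf I s P F; exact: (big_morph _ (linear_fD lf) (linear_f0 lf)).
Qed.

Lemma linear_continuousP H K (f : H -> K) : linear f ->
  continuous f <-> exists M : R, forall x, hnorm (f x) <= M * hnorm x.
Proof.
move=> lf; split=> [cf|[M fM] x].
  have /cvgrPdist_lt/(_ 1 ltr01) := cf 0.
  move=> /nbhs_ballP[[d di]]; rewrite /= ltcE => /=/andP[/eqP di0 d0] hd.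
  exists (2 / d) => x.
  have [->|xn0] := eqVneq x 0; first by rewrite (linear_f0 lf) !hnorm0 mulr0.
  have xp : 0 < hnorm x by rewrite hnorm_gt0.
  (* Halving keeps the rescaled vector strictly inside the open ball of radius [d], whence the bound
     [2 / d]. *)
  pose r := d / 2 / hnorm x.
  have r0 : 0 < r by rewrite !divr_gt0.
  have := hd (r%:C%C *: x).
  rewrite -ball_normE/= sub0r normrN hnormC hnormZ cabs_real gtr0_norm//.
  rewrite di0 ltcR /r divfK ?gt_eqF// ltr_pdivrMr// ltr_pMr// ltr1n.
  move=> /(_ isT); rewrite (linear_f0 lf) sub0r normrN hnormC (linear_fZ lf).
  rewrite hnormZ cabs_real gtr0_norm// -(rmorph1 (real_complex R)) ltcR => h.
  have -> : 2 / d * hnorm x = r^-1 by rewrite /r !invfM !invrK (mulrC 2).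
  by rewrite -[r^-1]mul1r ler_pdivlMr// mulrC ltW.
apply/cvgrPdist_lt => -[e ei]; rewrite ltcE/= => /andP[/eqP ei0 e0].
have M0 : 0 < `|M| + 1 by rewrite ltr_wpDl.
apply/nbhs_ballP; exists (e / (`|M| + 1))%:C%C => /=.
  by rewrite ltcR divr_gt0.
move=> y; rewrite -ball_normE/= hnormC ltcR -(linear_fB lf) ltr_pdivlMr// => xy.
rewrite hnormC ei0 ltcR (le_lt_trans _ xy)// (le_trans (fM _))// mulrC.
by rewrite ler_wpM2l ?hnorm_ge0// (le_trans (ler_norm _))// lerDl.
Qed.

Lemma bounded_opE H (a : op H) : bounded_op a <-> bmap a.
Proof.
split=> -[la]; first by move=> /(linear_continuousP la).
by move=> /(linear_continuousP la).
Qed.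

Lemma linear_comp H K L (f : K -> L) (g : H -> K) :
  linear f -> linear g -> linear (f \o g).
Proof. by move=> lf lg c x y /=; rewrite lg lf. Qed.

Lemma bmap_bound H K (f : H -> K) : bmap f ->
  exists2 M : R, 0 <= M & forall x, hnorm (f x) <= M * hnorm x.
Proof.
move=> [_ [M fM]]; exists `|M| => // x.
by rewrite (le_trans (fM _))// ler_wpM2r ?hnorm_ge0 ?ler_norm.
Qed.

Lemma bmap_comp H K L (f : K -> L) (g : H -> K) :
  bmap f -> bmap g -> bmap (f \o g).
Proof.
move=> bf bg; split; first exact: linear_comp bf.1 bg.1.
have [M M0 fM] := bmap_bound bf; have [N N0 gN] := bmap_bound bg.
exists (M * N) => x /=; rewrite (le_trans (fM _))// -mulrA.
by rewrite ler_wpM2l.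
Qed.

Lemma eq_on_dense H K (S : set H) (f g : H -> K) : bmap f -> bmap g ->
  closure (lspan S) = setT -> (forall x, S x -> f x = g x) -> f = g.
Proof.
move=> bf bg dS fg; apply/funext => x.
have [M M0 fM] := bmap_bound bf; have [N N0 gN] := bmap_bound bg.
apply/eqP; rewrite -subr_eq0; apply/eqP/hnorm_eq0/eqP.
rewrite eq_le hnorm_ge0 andbT; apply/ler_addgt0Pl => e e0; rewrite addr0.
have : closure (lspan S) x by rewrite dS.
have MN1 : 0 < M + N + 1 by rewrite ltr_wpDl// addr_ge0.
move=> /closure_hnormP/(_ (e / (M + N + 1))); rewrite divr_gt0// => /(_ isT).
move=> [y [n [c [s [Ss yE]]]] xy].
have fgy : f y = g y.
  rewrite yE !(linear_fsum bf.1, linear_fsum bg.1); apply: eq_bigr => i _.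
  by rewrite (linear_fZ bf.1) (linear_fZ bg.1) fg.
have -> : f x - g x = f (x - y) - g (x - y).
  by rewrite (linear_fB bf.1) (linear_fB bg.1) fgy opprB addrA subrK.
rewrite (le_trans (hnormB _ _))// (le_trans (lerD (fM _) (gN _)))//.
rewrite -mulrDl; rewrite ltr_pdivlMr// mulrC in xy.
by rewrite (le_trans _ (ltW xy))// ler_wpM2r ?hnorm_ge0// lerDl.
Qed.

End BoundedMaps.

Section BoundedOperators.
Variables (R : realType) (H : hilbert R).
Implicit Types (a b : op H) (c : R[i]) (C : R).

Lemma bop_linear a : bounded_op a -> linear a. Proof. by case. Qed.

Lemma bop0 : bounded_op (0 : op H).
Proof.
apply/bounded_opE; split=> [c x y|]; first by rewrite scaler0 addr0.
by exists 0 => x; rewrite mul0r hnorm0.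
Qed.

Lemma bop_id : bounded_op (id : op H).
Proof. by apply/bounded_opE; split=> //; exists 1 => x; rewrite mul1r. Qed.

Lemma bopZD c a b : bounded_op a -> bounded_op b -> bounded_op (c *: a + b).
Proof.
move=> /bounded_opE ba /bounded_opE bb; apply/bounded_opE; split=> [d x y|].
  rewrite !fctE ba.1 bb.1 !scalerDr !scalerA (mulrC c) -!addrA; congr (_ + _).
  by rewrite addrCA.
have [M M0 aM] := bmap_bound ba; have [N N0 bN] := bmap_bound bb.
exists (cabs c * M + N) => x; rewrite !fctE (le_trans (hnormD _ _))// hnormZ.
by rewrite mulrDl lerD// -mulrA ler_wpM2l ?cabs_ge0.
Qed.

Lemma bopZ c a : bounded_op a -> bounded_op (c *: a).
Proof. by move=> ba; rewrite -[_ *: _]addr0; apply: bopZD => //; apply: bop0. Qed.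

Lemma bopD a b : bounded_op a -> bounded_op b -> bounded_op (a + b).
Proof. by move=> ba bb; rewrite -[a]scale1r; apply: bopZD. Qed.

Lemma bopN a : bounded_op a -> bounded_op (- a).
Proof. by move=> ba; rewrite -scaleN1r; apply: bopZ. Qed.

Lemma bopB a b : bounded_op a -> bounded_op b -> bounded_op (a - b).
Proof. by move=> ba bb; apply: bopD => //; apply: bopN. Qed.

Lemma bop_comp a b : bounded_op a -> bounded_op b -> bounded_op (a \o b).
Proof.
by move=> /bounded_opE ba /bounded_opE bb; apply/bounded_opE/bmap_comp.
Qed.

Lemma bop_sum I (s : seq I) (P : pred I) (F : I -> op H) :
  (forall i, P i -> bounded_op (F i)) ->
  bounded_op (\sum_(i <- s | P i) F i).
Proof.
by move=> bF; elim/big_ind: _ => //; [exact: bop0 | exact: bopD].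
Qed.

Lemma opnorm_ub a C : 0 <= C -> (forall x, hnorm (a x) <= C * hnorm x) ->
  opnorm a <= C.
Proof.
move=> C0 aC; apply: ge_sup.
  by exists (hnorm (a 0)), 0 => //=; rewrite hnorm0 ler01.
move=> _ [x /= x1 <-]; rewrite (le_trans (aC _))//.
by rewrite -[leRHS]mulr1 ler_wpM2l.
Qed.

Lemma bop_has_sup a : bounded_op a ->
  has_sup [set hnorm (a x) | x in [set x | hnorm x <= 1]].
Proof.
move=> /bounded_opE ba; have [M M0 aM] := bmap_bound ba; split.
  by exists (hnorm (a 0)), 0 => //=; rewrite hnorm0 ler01.
exists M => _ [x /= x1 <-]; rewrite (le_trans (aM _))//.
by rewrite -[leRHS]mulr1 ler_wpM2l.
Qed.

(** Holds for every function [a]: either the supremum exists and dominates the norm of [a 0], or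
    [sup] takes its default value 0. *)
Lemma opnorm_ge0 a : 0 <= opnorm a.
Proof.
rewrite /opnorm; set S := [set _ | _ in _].
have [hS|/sup_out -> //] := pselect (has_sup S).
apply: le_trans (hnorm_ge0 (a 0)) _; apply: ub_le_sup; first exact: hS.2.
by exists 0 => //=; rewrite hnorm0 ler01.
Qed.

Lemma le_opnorm a x : bounded_op a -> hnorm (a x) <= opnorm a * hnorm x.
Proof.
move=> ba; have la := bop_linear ba.
have [->|xn0] := eqVneq x 0; first by rewrite (linear_f0 la) !hnorm0 mulr0.
have xp : 0 < hnorm x by rewrite hnorm_gt0.
rewrite -ler_pdivrMr//; apply: ub_le_sup; first exact: (bop_has_sup ba).2.
exists ((hnorm x)^-1%:C%C *: x).
  by rewrite /= hnormZ cabs_real ger0_norm ?invr_ge0 ?hnorm_ge0// mulVf ?gt_eqF.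
rewrite (linear_fZ la) hnormZ cabs_real ger0_norm ?invr_ge0 ?hnorm_ge0//.
by rewrite mulrC.
Qed.

Lemma opnormP a C : bounded_op a -> 0 <= C ->
  opnorm a <= C <-> forall x, hnorm (a x) <= C * hnorm x.
Proof.
move=> ba C0; split=> [aC x|]; last exact: opnorm_ub.
by rewrite (le_trans (le_opnorm _ ba))// ler_wpM2r ?hnorm_ge0.
Qed.

Lemma opnorm_bound a C x : bounded_op a -> opnorm a <= C ->
  hnorm (a x) <= C * hnorm x.
Proof.
by move=> ba aC; rewrite (le_trans (le_opnorm _ ba))// ler_wpM2r ?hnorm_ge0.
Qed.

Lemma contraction a x : bounded_op a -> opnorm a <= 1 -> hnorm (a x) <= hnorm x.
Proof. by move=> ba a1; rewrite -[leRHS]mul1r opnorm_bound. Qed.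

Lemma opnorm0 : opnorm (0 : op H) = 0.
Proof.
apply/eqP; rewrite eq_le opnorm_ge0 andbT; apply: opnorm_ub => // x.
by rewrite mul0r hnorm0.
Qed.

Lemma opnorm_eq0 a : bounded_op a -> opnorm a = 0 -> a = 0.
Proof.
move=> ba a0; apply/funext => x; apply/hnorm_eq0/eqP.
by rewrite eq_le hnorm_ge0 andbT (le_trans (le_opnorm _ ba))// a0 mul0r.
Qed.

Lemma opnormD a b : bounded_op a -> bounded_op b ->
  opnorm (a + b) <= opnorm a + opnorm b.
Proof.
move=> ba bb; apply: opnorm_ub => [|x]; first by rewrite addr_ge0 ?opnorm_ge0.
by rewrite mulrDl (le_trans (hnormD _ _))// lerD// le_opnorm.
Qed.

Lemma opnormZ c a : bounded_op a -> opnorm (c *: a) <= cabs c * opnorm a.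
Proof.
move=> ba; apply: opnorm_ub => [|x]; first by rewrite mulr_ge0 ?cabs_ge0 ?opnorm_ge0.
by rewrite !fctE hnormZ -mulrA ler_wpM2l ?cabs_ge0 ?le_opnorm.
Qed.

Lemma opnormN a : opnorm (- a) = opnorm a.
Proof.
rewrite /opnorm; congr (sup (_ @` _)); apply/funext => x.
exact: hnormN.
Qed.

Lemma opnormBC a b : opnorm (a - b) = opnorm (b - a).
Proof. by rewrite -opnormN opprB. Qed.

Lemma opnormB a b : bounded_op a -> bounded_op b ->
  opnorm (a - b) <= opnorm a + opnorm b.
Proof. by move=> ba bb; rewrite -(opnormN b) opnormD//; apply: bopN. Qed.

Lemma opnormM a b : bounded_op a -> bounded_op b ->
  opnorm (a \o b) <= opnorm a * opnorm b.
Proof.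
move=> ba bb; apply: opnorm_ub => [|x]; first by rewrite mulr_ge0 ?opnorm_ge0.
rewrite /= (le_trans (le_opnorm _ ba))// -mulrA ler_wpM2l ?opnorm_ge0//.
exact: le_opnorm.
Qed.

Lemma opnorm_dist_triangle b a d : bounded_op a -> bounded_op b -> bounded_op d ->
  opnorm (a - d) <= opnorm (a - b) + opnorm (b - d).
Proof.
move=> ba bb bd; by rewrite -(subrKA b) opnormD//; apply: bopB.
Qed.

Lemma opnormZD_close c a b a' b' (e : R) :
  bounded_op a -> bounded_op b -> bounded_op a' -> bounded_op b' ->
  opnorm (a - a') < e / 2 / (cabs c + 1) -> opnorm (b - b') < e / 2 ->
  opnorm (c *: a + b - (c *: a' + b')) < e.
Proof.
move=> ba bb ba' bb' h h'; rewrite opprD addrACA -scalerBr.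
have b1 := bopB ba ba'; have b2 := bopB bb bb'.
apply: le_lt_trans (opnormD (bopZ c b1) b2) _.
rewrite [ltRHS]splitr ler_ltD// (le_trans (opnormZ _ b1))//.
have c1 : 0 < cabs c + 1 by rewrite ltr_wpDl ?cabs_ge0.
move: h; rewrite ltr_pdivlMr// mulrC => /ltW/(le_trans _); apply.
by rewrite ler_wpM2r ?opnorm_ge0// lerDl.
Qed.

Lemma opnorm_comp_close a b a' b' (d : R) :
  bounded_op a -> bounded_op b -> bounded_op a' -> bounded_op b' -> d <= 1 ->
  opnorm (a - a') < d -> opnorm (b - b') < d ->
  opnorm ((a \o b) - (a' \o b')) <= d * (opnorm a + opnorm b + 1).
Proof.
move=> ba bb ba' bb' d1 /ltW h /ltW h'.
have -> : (a \o b) - (a' \o b') = ((a - a') \o b) + (a' \o (b - b')).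
  apply/funext => z; rewrite !fctE /= (linear_fB (bop_linear ba')).
  by rewrite addrA subrK.
have b1 := bopB ba ba'; have b2 := bopB bb bb'.
apply: le_trans (opnormD (bop_comp b1 bb) (bop_comp ba' b2)) _.
have := opnormM b1 bb; have := opnormM ba' b2.
(* Here [d <= 1] enters; it keeps the final bound linear in [d]. *)
have h3 : opnorm a' <= opnorm a + 1.
  rewrite -[a'](subrK a); apply: le_trans (opnormD (bopB ba' ba) ba) _.
  by rewrite addrC lerD2l opnormBC (le_trans h).
have h6 : opnorm a' * opnorm (b - b') <= (opnorm a + 1) * d.
  by rewrite ler_pM ?opnorm_ge0.
have h7 : opnorm (a - a') * opnorm b <= d * opnorm b.
  by rewrite ler_wpM2r ?opnorm_ge0.
lra.
Qed.

(** The limit is taken pointwise in the complete space [H]. The Cauchy condition is asked only for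
    ordered indices, the form that telescoping sums deliver. *)
Lemma op_complete (s : nat -> op H) : (forall n, bounded_op (s n)) ->
  (forall e : R, 0 < e -> exists N, forall m n, (N <= m <= n)%N ->
    opnorm (s m - s n) < e) ->
  exists2 a, bounded_op a &
    forall e : R, 0 < e -> exists N, forall n, (N <= n)%N -> opnorm (s n - a) < e.
Proof.
move=> bs cs0.
have cs (e : R) : 0 < e -> exists N, forall m n, (N <= m)%N -> (N <= n)%N ->
    opnorm (s m - s n) < e.
  move=> /cs0[N hN]; exists N => m n Nm Nn.
  case: (leqP m n) => [mn|/ltnW mn]; last rewrite opnormBC.
    by apply: hN; rewrite Nm.
  by apply: hN; rewrite Nn.
have /choice[a aE] : forall x, exists l, cvs (fun n => s n x) l.
  move=> x; apply: hilbert_complete => e e0.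
  have x1 : 0 < hnorm x + 1 by rewrite ltr_wpDl ?hnorm_ge0.
  have [N sN] := cs (e / (hnorm x + 1)) (divr_gt0 e0 x1); exists N => m n Nm Nn.
  have := sN m n Nm Nn; rewrite ltr_pdivlMr// => /(le_lt_trans _) -> //.
  have := le_opnorm x (bopB (bs m) (bs n)); rewrite !fctE => /le_trans -> //.
  by rewrite ler_wpM2l ?opnorm_ge0// lerDl.
(* The bound [e] does not depend on the vector, which upgrades pointwise convergence to convergence
   in norm. *)
have limE (e : R) N : (forall m n, (N <= m)%N -> (N <= n)%N ->
    opnorm (s m - s n) < e) -> forall n, (N <= n)%N ->
    forall x, hnorm (s n x - a x) <= e * hnorm x.
  move=> sN n Nn x; apply/ler_addgt0Pr => d d0.
  have [N' hN'] := aE x d d0.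
  have := hN' (maxn N N') (leq_maxr _ _).
  have := sN n (maxn N N') Nn (leq_maxl _ _).
  set m := maxn N N' => /ltW h1 /ltW h2.
  rewrite -(subrKA (s m x)) (le_trans (hnormD _ _))// lerD//.
  apply: le_trans (le_opnorm x (bopB (bs n) (bs m))) _.
  by rewrite ler_wpM2r ?hnorm_ge0.
have la : linear a.
  move=> c x y; apply: cvs_unique (aE _) _.
  have -> : (fun n => s n (c *: x + y)) = (fun n => c *: s n x + s n y).
    by apply/funext => n; exact: bop_linear.
  exact: cvsZD.
have ba : bounded_op a.
  apply/bounded_opE; split=> //; have [N sN] := cs 1 ltr01.
  exists (1 + opnorm (s N)) => x; rewrite mulrDl.
  rewrite -[a x](subrK (s N x)) (le_trans (hnormD _ _))// lerD ?le_opnorm//.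
  by rewrite hnormBC; apply: limE sN _ _ _.
exists a => // e e0; have e2 : 0 < e / 2 by rewrite divr_gt0.
have [N sN] := cs _ e2; exists N => n Nn.
have h : opnorm (s n - a) <= e / 2.
  by apply: opnorm_ub => [|x]; [exact: ltW | exact: limE sN _ _ _].
by rewrite (le_lt_trans h)// ltr_pdivrMr// ltr_pMr// ltr1n.
Qed.

End BoundedOperators.

(** * Riesz representation and adjoints *)

Section RealLemmas.
Variable R : realType.

(** At [t = - q / (A + 1)] the polynomial equals [- (q / (A + 1))^2]; the [+ 1] covers [A = 0]. It
    serves to extract identities from inequalities that hold for all real [t]. *)
Lemma quad_ge0_lin0 (A q : R) : 0 <= A ->
  (forall t, 0 <= t ^+ 2 * A + t * q) -> q = 0.
Proof.
move=> A0 h; apply/eqP; rewrite -sqrf_eq0 eq_le sqr_ge0 andbT.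
have A1 : 0 < A + 1 by rewrite ltr_wpDl.
have := h (- (q / (A + 1))).
have -> : (- (q / (A + 1))) ^+ 2 * A + - (q / (A + 1)) * q =
  - (q ^+ 2 / (A + 1) ^+ 2) by field; rewrite gt_eqF.
rewrite oppr_ge0 => h1.
by rewrite -(pmulr_lle0 _ (_ : 0 < (A + 1) ^- 2)) ?invr_gt0 ?exprn_gt0.
Qed.

Lemma expr_small (q e : R) : 0 <= q -> q < 1 -> 0 < e ->
  exists N, forall n, (N <= n)%N -> q ^+ n < e.
Proof.
move=> q0 q1 e0; have qn : `|q| < 1 by rewrite ger0_norm.
have /cvgrPdist_lt/(_ e e0)[N _ hN] := @cvg_expr R q qn.
exists N => n /hN /=; rewrite sub0r normrN ger0_norm//.
by rewrite exprn_ge0.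
Qed.

Lemma inv_small (e : R) : 0 < e -> exists N : nat, N.+1%:R^-1 < e.
Proof.
move=> e0; exists (Num.bound e^-1).
rewrite invf_plt ?posrE ?ltr0n// (@lt_trans _ _ (Num.bound e^-1)%:R)//.
  by rewrite archi_boundP// invr_ge0 ltW.
by rewrite ltr_nat.
Qed.

Lemma ler_epsM (a b c : R) : (forall e : R, 0 < e -> a <= b + e * c) -> a <= b.
Proof.
move=> h; apply/ler_addgt0Pr => e e0.
have c1 : 0 < `|c| + 1 by rewrite ltr_wpDl.
apply: le_trans (h _ (divr_gt0 e0 c1)) _; rewrite lerD2l.
rewrite mulrAC ler_pdivrMr// ler_wpM2l ?(ltW e0)//.
by rewrite (le_trans (ler_norm _))// lerDl.
Qed.

End RealLemmas.

Section Riesz.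
Variables (R : realType) (H : hilbert R).

(** The representing vector minimises [F x = |x|^2 - 2 Re (f x)]. The first variation of [F] gives
    equality of real parts, and replacing [x] by [i x] gives the imaginary parts. *)
Lemma riesz (f : H -> R[i]) : (forall c x y, f (c *: x + y) = c * f x + f y) ->
  (exists M : R, forall x, cabs (f x) <= M * hnorm x) ->
  exists z, forall x, f x = inner H x z.
Proof.
move=> fl [M fM].
have fD x y : f (x + y) = f x + f y by rewrite -{1}[x]scale1r fl mul1r.
have f0 : f 0 = 0 by apply: (@addrI _ (f 0)); rewrite -fD !addr0.
have fZ c x : f (c *: x) = c * f x by rewrite -[c *: x]addr0 fl f0 addr0.
pose F x := hnorm x ^+ 2 - complex.Re (f x) *+ 2.
have Fge x : - M ^+ 2 <= F x.
  rewrite /F.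
  have h : complex.Re (f x) <= M * hnorm x := le_trans (cRe_le_cabs _) (fM x).
  have := sqr_ge0 (hnorm x - M); nra.
have Finf : has_inf (range F).
  split; first by exists (F 0), 0.
  by exists (- M ^+ 2) => _ [x _ <-].
set d := inf (range F).
have dF x : d <= F x by apply: (ge_inf Finf.2); exists x.
have /choice[s sP] : forall n : nat, exists x, F x < d + n.+1%:R^-1.
  move=> n; have n0 : 0 < n.+1%:R^-1 :> R by rewrite invr_gt0.
  by have [_ [x _ <-] h] := inf_adherent n0 Finf; exists x.
(* By the parallelogram law the left side is [2 F x + 2 F y - 4 F ((x + y) / 2)], because the linear
   parts of [F] cancel. Minimising sequences are therefore Cauchy. *)
have par x y : hnorm (x - y) ^+ 2 <= F x *+ 2 + F y *+ 2 - d *+ 4.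
  have := dF ((2^-1 : R)%:C%C *: (x + y)).
  rewrite /F hnormZ exprMn fZ cReZ fD cReD cabs_real ger0_norm ?invr_ge0//.
  rewrite hnormD2 hnormB2; nra.
have [z sz] : exists z, cvs s z.
  apply: hilbert_complete => e e0.
  have e4 : 0 < e ^+ 2 / 4 by rewrite divr_gt0// exprn_gt0.
  have [N hN] := inv_small e4; exists N => m n Nm Nn.
  rewrite -(ltr_pXn2r (ltn0Sn 1)) ?nnegrE ?hnorm_ge0 ?(ltW e0)//.
  apply: le_lt_trans (par _ _) _.
  have small k : (N <= k)%N -> F (s k) < d + e ^+ 2 / 4.
    move=> Nk; apply: lt_trans (sP k) _; rewrite ltrD2l (le_lt_trans _ hN)//.
    by rewrite lef_pV2 ?posrE ?ltr0n// ler_nat.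
  have := small _ Nm; have := small _ Nn; lra.
have key x : complex.Re (f x) = complex.Re (inner H x z).
  apply/eqP; rewrite eq_sym -subr_eq0; apply/eqP.
  suff : (complex.Re (inner H x z) - complex.Re (f x)) *+ 2 = 0.
    by move=> /eqP; rewrite mulrn_eq0 => /eqP.
  apply: (@quad_ge0_lin0 _ (hnorm x ^+ 2)); first by rewrite exprn_ge0 ?hnorm_ge0.
  (* The infimum is compared with [F] at [s n + t x] for a large [n], at a cost of at most [e], so
     [F] need not be evaluated at the limit [z]. *)
  move=> t; apply/ler_addgt0Pr => e e0.
  have T0 : 0 < (`|t| * hnorm x) *+ 2 + 1 by rewrite ltr_wpDl// mulrn_wge0// mulr_ge0 ?hnorm_ge0.
  have e2 : 0 < e / 2 by rewrite divr_gt0.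
  have [N hN] := sz _ (divr_gt0 e2 T0); have [N' hN'] := inv_small e2.
  set n := maxn N N'.
  have h1 := hN n (leq_maxl _ _).
  have h2 : F (s n) < d + e / 2.
    apply: lt_trans (sP n) _; rewrite ltrD2l (le_lt_trans _ hN')//.
    by rewrite lef_pV2 ?posrE ?ltr0n// ler_nat ltnS leq_maxr.
  have := dF (s n + t%:C%C *: x); rewrite /F hnormD2 hnormZ fD fZ cReD cReZ cabs_real.
  rewrite exprMn real_normK ?num_real// innerZr.
  have -> : (t%:C%C)^* = t%:C%C :> R[i] by apply/complex_eq => //=; rewrite oppr0.
  have h3 : t * complex.Re (inner H (s n) x) - t * complex.Re (inner H x z) <=
      hnorm (s n - z) * (`|t| * hnorm x).
    have := cRe_inner_le (t%:C%C *: (s n - z)) x.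
    rewrite innerZl cReZ innerBl cReD cReN hnormZ cabs_real [inner H z x]innerC cRe_conj.
    by rewrite mulrBr mulrAC (mulrC (hnorm (s n - z))).
  have h4 : hnorm (s n - z) * (`|t| * hnorm x) *+ 2 <= e / 2.
    have := ltW h1; rewrite ler_pdivlMr// => /(le_trans _); apply.
    by rewrite -mulrnAr ler_wpM2l ?hnorm_ge0// lerDl.
  rewrite cReZ; move: h2; rewrite /F; lra.
exists z => x; apply: complex_eq => //.
by apply: oppr_inj; rewrite -!cReMi -fZ key innerZl.
Qed.

End Riesz.

Section Adjoints.
Variables (R : realType) (H : hilbert R).
Implicit Types (a b : op H) (c : R[i]).

Lemma is_adjoint_ex a : bounded_op a -> exists b, is_adjoint a b.
Proof.
move=> ba; have la := bop_linear ba.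
suff /choice[b bP] : forall y, exists z, forall x, inner H (a x) y = inner H x z.
  by exists b => x y.
move=> y; apply: (@riesz _ _ (fun x => inner H (a x) y)) => [c x x'|].
  by rewrite la innerDl innerZl.
exists (opnorm a * hnorm y) => x; rewrite (le_trans (CauchySchwarz_hnorm _ _))//.
by rewrite mulrAC ler_wpM2r ?hnorm_ge0// le_opnorm.
Qed.

Definition adj a : op H := xget 0 [set b | is_adjoint a b].

Lemma adjP a : bounded_op a -> is_adjoint a (adj a).
Proof. by move=> /is_adjoint_ex[b ab]; rewrite /adj; case: xgetP => // /(_ b). Qed.

Lemma is_adjointC a b : is_adjoint a b -> is_adjoint b a.
Proof. by move=> ab x y; rewrite innerC -ab -innerC. Qed.

Lemma is_adjoint_uniq a b b' : is_adjoint a b -> is_adjoint a b' -> b = b'.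
Proof.
by move=> ab ab'; apply/funext => y; apply: inner_extr => x; rewrite -ab -ab'.
Qed.

Lemma is_adjoint_bound a b : bounded_op a -> is_adjoint a b ->
  forall x, hnorm (b x) <= opnorm a * hnorm x.
Proof.
move=> ba ab x; have [->|n0] := eqVneq (hnorm (b x)) 0.
  by rewrite mulr_ge0 ?opnorm_ge0 ?hnorm_ge0.
have p0 : 0 < hnorm (b x) by rewrite lt_neqAle eq_sym n0 hnorm_ge0.
rewrite -(ler_pM2l p0) -expr2 hnorm_sqr -ab (le_trans (cRe_inner_le _ _))//.
rewrite mulrA ler_wpM2r ?hnorm_ge0// mulrC.
exact: le_opnorm.
Qed.

Lemma is_adjoint_bop a b : bounded_op a -> is_adjoint a b -> bounded_op b.
Proof.
move=> ba ab; apply/bounded_opE; split=> [c x y|].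
  by apply: inner_extr => z; rewrite -ab !innerDr !innerZr !ab.
by exists (opnorm a); apply: is_adjoint_bound.
Qed.

Lemma is_adjoint_opnorm a b : bounded_op a -> is_adjoint a b ->
  opnorm b <= opnorm a.
Proof.
by move=> ba ab; apply: opnorm_ub (is_adjoint_bound ba ab); exact: opnorm_ge0.
Qed.

Lemma bop_adj a : bounded_op a -> bounded_op (adj a).
Proof. by move=> ba; apply: is_adjoint_bop (adjP ba). Qed.

Lemma is_adjoint_adj a b : is_adjoint a b -> adj a = b.
Proof.
move=> ab; rewrite /adj; case: xgetP => [b' _ /= ab'|/(_ b)//].
exact: is_adjoint_uniq ab' ab.
Qed.

Lemma is_adjointZD c a a' b b' : is_adjoint a a' -> is_adjoint b b' ->
  is_adjoint (c *: a + b) (c^* *: a' + b').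
Proof.
by move=> aa bb x y; rewrite innerDl innerZl aa bb innerDr innerZr conjCK.
Qed.

Lemma is_adjointD a a' b b' : is_adjoint a a' -> is_adjoint b b' ->
  is_adjoint (a + b) (a' + b').
Proof. by move=> aa bb x y; rewrite innerDl aa bb innerDr. Qed.

Lemma is_adjointZ c a a' : is_adjoint a a' -> is_adjoint (c *: a) (c^* *: a').
Proof. by move=> aa x y; rewrite innerZl aa innerZr conjCK. Qed.

Lemma is_adjointB a a' b b' : is_adjoint a a' -> is_adjoint b b' ->
  is_adjoint (a - b) (a' - b').
Proof. by move=> aa bb x y; rewrite innerBl aa bb innerBr. Qed.

Lemma is_adjoint0 : is_adjoint (0 : op H) 0.
Proof. by move=> x y; rewrite inner0l inner0r. Qed.

Lemma is_adjoint_comp a a' b b' : is_adjoint a a' -> is_adjoint b b' ->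
  is_adjoint (a \o b) (b' \o a').
Proof. by move=> aa bb x y /=; rewrite aa bb. Qed.

Lemma is_adjoint_sum I (s : seq I) (P : pred I) (F F' : I -> op H) :
  (forall i, P i -> is_adjoint (F i) (F' i)) ->
  is_adjoint (\sum_(i <- s | P i) F i) (\sum_(i <- s | P i) F' i).
Proof.
move=> h; elim/big_rec2: _ => [|i y x Pi]; first exact: is_adjoint0.
by apply: is_adjointD; exact: h.
Qed.

(** Polarisation: [x + y] and [x + i y] give two equations between [<a x, y>] and [<a y, x>] that
    together force both to vanish. Complex scalars are essential. *)
Lemma quad_form_eq0 a : linear a -> (forall x, inner H (a x) x = 0) -> a = 0.
Proof.
move=> la h; apply/funext => x; apply: inner_extl => y; rewrite inner0l.
have h1 := h (x + y); have h2 := h (x + 'i%C *: y); move: h1 h2.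
rewrite !(linear_fD la) (linear_fZ la) !innerDl !innerDr !h !innerZl !innerZr h.
rewrite !(mulr0, addr0, add0r).
case: (inner H (a x) y) => r s; case: (inner H (a y) x) => r' s'.
move=> [h1 h2] [h3 h4]; apply: complex_eq => /=; lra.
Qed.

End Adjoints.

(** * C*-algebras and star-homomorphisms *)

Section Closure.
Variables (R : realType) (H : hilbert R).
Implicit Types (a b : op H) (S T : set (op H)).

Lemma sub_opclosure S : S `<=` @bounded_op R H -> S `<=` opclosure S.
Proof.
move=> bS a Sa; split; first exact: bS.
by move=> e e0; exists a => //; rewrite subrr opnorm0.
Qed.

Lemma opclosure_sub S T : S `<=` T -> opclosure S `<=` opclosure T.
Proof.
by move=> ST a [ba h]; split=> // e /h[s Ss ?]; exists s => //; exact: ST.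
Qed.

Lemma opclosure_bop S : opclosure S `<=` @bounded_op R H.
Proof. by move=> a []. Qed.

Lemma opclosure_idem S : S `<=` @bounded_op R H ->
  opclosure (opclosure S) `<=` opclosure S.
Proof.
move=> bS a [ba h]; split=> // e e0; have e2 : 0 < e / 2 by rewrite divr_gt0.
have [s [bs hs] as_] := h _ e2; have [t St st] := hs _ e2; exists t => //.
rewrite [ltRHS]splitr (le_lt_trans (opnorm_dist_triangle ba bs (bS _ St)))//.
by rewrite ltrD.
Qed.

Lemma opnorm_lim0 a : bounded_op a -> (forall e : R, 0 < e -> opnorm a <= e) ->
  a = 0.
Proof.
move=> ba h; apply: opnorm_eq0 => //; apply/eqP; rewrite eq_le opnorm_ge0 andbT.
by apply/ler_addgt0Pl => e /h; rewrite addr0.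
Qed.

(** With [opball_closed] and [commutant_closed], this makes the domain of the iteration in
    [cs_cayley_inv] norm closed. *)
Lemma selfadjoint_closed : @opclosure R H [set a : op H | bounded_op a /\ is_adjoint a a]
  `<=` [set a : op H | is_adjoint a a].
Proof.
move=> a [ba h] /=; suff E : adj a = a by rewrite -{2}E; exact: adjP.
apply/eqP; rewrite -subr_eq0; apply/eqP/opnorm_lim0 => [|e e0].
  by apply: bopB => //; apply: bop_adj.
have e2 : 0 < e / 2 by rewrite divr_gt0.
have [s [bs ss] as_] := h _ e2; have as' := ltW as_.
rewrite [leRHS]splitr (le_trans (opnorm_dist_triangle (bop_adj ba) bs ba))//.
apply: lerD; last by rewrite opnormBC.
apply: le_trans as'; apply: is_adjoint_opnorm; first exact: bopB.
exact: is_adjointB (adjP ba) ss.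
Qed.

Lemma opball_closed (r : R) : @opclosure R H [set a : op H | bounded_op a /\ opnorm a <= r]
  `<=` [set a : op H | opnorm a <= r].
Proof.
move=> a [ba h] /=; apply/ler_addgt0Pl => e /h[s [bs sr] as_].
by rewrite -(subrK s a) (le_trans (opnormD (bopB ba bs) bs))// lerD// ltW.
Qed.

Lemma commutant_closed b : bounded_op b ->
  @opclosure R H [set a : op H | bounded_op a /\ a \o b = b \o a]
  `<=` [set a : op H | a \o b = b \o a].
Proof.
move=> bb a [ba h] /=; have lb := bop_linear bb.
apply/eqP; rewrite -subr_eq0; apply/eqP/opnorm_lim0 => [|e e0].
  by apply: bopB; apply: bop_comp.
have p0 : 0 < opnorm b *+ 2 + 1 by rewrite ltr_wpDl// mulrn_wge0// opnorm_ge0.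
have [s [bs sb] as_] := h _ (divr_gt0 e0 p0).
have -> : (a \o b) - (b \o a) = ((a - s) \o b) - (b \o (a - s)).
  apply/funext => x; have := congr1 (@^~ x) sb; rewrite !fctE /= => sbx.
  by rewrite (linear_fB lb) -sbx opprB addrA subrK.
move: as_; rewrite ltr_pdivlMr// => /ltW/(le_trans _); apply.
rewrite (le_trans (opnormB _ _))//; try by apply: bop_comp => //; apply: bopB.
have := opnormM (bopB ba bs) bb; have := opnormM bb (bopB ba bs).
have := opnorm_ge0 (a - s); nra.
Qed.

(** Banach's fixed-point theorem, the source of all inverses and square-root-like elements below.
    Since [S] is any closed set, side conditions on the solution can be built into it. *)
Lemma op_fixpoint S (F : op H -> op H) (q : R) x0 :
  S `<=` @bounded_op R H -> opclosure S `<=` S -> set_fun S S F ->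
  0 <= q < 1 ->
  (forall a b, S a -> S b -> opnorm (F a - F b) <= q * opnorm (a - b)) ->
  S x0 -> exists2 y, S y & F y = y.
Proof.
move=> bS cS SF /andP[q0 q1] Fq Sx0; pose s n := iter n F x0.
have Ss n : S (s n) by elim: n => // n ih; exact: SF.
pose D := opnorm (s 1%N - s 0%N); pose B := D / (1 - q).
have q1' : 0 < 1 - q by rewrite subr_gt0.
have sB k : opnorm (s k - s 0%N) <= B.
  elim: k => [|k ih]; first by rewrite subrr opnorm0 divr_ge0 ?opnorm_ge0 ?ltW.
  apply: le_trans (opnorm_dist_triangle (bS _ (Ss _)) (bS _ (Ss 1%N)) (bS _ (Ss _))) _.
  have := Fq _ _ (Ss k) (Ss 0%N); rewrite -/(s k.+1) -/(s 1%N) -/D => h.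
  have BE : B = q * B + D by rewrite /B; field; rewrite gt_eqF.
  by rewrite [leRHS]BE lerD// (le_trans h)// ler_wpM2l.
have sn n k : opnorm (s (n + k)%N - s n) <= q ^+ n * B.
  elim: n => [|n ih]; first by rewrite expr0 mul1r.
  rewrite exprS -mulrA (le_trans (Fq _ _ (Ss (n + k)%N) (Ss n)))//.
  by rewrite ler_wpM2l.
have B0 : 0 <= B by apply: le_trans (sB 0%N); exact: opnorm_ge0.
have smalln (e : R) : 0 < e -> exists N, forall n, (N <= n)%N -> q ^+ n * B < e.
  move=> e0; have B1 : 0 < B + 1 by rewrite ltr_wpDl.
  have [N hN] := expr_small q0 q1 (divr_gt0 e0 B1); exists N => n /hN.
  rewrite ltr_pdivlMr// => /(le_lt_trans _); apply.
  by rewrite ler_wpM2l ?exprn_ge0// lerDl.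
have [y by_ sy] : exists2 a, bounded_op a &
    forall e : R, 0 < e -> exists N, forall n, (N <= n)%N -> opnorm (s n - a) < e.
  apply: op_complete => [n|e e0]; first exact: bS.
  have [N hN] := smalln _ e0; exists N.
  move=> m n /andP[Nm mn]; rewrite opnormBC -(subnKC mn).
  exact: le_lt_trans (sn _ _) (hN _ Nm).
have Sy : S y.
  apply: cS; split=> // e /sy[N hN]; exists (s N) => //.
  by rewrite opnormBC hN.
exists y => //; apply/eqP; rewrite -subr_eq0; apply/eqP/opnorm_lim0 => [|e e0].
  by apply: bopB => //; apply: bS; apply: SF.
have e2 : 0 < e / 2 by rewrite divr_gt0.
have [N hN] := sy _ e2.
rewrite [leRHS]splitr.
apply: le_trans (opnorm_dist_triangle (bS _ (SF _ Sy)) (bS _ (Ss N.+1)) by_) _.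
rewrite lerD//; last by rewrite ltW// hN.
apply: le_trans (Fq _ _ Sy (Ss N)) _.
have := hN _ (leqnn N); rewrite opnormBC; have := opnorm_ge0 (y - s N); nra.
Qed.

End Closure.

Section StarHoms.
Variable R : realType.
Implicit Types (H K : hilbert R) (c : R[i]).

Section Cstar.
Variables (H : hilbert R) (M : set (op H)).

Section OperatorAlgebra.
Hypothesis oM : operator_algebra M.
Implicit Types a b : op H.

Lemma oa_bop a : M a -> bounded_op a. Proof. by case: oM => h _ _ _; exact: h. Qed.
Lemma oa0 : M 0. Proof. by case: oM => _ []. Qed.
Lemma oaZD c a b : M a -> M b -> M (c *: a + b).
Proof. by case: oM => _ [_ h] _ _; exact: h. Qed.
Lemma oaZ c a : M a -> M (c *: a).
Proof. by move=> Ma; rewrite -[_ *: _]addr0; apply: oaZD => //; exact: oa0. Qed.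
Lemma oaD a b : M a -> M b -> M (a + b).
Proof. by move=> Ma Mb; rewrite -[a]scale1r; apply: oaZD. Qed.
Lemma oaN a : M a -> M (- a).
Proof. by move=> Ma; rewrite -scaleN1r; apply: oaZ. Qed.
Lemma oaB a b : M a -> M b -> M (a - b).
Proof. by move=> Ma Mb; apply: oaD => //; apply: oaN. Qed.
Lemma oa_comp a b : M a -> M b -> M (a \o b).
Proof. by case: oM => _ _ h _; exact: h. Qed.
Lemma oa_closed : opclosure M `<=` M. Proof. by case: oM. Qed.
Lemma oa_sum I (s : seq I) (P : pred I) (F : I -> op H) :
  (forall i, P i -> M (F i)) -> M (\sum_(i <- s | P i) F i).
Proof. by move=> MF; elim/big_ind: _ => //; [exact: oa0 | exact: oaD]. Qed.
End OperatorAlgebra.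

Hypothesis cM : cstar_algebra M.

Lemma cs_adj a : M a -> M (adj a).
Proof. by move=> Ma; apply: (cM.2 _ _ Ma); exact: adjP (oa_bop cM.1 Ma). Qed.

End Cstar.

Section AlgHom.
Variables (H K : hilbert R) (M : set (op H)) (N : set (op K)) (phi : op H -> op K).
Hypotheses (oM : operator_algebra M) (hphi : alg_hom M N phi).

Lemma hom_in a : M a -> N (phi a). Proof. by case: hphi => h _ _; exact: h. Qed.
Lemma homZD c a b : M a -> M b -> phi (c *: a + b) = c *: phi a + phi b.
Proof. by case: hphi => _ h _; exact: h. Qed.
Lemma hom_comp a b : M a -> M b -> phi (a \o b) = phi a \o phi b.
Proof. by case: hphi => _ _ h; exact: h. Qed.
Lemma homD a b : M a -> M b -> phi (a + b) = phi a + phi b.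
Proof. by move=> Ma Mb; rewrite -{1}[a]scale1r homZD// scale1r. Qed.
Lemma hom0 : phi 0 = 0.
Proof.
have M0 := oa0 oM.
by apply: (@addrI _ (phi 0)); rewrite -homD// !addr0.
Qed.
Lemma homZ c a : M a -> phi (c *: a) = c *: phi a.
Proof.
move=> Ma; rewrite -[c *: a]addr0 homZD ?hom0 ?addr0//; exact: oa0.
Qed.
Lemma homN a : M a -> phi (- a) = - phi a.
Proof. by move=> Ma; rewrite -scaleN1r homZ// scaleN1r. Qed.
Lemma homB a b : M a -> M b -> phi (a - b) = phi a - phi b.
Proof. by move=> Ma Mb; rewrite homD ?homN//; exact: oaN. Qed.
Lemma hom_sum I (s : seq I) (P : pred I) (F : I -> op H) :
  (forall i, P i -> M (F i)) ->
  phi (\sum_(i <- s | P i) F i) = \sum_(i <- s | P i) phi (F i).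
Proof.
move=> MF; suff [] : M (\sum_(i <- s | P i) F i) /\
  phi (\sum_(i <- s | P i) F i) = \sum_(i <- s | P i) phi (F i) by [].
elim/big_rec2: _ => [|i y x Pi [Mx xE]]; first by split; [exact: oa0|exact: hom0].
by split; [apply: oaD => //; exact: MF | rewrite homD ?xE//; exact: MF].
Qed.
End AlgHom.

End StarHoms.

Section CstarClosure.
Variable R : realType.
Implicit Types (H K : hilbert R) (c : R[i]).

Lemma opclosure_operator_algebra H (S : set (op H)) :
  S `<=` @bounded_op R H -> S 0 ->
  (forall c a b, S a -> S b -> S (c *: a + b)) ->
  (forall a b, S a -> S b -> S (a \o b)) -> operator_algebra (opclosure S).
Proof.
move=> bS S0 SZD SM; split; first exact: opclosure_bop.
- split; first exact: sub_opclosure.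
  move=> c a b [ba ha] [bb hb]; split=> [|e e0]; first exact: bopZD.
  have c0 : 0 < cabs c + 1 by rewrite ltr_wpDl ?cabs_ge0.
  have e2 : 0 < e / 2 by rewrite divr_gt0.
  have [s Ss as_] := ha _ (divr_gt0 e2 c0); have [t St bt] := hb _ e2.
  exists (c *: s + t); first exact: SZD.
  by apply: opnormZD_close => //; exact: bS.
- move=> a b [ba ha] [bb hb]; split=> [|e e0]; first exact: bop_comp.
  have D0 : 0 < opnorm a + opnorm b + 1 by rewrite ltr_wpDl ?addr_ge0 ?opnorm_ge0.
  pose d := Num.min 1 (e / 2 / (opnorm a + opnorm b + 1)).
  have d0 : 0 < d by rewrite lt_min ltr01 !divr_gt0.
  have [s Ss as_] := ha _ d0; have [t St bt] := hb _ d0.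
  exists (s \o t); first exact: SM.
  apply: le_lt_trans (opnorm_comp_close ba bb (bS _ Ss) (bS _ St) _ as_ bt) _.
    by rewrite ge_min lexx.
  apply: le_lt_trans (_ : e / 2 < _); last by rewrite ltr_pdivrMr// ltr_pMr// ltr1n.
  by rewrite -ler_pdivlMr// ge_min lexx orbT.
- exact: opclosure_idem.
Qed.

Lemma opclosure_cstar_algebra H (S : set (op H)) :
  S `<=` @bounded_op R H -> S 0 ->
  (forall c a b, S a -> S b -> S (c *: a + b)) ->
  (forall a b, S a -> S b -> S (a \o b)) ->
  (forall a, S a -> S (adj a)) -> cstar_algebra (opclosure S).
Proof.
move=> bS S0 SZD SM SA; split; first exact: opclosure_operator_algebra.
move=> a b [ba ha] ab; split=> [|e /ha[s Ss as_]]; first exact: is_adjoint_bop ab.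
exists (adj s); first exact: SA.
apply: le_lt_trans as_; apply: is_adjoint_opnorm; first exact: bopB ba (bS _ Ss).
exact: is_adjointB ab (adjP (bS _ Ss)).
Qed.

Lemma bounded_op_cstar H : cstar_algebra (@bounded_op R H).
Proof.
split; last by move=> a b ba; exact: is_adjoint_bop.
split=> //; last exact: opclosure_bop.
  by split; [exact: bop0 | exact: bopZD].
exact: bop_comp.
Qed.

(** Boundedness of [S] puts the algebra of all bounded operators among those intersected, so that
    the intersection consists of bounded operators. *)
Lemma cstar_gen_cstar H (S : set (op H)) : S `<=` @bounded_op R H ->
  cstar_algebra (cstar_gen S).
Proof.
move=> bS; have in_gen a : (forall M, cstar_algebra M /\ S `<=` M -> M a) ->
  cstar_gen S a by move=> h M hM; exact: h.
have bgen : cstar_gen S `<=` @bounded_op R H.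
  by move=> a /(_ (@bounded_op R H)); apply; split=> //; exact: bounded_op_cstar.
split; [split=> // |].
- split; first by apply: in_gen => M [[oM _] _]; exact: oa0.
  move=> c a b ga gb; apply: in_gen => M hM; apply: (oaZD hM.1.1).
    exact: (ga M hM).
  exact: (gb M hM).
- move=> a b ga gb; apply: in_gen => M hM; apply: (oa_comp hM.1.1).
    exact: (ga M hM).
  exact: (gb M hM).
- move=> a ga; apply: in_gen => M hM; apply: (oa_closed hM.1.1).
  by apply: opclosure_sub ga => s /(_ M hM).
- move=> a b ga ab; apply: in_gen => M hM; apply: (hM.1.2 a) => //.
  exact: (ga M hM).
Qed.

Lemma sub_cstar_gen H (S : set (op H)) : S `<=` cstar_gen S.
Proof. exact: sub_smallest. Qed.

Lemma cstar_gen_min H (S M : set (op H)) : cstar_algebra M -> S `<=` M ->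
  cstar_gen S `<=` M.
Proof. by move=> cM SM; apply: smallest_sub. Qed.

End CstarClosure.

(** * Contractivity of star-homomorphisms, by the substitution x = 2 w (1 + w^2)^-1 *)

Section Cayley.
Variable R : realType.
Implicit Types (H K : hilbert R).

(** The operator [e] is [v^2 (1 + v^2)^-1], so that [x - e x] is [(1 + v^2)^-1 x]. Unlike the
    resolvent itself, [e] stays in an algebra without unit. *)
Lemma cs_resolvent H (M : set (op H)) v :
  cstar_algebra M -> M v -> is_adjoint v v ->
  exists2 e, M e & forall x, (x - e x) + v (v (x - e x)) = x.
Proof.
move=> cM Mv sv; have oM := cM.1; have bM := oa_bop oM; have bv := bM _ Mv.
have lv := bop_linear bv.
pose N := opnorm v ^+ 2; have N0 : 0 <= N by rewrite exprn_ge0 ?opnorm_ge0.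
have N1 : 0 < 1 + N by rewrite ltr_wpDr.
pose r := (1 + N)^-1; have r0 : 0 < r by rewrite invr_gt0.
pose F e := r%:C%C *: (N%:C%C *: e - (v \o (v \o e)) + (v \o v)).
(* The equation [e + v^2 e = v^2] is rewritten as [(1 + N) e = (N - v^2) e + v^2]. As
   [0 <= v^2 <= N], the operator [N - v^2] has norm at most [N], which gives the ratio
   [N / (1 + N)]. *)
have [||||||e Me eE] := @op_fixpoint _ _ M F (r * N) 0.
- exact: bM.
- exact: oa_closed.
- move=> e Me; apply: (oaZ oM); apply: (oaD oM); last exact: (oa_comp oM).
  by apply: (oaB oM); [exact: (oaZ oM)|do 2 apply: (oa_comp oM) => //].
- apply/andP; split; first by rewrite mulr_ge0// ltW.
  by rewrite mulrC ltr_pdivrMr// mul1r ltrDr.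
- move=> a b Ma Mb.
  have -> : F a - F b = r%:C%C *: (N%:C%C *: (a - b) - (v \o (v \o (a - b)))).
    rewrite /F -scalerBr; congr (_ *: _); apply/funext => z.
    rewrite !fctE /= !(linear_fB lv); hring.
  have bab := bopB (bM _ Ma) (bM _ Mb).
  have bvv : bounded_op (v \o (v \o (a - b))) by do 2 apply: bop_comp => //.
  apply: le_trans (opnormZ _ (bopB (bopZ _ bab) bvv)) _.
  rewrite cabs_real gtr0_norm// -mulrA ler_wpM2l ?(ltW r0)//.
  apply: opnorm_ub => [|x]; first by rewrite mulr_ge0 ?opnorm_ge0.
  rewrite -mulrA; apply: le_trans (_ : N * hnorm ((a - b) x) <= _); last first.
    by rewrite ler_wpM2l// le_opnorm.
  set z := (a - b) x; rewrite !fctE /= -/z.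
  rewrite -ler_sq ?mulr_ge0 ?hnorm_ge0 ?opnorm_ge0//.
  rewrite hnormB2 hnormZ cabs_real ger0_norm// innerZl cReZ -sv -hnorm_sqr.
  have h : hnorm (v (v z)) ^+ 2 <= N * hnorm (v z) ^+ 2.
    rewrite /N -exprMn ler_sq ?mulr_ge0 ?opnorm_ge0 ?hnorm_ge0//.
    exact: le_opnorm.
  rewrite exprMn; have := mulr_ge0 N0 (sqr_ge0 (hnorm (v z))); lra.
- exact: (oa0 oM).
have key x : e x + v (v (e x)) = v (v x).
  have := congr1 (fun f => (1 + N)%:C%C *: f) eE.
  rewrite /F scalerA -rmorphM/= /r divff ?gt_eqF// scale1r => /(congr1 (@^~ x)).
  rewrite !fctE /= rmorphD scalerDl scale1r => eE'.
  apply: (@addrI _ (N%:C%C *: e x - v (v (e x)))); rewrite eE'; hring.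
exists e => // x; rewrite !(linear_fB lv) -(key x); hring.
Qed.

(** The operator [c] is [2 v (1 + v^2)^-1]. With [h = (1 + v^2)^-1 x], the difference of
    [|h + v^2 h|^2] and [|2 v h|^2] is [|h - v^2 h|^2], hence the norm bound without any restriction
    on the size of [v]. *)
Lemma cs_cayley H (M : set (op H)) v :
  cstar_algebra M -> M v -> is_adjoint v v ->
  exists c, [/\ M c, opnorm c <= 1 & forall x, c x + v (v (c x)) = v x + v x].
Proof.
move=> cM Mv sv; have oM := cM.1; have bM := oa_bop oM; have bv := bM _ Mv.
have lv := bop_linear bv.
have [e Me eP] := cs_resolvent cM Mv sv.
pose r x := x - e x.
have cE x : ((v - (v \o e)) + (v - (v \o e))) x = v (r x) + v (r x).
  by rewrite !fctE /= (linear_fB lv).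
exists ((v - (v \o e)) + (v - (v \o e))); split.
- by do 2 (apply: (oaD oM)); try apply: (oaN oM); try exact: (oa_comp oM).
- apply: opnorm_ub => // x; rewrite mul1r cE.
  rewrite -ler_sq ?hnorm_ge0//.
  have := eP x; rewrite -/(r x); move: (r x) => h <-.
  have := sqr_ge0 (hnorm (h - v (v h))).
  have E : inner H h (v (v h)) = (hnorm (v h) ^+ 2)%:C%C by rewrite -sv hnormE.
  by rewrite hnormB2 !hnormD2 E hnormE /=; lra.
- move=> x; rewrite cE !(linear_fD lv) addrACA -!(linear_fD lv).
  by rewrite /r eP.
Qed.

(** The solution [w] is [x / (1 + sqrt (1 - x^2))], found as the fixed point of
    [w |-> (x + w^2 x) / 2]. On the ball of radius [q = |x| < 1] this map has Lipschitz constant at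
    most [q^2], and it preserves the ball because [(q + q^3) / 2 <= q]. *)
Lemma cs_cayley_inv H (N : set (op H)) x :
  cstar_algebra N -> N x -> is_adjoint x x -> opnorm x < 1 ->
  exists w, [/\ N w, is_adjoint w w, opnorm w <= 1 &
    forall z, x z + w (w (x z)) = w z + w z].
Proof.
move=> cN Nx sx x1; have oN := cN.1; have bN := oa_bop oN; have bx := bN _ Nx.
pose q := opnorm x; have q0 : 0 <= q := opnorm_ge0 x; have q1 : q < 1 := x1.
pose F w := (2^-1 : R)%:C%C *: (x + (w \o (w \o x))).
have [||||||w [Nw sw _ wq] wE] := @op_fixpoint _ _
  [set w | [/\ N w, is_adjoint w w, w \o x = x \o w & opnorm w <= q]] F q 0.
- by move=> w [/bN].
- move=> a ha; split.
  + by apply: (oa_closed oN); apply: opclosure_sub ha => y [].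
  + by apply: selfadjoint_closed; apply: opclosure_sub ha => y [/bN].
  + by apply: commutant_closed => //; apply: opclosure_sub ha => y [/bN].
  + by apply: opball_closed; apply: opclosure_sub ha => y [/bN].
- move=> w [Nw sw wx wq]; have bw := bN _ Nw; split.
  + by apply: (oaZ oN); apply: (oaD oN) => //; do 2 apply: (oa_comp oN) => //.
  + rewrite /F -{2}conj_realC; apply: is_adjointZ; apply: is_adjointD => //.
    (* The adjoint of [w w x] is [x w w]. Commutation with [x] is part of the invariant set exactly
       to identify the two. *)
    have {2}-> : w \o (w \o x) = (x \o w) \o w by rewrite -wx -[LHS]/((w \o w) \o x) -[RHS]/(w \o (x \o w)) -wx.
    exact: is_adjoint_comp sw (is_adjoint_comp sw sx).
  + apply/funext => z; rewrite /F !fctE /=.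
    rewrite (linear_fZ (bop_linear bx)) (linear_fD (bop_linear bx)).
    by have wxE y : w (x y) = x (w y) by [exact: (congr1 (@^~ y) wx)]; rewrite !wxE.
  + have bww := bop_comp bw (bop_comp bw bx).
    apply: le_trans (opnormZ _ (bopD bx bww)) _.
    rewrite cabs_real ger0_norm ?invr_ge0//.
    have := opnormD bx bww; have := opnormM bw (bop_comp bw bx).
    have := opnormM bw bx; rewrite -/q => h1 h2 h3.
    have w0 := opnorm_ge0 w.
    have h4 : opnorm w * opnorm (w \o x) <= q.
      rewrite -[leRHS]mulr1 ler_pM ?opnorm_ge0//; nra.
    lra.
- by rewrite q0.
- move=> a b [Na _ ax aq] [Nb _ bx' bq].
  have ba := bN _ Na; have bb := bN _ Nb; have bab := bopB ba bb.
  have -> : F a - F b = (2^-1 : R)%:C%C *: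
      ((a \o ((a - b) \o x)) + ((a - b) \o (b \o x))).
    rewrite /F -scalerBr; congr (_ *: _); apply/funext => z.
    rewrite !fctE /= (linear_fB (bop_linear ba)) opprD addrACA subrr add0r.
    by rewrite addrA subrK.
  have b1 := bop_comp bab bx; have b2 := bop_comp bb bx.
  apply: le_trans (opnormZ _ (bopD (bop_comp ba b1) (bop_comp bab b2))) _.
  rewrite cabs_real ger0_norm ?invr_ge0//.
  have := opnormD (bop_comp ba b1) (bop_comp bab b2).
  have := opnormM ba b1; have := opnormM bab b2.
  have := opnormM bab bx; have := opnormM bb bx.
  have := opnorm_ge0 (a - b); have := opnorm_ge0 a; have := opnorm_ge0 b.
  rewrite -/q; set X := opnorm (a - b); set Y := opnorm (_ \o x).
  set Z := opnorm ((a - b) \o x) => b0 a0 X0 h1 h2 h3 h4 h5.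
  have h6 : opnorm a * Z <= q * X.
    by rewrite ler_pM ?opnorm_ge0// (le_trans h2)// ler_piMr// ltW.
  have h7 : X * Y <= q * X.
    by rewrite mulrC ler_wpM2r// (le_trans h1)// (le_trans _ bq)// ler_piMr// ltW.
  lra.
- split; [exact: (oa0 oN) | exact: is_adjoint0 | | by rewrite opnorm0].
  by apply/funext => z /=; rewrite (linear_f0 (bop_linear bx)).
exists w; split=> //; first exact: le_trans wq (ltW q1).
move=> z; have := congr1 (@^~ z) wE => <-.
by rewrite /F !fctE /= scale_halfD.
Qed.
(** The real part of [<y + w^2 y, y>] is [|y|^2 + |w y|^2]. Hence [1 + w^2] is bounded below by 1,
    so equations in [1 + w^2] have unique solutions and estimates can be read off after applying
    it. *)
Lemma le_hnorm_add_sq H (w : op H) y : is_adjoint w w ->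
  hnorm y <= hnorm (y + w (w y)).
Proof.
move=> sw; have [->|n0] := eqVneq (hnorm y) 0; first exact: hnorm_ge0.
have p0 : 0 < hnorm y by rewrite lt_neqAle eq_sym n0 hnorm_ge0.
rewrite -(ler_pM2r p0); apply: le_trans (cRe_inner_le _ _).
rewrite innerDl cReD -expr2 -hnorm_sqr lerDl (sw (w y) y) -hnorm_sqr.
exact: sqr_ge0.
Qed.

(* A self-adjoint [x] of norm less than 1 is [2 w (1 + w^2)^-1] for some
   self-adjoint [w] in the algebra.  Its image is therefore of the same form,
   hence of norm at most 1. *)
Lemma star_hom_contractive H K (M : set (op H)) (N : set (op K)) phi a :
  cstar_algebra M -> N `<=` @bounded_op R K -> star_hom M N phi -> M a ->
  opnorm (phi a) <= opnorm a.
Proof.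
move=> cM bN [hphi sphi]; have oM := cM.1; have bM := oa_bop oM.
have bphi d : M d -> bounded_op (phi d) by move=> Md; apply: bN; exact: (hom_in hphi).
have small x : M x -> is_adjoint x x -> opnorm x < 1 -> opnorm (phi x) <= 1.
  move=> Mx sx x1; have [w [Mw sw _ wE]] := cs_cayley_inv cM Mx sx x1.
  have bW := bphi _ Mw; have lW := bop_linear bW.
  have sW := sphi _ _ Mw Mw sw.
  have [c [_ c1 cE]] := cs_cayley (bounded_op_cstar K) bW sW.
  suff -> : phi x = c by [].
  have Mwx := oa_comp oM Mw Mx; have Mwwx := oa_comp oM Mw Mwx.
  have : x + (w \o (w \o x)) = w + w by apply/funext => z; exact: wE.
  move=> /(congr1 phi); rewrite (homD hphi Mx Mwwx) (homD hphi Mw Mw).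
  rewrite (hom_comp hphi Mw Mwx) (hom_comp hphi Mw Mx) => XE.
  apply/funext => z; apply/eqP; rewrite -subr_eq0; apply/eqP/hnorm_eq0/eqP.
  rewrite eq_le hnorm_ge0 andbT; apply: le_trans (le_hnorm_add_sq _ sW) _.
  have := congr1 (@^~ z) XE; rewrite !fctE /= => XEz.
  rewrite !(linear_fB lW) addrACA -opprD XEz cE subrr hnorm0 //.
(* A general element is reduced to the self-adjoint [adj d \o d], as in the C*-identity. *)
have unit d : M d -> opnorm d < 1 -> opnorm (phi d) <= 1.
  move=> Md d1; have Md' := cs_adj cM Md; have bd := bM _ Md.
  have Mx := oa_comp oM Md' Md; have ad := adjP bd.
  have x1 : opnorm (adj d \o d) < 1.
    apply: le_lt_trans (opnormM (bM _ Md') bd) _.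
    have := is_adjoint_opnorm bd ad; have := opnorm_ge0 (adj d).
    have := opnorm_ge0 d; nra.
  have px := small _ Mx (is_adjoint_comp (is_adjointC ad) ad) x1.
  apply: opnorm_ub => // x; rewrite mul1r.
  rewrite -ler_sq ?hnorm_ge0// hnorm_sqr (sphi _ _ Md Md' ad).
  rewrite -[phi (adj d) (phi d x)]/((phi (adj d) \o phi d) x) -(hom_comp hphi)//.
  apply: le_trans (cRe_inner_le _ _) _; rewrite expr2 ler_wpM2l ?hnorm_ge0//.
  exact: contraction (bphi _ Mx) px.
move=> Ma; apply/ler_addgt0Pr => e e0.
have p0 : 0 < opnorm a + e by rewrite ltr_wpDl ?opnorm_ge0.
pose r := (opnorm a + e)^-1; have r0 : 0 < r by rewrite invr_gt0.
have := unit (r%:C%C *: a) (oaZ oM _ Ma).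
rewrite (homZ oM hphi)// => h.
apply: opnorm_ub => [|x]; first exact: ltW.
have {}h := h (le_lt_trans (opnormZ _ (bM _ Ma)) _).
rewrite cabs_real gtr0_norm// mulrC ltr_pdivrMr// mul1r ltrDl e0 in h.
have := le_opnorm x (bopZ r%:C%C (bphi _ Ma)).
rewrite !fctE hnormZ cabs_real gtr0_norm// => h1.
have {}h1 := le_trans h1 (ler_wpM2r (hnorm_ge0 x) (h isT)).
by rewrite mul1r mulrC ler_pdivrMr// mulrC in h1.
Qed.

End Cayley.

(** * Closed range of star-homomorphisms *)

Section StarHomRange.
Variables (R : realType) (H K : hilbert R).
Variables (M : set (op H)) (B : set (op K)) (phi : op H -> op K).
Hypotheses (cM : cstar_algebra M) (bB : B `<=` @bounded_op R K)
  (sphi : star_hom M B phi).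

Let oM := cM.1.
Let bM := oa_bop oM.
Let hphi := sphi.1.

Lemma star_hom_bop a : M a -> bounded_op (phi a).
Proof. by move=> Ma; apply: bB; exact: (hom_in hphi). Qed.

Lemma star_hom_adj a : M a -> phi (adj a) = adj (phi a).
Proof.
move=> Ma; apply/esym/is_adjoint_adj; apply: sphi.2 => //.
  exact: cs_adj.
exact: adjP (bM Ma).
Qed.

Local Notation N := (opclosure (phi @` M)).

Lemma star_hom_range_bop : phi @` M `<=` @bounded_op R K.
Proof. by move=> _ [a Ma <-]; exact: star_hom_bop. Qed.

Lemma star_hom_range_closure : cstar_algebra N.
Proof.
apply: opclosure_cstar_algebra; first exact: star_hom_range_bop.
- by exists 0; [exact: (oa0 oM) | exact: (hom0 oM hphi)].
- move=> c _ _ [a Ma <-] [b Mb <-]; exists (c *: a + b); first exact: (oaZD oM).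
  exact: (homZD hphi).
- move=> _ _ [a Ma <-] [b Mb <-]; exists (a \o b); first exact: (oa_comp oM).
  exact: (hom_comp hphi).
- move=> _ [a Ma <-]; exists (adj a); first exact: cs_adj.
  exact: star_hom_adj.
Qed.

Lemma star_hom_approx_selfadjoint w (e : R) : N w -> is_adjoint w w -> 0 < e ->
  exists2 v, M v /\ is_adjoint v v & opnorm (phi v - w) < e.
Proof.
move=> [bw hw] sw e0; have [_ [v0 Mv0 <-] h] := hw _ e0.
have Mv0' := cs_adj cM Mv0; have bv0 := bM Mv0.
pose h2 := (2^-1 : R)%:C%C.
exists (h2 *: (v0 + adj v0)).
  split; first by apply: (oaZ oM); exact: (oaD oM).
  rewrite -{2}[h2]conj_realC; apply: is_adjointZ; rewrite {2}addrC.
  apply: is_adjointD; first exact: adjP.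
  exact: is_adjointC (adjP bv0).
have bp := star_hom_bop Mv0.
have -> : phi (h2 *: (v0 + adj v0)) - w =
    h2 *: ((phi v0 - w) + (adj (phi v0) - w)).
  rewrite (homZ oM hphi) ?(homD hphi)//; last exact: (oaD oM).
  rewrite star_hom_adj//; apply/funext => z; rewrite !fctE.
  by rewrite -[w z in LHS]scale_halfD -/h2; hring.
have b1 := bopB bp bw; have b2 := bopB (bop_adj bp) bw.
apply: le_lt_trans (opnormZ _ (bopD b1 b2)) _.
rewrite cabs_real ger0_norm ?invr_ge0//.
have := opnormD b1 b2.
have : opnorm (adj (phi v0) - w) <= opnorm (phi v0 - w).
  by apply: is_adjoint_opnorm b1 _; exact: is_adjointB (adjP bp) sw.
rewrite opnormBC in h; lra.
Qed.

(** An approximate form of Kaplansky's density theorem. Approximants of [x] in the range may have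
    preimages of any norm, so the approximation is made on [w] with [x = 2 w (1 + w^2)^-1]: the
    preimage [c = 2 v (1 + v^2)^-1] has norm at most 1 whatever the size of [v]. *)
Lemma star_hom_kaplansky_selfadjoint x : N x -> is_adjoint x x -> opnorm x < 1 ->
  exists c, [/\ M c, opnorm c <= 1 & opnorm (x - phi c) <= 4^-1].
Proof.
move=> Nx sx x1; have cN := star_hom_range_closure; have bN := oa_bop cN.1.
have [w [Nw sw w1 wE]] := cs_cayley_inv cN Nx sx x1.
(* With [|V - w| <= 1/20], the four terms of [yE] add up to at most [(2 + 21/20 + 1) / 20], which is
   below [1/4]. *)
have e0 : 0 < (20^-1 : R) by rewrite invr_gt0.
have [v [Mv sv] vw] := star_hom_approx_selfadjoint Nw sw e0.
have [c [Mc c1 cE]] := cs_cayley cM Mv sv.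
exists c; split=> //; set V := phi v; set C := phi c.
have bV : bounded_op V := star_hom_bop Mv; have bC : bounded_op C := star_hom_bop Mc.
have bw := bN _ Nw; have bx := bN _ Nx.
have lw := bop_linear bw; have lV := bop_linear bV; have lC := bop_linear bC.
have CE z : C z + V (V (C z)) = V z + V z.
  have : c + (v \o (v \o c)) = v + v by apply/funext => y; exact: cE.
  have Mvc := oa_comp oM Mv Mc; have Mvvc := oa_comp oM Mv Mvc.
  move=> /(congr1 phi); rewrite (homD hphi Mc Mvvc) (homD hphi Mv Mv).
  rewrite (hom_comp hphi Mv Mvc) (hom_comp hphi Mv Mc).
  by move=> /(congr1 (@^~ z)).
apply: opnorm_ub => [|z]; first by rewrite invr_ge0.
set y := (x - C) z.
(* Multiplying [x - C] by [1 + w^2] removes the inverses: [x] contributes [2 w], and [C] contributes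
   [2 V - V^2 C + w^2 C]. What remains is split so that each term has a factor [V - w]. *)
have yE : y + w (w y) = (w - V) z + (w - V) z + (V ((V - w) (C z)) + (V - w) (w (C z))).
  rewrite /y !fctE !(linear_fB lw) !(linear_fB lV).
  have := wE z; have := CE z; move=> h1 h2.
  have -> : x z - C z + (w (w (x z)) - w (w (C z))) =
    (x z + w (w (x z))) - (C z + V (V (C z))) + V (V (C z)) - w (w (C z)) by hring.
  rewrite h1 h2; hring.
have Dn (t : K) : hnorm ((V - w) t) <= 20^-1 * hnorm t.
  by apply: opnorm_bound (ltW vw); exact: bopB.
have Dn' (t : K) : hnorm ((w - V) t) <= 20^-1 * hnorm t.
  by rewrite !fctE hnormBC; exact: Dn.
have wn (t : K) : hnorm (w t) <= hnorm t by exact: contraction.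
have Vn (t : K) : hnorm (V t) <= (1 + 20^-1) * hnorm t.
  have -> : V t = (V - w) t + w t by rewrite !fctE subrK.
  have := hnormD ((V - w) t) (w t); have := Dn t; have := wn t; lra.
have Cn (t : K) : hnorm (C t) <= hnorm t.
  apply: contraction => //.
  exact: le_trans (star_hom_contractive cM bB sphi Mc) c1.
have ub : hnorm (y + w (w y)) <= 4^-1 * hnorm z.
  rewrite yE.
  have := hnormD ((w - V) z + (w - V) z) (V ((V - w) (C z)) + (V - w) (w (C z))).
  have := hnormD ((w - V) z) ((w - V) z).
  have := hnormD (V ((V - w) (C z))) ((V - w) (w (C z))).
  have := Dn' z; have := Vn ((V - w) (C z)); have := Dn (C z).
  have := Dn (w (C z)); have := wn (C z); have := Cn z; have := hnorm_ge0 z; lra.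
exact: le_trans (le_hnorm_add_sq _ sw) ub.
Qed.

(** The real and imaginary parts of [x] are approximated separately; the norms of the two preimages
    and the two errors add. *)
Lemma star_hom_kaplansky x : N x -> opnorm x < 1 ->
  exists c, [/\ M c, opnorm c <= 2 & opnorm (x - phi c) <= 2^-1].
Proof.
move=> Nx x1; have cN := star_hom_range_closure; have oN := cN.1.
have bx := oa_bop oN Nx; have Nx' := cs_adj cN Nx; have bx' := oa_bop oN Nx'.
pose h2 := (2^-1 : R)%:C%C.
have nx' : opnorm (adj x) <= opnorm x := is_adjoint_opnorm bx (adjP bx).
have x'x := is_adjointC (adjP bx).
have [|||a [Ma a1 xa]] := @star_hom_kaplansky_selfadjoint (h2 *: (x + adj x)).
- by apply: (oaZ oN); exact: (oaD oN).
- rewrite -{2}[h2]conj_realC; apply: is_adjointZ; rewrite {2}addrC.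
  by apply: is_adjointD => //; exact: adjP.
- apply: le_lt_trans (opnormZ _ (bopD bx bx')) _.
  rewrite cabs_real ger0_norm ?invr_ge0//; have := opnormD bx bx'; lra.
have [|||b [Mb b1 xb]] := @star_hom_kaplansky_selfadjoint ((- 'i%C * h2) *: (x - adj x)).
- by apply: (oaZ oN); exact: (oaB oN).
- have {2}-> : (- 'i%C * h2) *: (x - adj x) = (- 'i%C * h2)^* *: (adj x - x).
    rewrite -[adj x - x]opprB scalerN -scaleNr; congr (_ *: _).
    by apply: complex_eq; rewrite /=; ring.
  by apply: is_adjointZ; apply: is_adjointB => //; exact: adjP.
- apply: le_lt_trans (opnormZ _ (bopB bx bx')) _.
  rewrite cabsM cabs_real ger0_norm ?invr_ge0//.
  rewrite cabsN cabs_i.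
  have := opnormB bx bx'; lra.
have ba := bM Ma; have bb := bM Mb.
exists (a + 'i%C *: b); split; first by apply: (oaD oM) => //; exact: (oaZ oM).
  have := opnormD ba (bopZ 'i%C bb); have := opnormZ 'i%C bb; rewrite cabs_i; lra.
have bp := star_hom_bop Ma; have bq := star_hom_bop Mb.
rewrite (homD hphi) ?(homZ oM hphi)//; last exact: (oaZ oM).
have -> : x - (phi a + 'i%C *: phi b) = (h2 *: (x + adj x) - phi a) +
    'i%C *: ((- 'i%C * h2) *: (x - adj x) - phi b).
  rewrite scalerBr scalerA mulrA mulrN.
  have -> : - ('i%C * 'i%C) = 1 :> R[i] by apply: complex_eq => /=; ring.
  rewrite mul1r addrACA -scalerDr -opprD; congr (_ - _).
  by rewrite addrACA subrr addr0 scalerDr scale_halfD.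
have b1' := bopB (bopZ h2 (bopD bx bx')) bp.
have b2' := bopB (bopZ (- 'i%C * h2) (bopB bx bx')) bq.
have := opnormD b1' (bopZ 'i%C b2'); have := opnormZ 'i%C b2'; rewrite cabs_i; lra.
Qed.

Lemma star_hom_approx x : N x ->
  exists c, [/\ M c, opnorm c <= 3 * opnorm x &
    opnorm (x - phi c) <= 2 / 3 * opnorm x].
Proof.
move=> Nx; have oN := star_hom_range_closure.1; have bx := oa_bop oN Nx.
have [x0|n0] := eqVneq (opnorm x) 0.
  exists 0; split; first exact: (oa0 oM); first by rewrite opnorm0 x0 mulr0.
  by rewrite (hom0 oM hphi) subr0 x0 mulr0.
have p0 : 0 < opnorm x by rewrite lt_neqAle eq_sym n0 opnorm_ge0.
(* Scaling to norm [3/4] meets the strict bound of the previous lemma; undoing it turns 2 into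
   [8/3], which is below 3, and [1/2] into the error [2/3]. *)
pose r := 3 / 4 / opnorm x; have r0 : 0 < r by rewrite !divr_gt0.
have [||c [Mc c1 xc]] := @star_hom_kaplansky (r%:C%C *: x).
- exact: (oaZ oN).
- apply: le_lt_trans (opnormZ _ bx) _; rewrite cabs_real gtr0_norm// /r divfK//; lra.
pose s := r^-1; have s0 : 0 < s by rewrite invr_gt0.
have sE : s = 4 / 3 * opnorm x by rewrite /s /r invfM invrK invf_div.
have bc := bM Mc; have bp := star_hom_bop Mc.
exists (s%:C%C *: c); split; first exact: (oaZ oM).
  apply: le_trans (opnormZ _ bc) _; rewrite cabs_real gtr0_norm// sE; nra.
have -> : x - phi (s%:C%C *: c) = s%:C%C *: (r%:C%C *: x - phi c).
  rewrite (homZ oM hphi)// scalerBr scalerA -rmorphM/= /s mulVf ?gt_eqF//.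
  by rewrite scale1r.
apply: le_trans (opnormZ _ (bopB (bopZ _ bx) bp)) _.
rewrite cabs_real gtr0_norm// sE; nra.
Qed.

(* The errors of successive approximations decay geometrically, as in the open
   mapping theorem. *)
Lemma star_hom_range_closed : N `<=` phi @` M.
Proof.
move=> d Nd; have cN := star_hom_range_closure; have oN := cN.1.
have bN := oa_bop oN; have bd := bN _ Nd.
have /choice[g gP] : forall x, exists c, N x -> [/\ M c, opnorm c <= 3 * opnorm x &
    opnorm (x - phi c) <= 2 / 3 * opnorm x].
  move=> x; have [/star_hom_approx[c hc]|nN] := pselect (N x); first by exists c.
  by exists 0 => /nN.
pose s n := iter n (fun c => c + g (d - phi c)) 0.
have Nphi c : M c -> N (phi c).
  by move=> Mc; apply: sub_opclosure star_hom_range_bop _ _; exists c.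
have Ms n : M (s n).
  elim: n => [|n ih]; first exact: (oa0 oM).
  have [//|Mg _ _] := gP (d - phi (s n)); first by apply: (oaB oN) => //; exact: Nphi.
  exact: (oaD oM).
have Nds n : N (d - phi (s n)) by apply: (oaB oN) => //; exact: Nphi.
pose D := opnorm d; have D0 : 0 <= D := opnorm_ge0 d.
have dn n : opnorm (d - phi (s n)) <= (2 / 3) ^+ n * D.
  elim: n => [|n ih]; first by rewrite (hom0 oM hphi) subr0 expr0 mul1r.
  have [//|Mg _ h] := gP (d - phi (s n)).
  rewrite /s iterS -/(s n) (homD hphi)// opprD addrA exprS -mulrA.
  by apply: le_trans h _; rewrite ler_wpM2l.
have q0 n : 0 <= (2 / 3 : R) ^+ n by rewrite exprn_ge0.
have step n : opnorm (s n.+1 - s n) <= 3 * ((2 / 3) ^+ n * D).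
  have [//|Mg h _] := gP (d - phi (s n)).
  by rewrite /s iterS -/(s n) addrC addKr (le_trans h)// ler_wpM2l.
(* The 9 is [3 / (1 - 2/3)], the sum of the geometric series of step bounds. Keeping the tail on the
   left makes the induction on [k] close. *)
have sn n k : opnorm (s (n + k)%N - s n) + 9 * ((2 / 3) ^+ (n + k) * D) <=
    9 * ((2 / 3) ^+ n * D).
  elim: k => [|k ih]; first by rewrite addn0 subrr opnorm0 add0r.
  have bs m := bM (Ms m).
  rewrite addnS; have := opnorm_dist_triangle (bs (n + k).+1) (bs (n + k)%N) (bs n).
  have := step (n + k)%N; rewrite exprS; lra.
have small (e : R) : 0 < e -> exists m, forall n, (m <= n)%N -> 9 * ((2 / 3) ^+ n * D) < e.
  move=> e0; have D1 : 0 < 9 * D + 1 by rewrite ltr_wpDl// mulr_ge0.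
  have [||m hm] := @expr_small _ (2 / 3 : R) _ _ _ (divr_gt0 e0 D1); [lra|lra|].
  exists m => n /hm; rewrite ltr_pdivlMr//; have := q0 n; lra.
have [c bc sc] : exists2 a, bounded_op a &
    forall e : R, 0 < e -> exists N, forall n, (N <= n)%N -> opnorm (s n - a) < e.
  apply: op_complete => [n|e e0]; first exact: bM (Ms n).
  have [m hm] := small _ e0; exists m.
  move=> i j /andP[mi ij]; rewrite opnormBC -(subnKC ij).
  apply: le_lt_trans (hm _ mi).
  have := sn i (j - i)%N; have := mulr_ge0 (q0 (i + (j - i))%N) D0; lra.
have Mc : M c.
  apply: (oa_closed oM); split=> // e /sc[m hm]; exists (s m) => //.
  by rewrite opnormBC hm.
exists c => //; apply/eqP; rewrite -subr_eq0; apply/eqP/opnorm_lim0 => [|e e0].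
  by apply: bopB => //; exact: star_hom_bop.
have e2 : 0 < e / 2 by rewrite divr_gt0.
have [m hm] := small _ e2; have [m' hm'] := sc _ e2.
pose n := maxn m m'; have h1 := hm n (leq_maxl _ _); have h2 := hm' n (leq_maxr _ _).
have Msn := Ms n; have bsn := star_hom_bop Msn.
apply: le_trans (opnorm_dist_triangle (star_hom_bop Mc) bsn bd) _.
rewrite -(homB oM hphi)// opnormBC in h2 *.
have := star_hom_contractive cM bB sphi (oaB oM Mc Msn).
have := dn n; rewrite (opnormBC d); have := mulr_ge0 (q0 n) D0; move: h1 h2 => /=; lra.
Qed.

Lemma star_hom_range_cstar : cstar_algebra (phi @` M).
Proof.
suff <- : N = phi @` M by exact: star_hom_range_closure.
apply/seteqP; split; first exact: star_hom_range_closed.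
exact: sub_opclosure star_hom_range_bop.
Qed.

End StarHomRange.

(** * Contractive homomorphisms of C*-algebras preserve adjoints *)

Section ContractiveHom.
Variables (R : realType) (H K : hilbert R).
Variables (M : set (op H)) (B : set (op K)) (phi : op H -> op K).
Hypotheses (cM : cstar_algebra M) (bB : B `<=` @bounded_op R K)
  (hphi : alg_hom M B phi) (nphi : forall a, M a -> opnorm (phi a) <= opnorm a).

Let oM := cM.1.
Let bM := oa_bop oM.

Let bphi a : M a -> bounded_op (phi a).
Proof. by move=> Ma; apply: bB; exact: (hom_in hphi). Qed.

(* The witness is [k = 1 - (1 - h^2)^(2m)], a polynomial in [h] without constant
   term, since the algebra need not be unital. *)
Lemma approx_unit_selfadjoint h (e : R) : M h -> is_adjoint h h ->
  opnorm h <= 1 -> 0 < e ->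
  exists k', let k := h \o k' in
    [/\ M k', is_adjoint k k, k \o h = h \o k, opnorm k <= 1 &
        opnorm ((k \o h) - h) <= e].
Proof.
move=> Mh sh h1 e0; have bh := bM Mh; have lh := bop_linear bh.
pose P z := z - h (h z).
have lP : linear P.
  by move=> c x y; rewrite /P !lh; hring.
have hn z : hnorm (h z) <= hnorm z by exact: contraction.
have Ph z : P (h z) = h (P z) by rewrite /P (linear_fB lh).
have sP : is_adjoint P P.
  by move=> x y; rewrite /P innerBl innerBr !sh.
have lPn n : linear (iter n P) by elim: n => // n ih c x y; rewrite !iterS ih lP.
have Pnh n z : iter n P (h z) = h (iter n P z).
  by elim: n => // n ih; rewrite !iterS ih Ph.
have sPn n : is_adjoint (iter n P) (iter n P).
  elim: n => [|n ih] x y //.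
  by rewrite iterS sP ih -iterSr.
have Pdec z : hnorm (P z) ^+ 2 + hnorm (h z) ^+ 2 <= hnorm z ^+ 2.
  rewrite /P hnormB2 -sh hnormE /=.
  have : hnorm (h (h z)) ^+ 2 <= hnorm (h z) ^+ 2.
    by rewrite ler_sq ?hnorm_ge0.
  lra.
have Pn z : hnorm (P z) <= hnorm z.
  rewrite -ler_sq ?hnorm_ge0//.
  have := Pdec z; have := sqr_ge0 (hnorm (h z)); lra.
have Pnn n z : hnorm (iter n P z) <= hnorm z.
  by elim: n => // n ih; rewrite iterS (le_trans (Pn _)).
(* Summing [|P y|^2 + |h y|^2 <= |y|^2] along the orbit of [z], where [|h (P^j z)|] decreases in
   [j], bounds [|h (P^n z)|] by [|z| / sqrt n] without the spectral theorem. *)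
have hPn n z : n%:R * hnorm (h (iter n P z)) ^+ 2 + hnorm (iter n P z) ^+ 2 <=
    hnorm z ^+ 2.
  elim: n => [|n ih]; first by rewrite mul0r add0r.
  apply: le_trans ih; rewrite -addn1 natrD addn1 !iterS.
  have := Pdec (iter n P z); rewrite -Ph.
  have : hnorm (P (h (iter n P z))) ^+ 2 <= hnorm (h (iter n P z)) ^+ 2.
    by rewrite ler_sq ?hnorm_ge0.
  have n0 : 0 <= n%:R :> R by [].
  move=> /(ler_wpM2l n0); rewrite Ph.
  have : hnorm (P (h (iter n P z))) ^+ 2 <= hnorm (h (iter n P z)) ^+ 2.
    by rewrite ler_sq ?hnorm_ge0.
  rewrite Ph; lra.
(* The recursion makes [h (G n) = 1 - P^n] while every [G n] remains in the algebra. *)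
pose G n : op H := iter n (fun g => h + g - (h \o (h \o g))) 0.
have MG n : M (G n).
  elim: n => [|n ih]; first exact: (oa0 oM).
  apply: (oaB oM); first exact: (oaD oM).
  by do 2 apply: (oa_comp oM) => //.
have GE n z : h (G n z) = z - iter n P z.
  elim: n => [|n ih]; first by rewrite /= (linear_f0 lh) subrr.
  rewrite /G iterS -/(G n) !fctE /= !(linear_fB lh) (linear_fD lh) ih.
  by rewrite [in RHS]/P !(linear_fB lh); hring.
have [m hm] := inv_small (mulr_gt0 e0 e0).
(* An even exponent makes [P^n] a square of a self-adjoint contraction, which is what bounds
   [1 - P^n] by 1; [n] also exceeds [1 / e^2], as the error estimate requires. *)
have [n nE] : exists n, n = (m.+1 + m.+1)%N by exists (m.+1 + m.+1)%N.
exists (G n); split.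
- exact: MG.
- by move=> x y /=; rewrite !GE innerBl innerBr sPn.
- by apply/funext => z /=; rewrite !GE Pnh (linear_fB lh).
- apply: opnorm_ub => // z; rewrite mul1r /= GE.
  rewrite -ler_sq ?hnorm_ge0// hnormB2.
  rewrite nE iterD -sPn hnormE /=.
  set t := iter m.+1 P z.
  have : hnorm (iter m.+1 P t) ^+ 2 <= hnorm t ^+ 2.
    by rewrite ler_sq ?hnorm_ge0.
  have := sqr_ge0 (hnorm t); lra.
- apply: opnorm_ub => [|z]; first exact: ltW.
  rewrite !fctE /= GE Pnh addrAC subrr add0r hnormN.
  rewrite -ler_sq ?mulr_ge0 ?hnorm_ge0 ?(ltW e0)//.
  rewrite exprMn; have := hPn n z; set X := hnorm (h _) ^+ 2.
  have X0 : 0 <= X by exact: sqr_ge0.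
  have : m.+1%:R <= n%:R :> R by rewrite ler_nat nE leq_addr.
  have m0 : 0 < m.+1%:R :> R by rewrite ltr0n.
  move=> h2 h3; have h4 : m.+1%:R * X <= hnorm z ^+ 2.
    apply: le_trans h3; apply: le_trans (_ : n%:R * X <= _).
      by rewrite ler_wpM2r.
    by rewrite lerDl sqr_ge0.
  have h5 : X <= m.+1%:R^-1 * hnorm z ^+ 2 by rewrite ler_pdivlMl.
  apply: le_trans h5 _; rewrite ler_wpM2r ?sqr_ge0// expr2; exact: ltW.
Qed.

Section SelfAdjoint.
Variable h : op H.
Hypotheses (Mh : M h) (sh : is_adjoint h h) (h1 : opnorm h <= 1).

Let T := phi h.
Let bT : bounded_op T := bphi Mh.
Let T' := adj T.
Let bT' : bounded_op T' := bop_adj bT.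
Let TT' : is_adjoint T T' := adjP bT.

(** Contractivity of [phi] transports the approximate unit [k]: [phi k] nearly fixes the range of
    [T] and replaces the identity. Since [k] is a multiple of [h], the values of [phi k] lie in the
    range of [T]. *)
Let approx (e : R) : 0 < e -> exists k, [/\ M k, is_adjoint k k, k \o h = h \o k,
  opnorm k <= 1 & [/\ forall x, hnorm (phi k x) <= hnorm x,
  forall x, exists y, phi k x = T y,
  forall x, hnorm (phi k (T x) - T x) <= e * hnorm x &
  forall x, hnorm (T (phi k x) - T x) <= e * hnorm x]].
Proof.
move=> e0; have [k' [Mk' sk kh k1 ke]] := approx_unit_selfadjoint Mh sh h1 e0.
have Mk := oa_comp oM Mh Mk'; exists (h \o k'); split=> //.
have Mkh := oa_comp oM Mk Mh.
have E x : hnorm (phi ((h \o k') \o h) x - T x) <= e * hnorm x.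
  have -> : phi ((h \o k') \o h) x - T x = phi (((h \o k') \o h) - h) x.
    by rewrite (homB oM hphi).
  have Md := oaB oM Mkh Mh.
  exact: opnorm_bound (bphi Md) (le_trans (nphi Md) ke).
split=> x.
- exact: contraction (bphi Mk) (le_trans (nphi Mk) k1).
- by exists (phi k' x); rewrite (hom_comp hphi).
- by have := E x; rewrite (hom_comp hphi Mk Mh).
- by have := E x; rewrite kh (hom_comp hphi Mh Mk).
Qed.

(** The numerical-range argument: [k] and [h] are commuting self-adjoint contractions, so
    [k + i t h] has norm at most [sqrt (1 + t^2)]. Applying [phi] gives
    [|z + i t T z|^2 <= (1 + t^2) |z|^2] for [z = T x], and the term linear in [t], which carries
    the imaginary part of [<z, T z>], must vanish. *)
Let range_real x : inner K (T (T x)) (T x) = inner K (T x) (T (T x)).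
Proof.
set z := T x.
suff q : forall t : R, 0 <= t ^+ 2 * hnorm z ^+ 2 +
    t * (- complex.Re ('i%C^* * inner K z (T z)) *+ 2).
  have {q}/eqP := quad_ge0_lin0 (sqr_ge0 (hnorm z)) q.
  rewrite mulrn_eq0 /= oppr_eq0 => /eqP.
  rewrite (innerC z (T z)); case: (inner K z (T z)) => a b /= q.
  by apply: complex_eq => //=; lra.
move=> t; pose c : R[i] := t%:C%C * 'i%C.
have bound k : M k -> is_adjoint k k -> k \o h = h \o k -> opnorm k <= 1 ->
    forall y, hnorm (phi k y + c *: T y) <= Num.sqrt (1 + t ^+ 2) * hnorm y.
  move=> Mk sk kh k1 y; have bk := bM Mk; have bh := bM Mh.
  have t0 : 0 <= 1 + t ^+ 2 by rewrite addr_ge0// sqr_ge0.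
  have Mc : M (k + c *: h) by apply: (oaD oM) => //; exact: (oaZ oM).
  have n1 : opnorm (k + c *: h) <= Num.sqrt (1 + t ^+ 2).
    apply: opnorm_ub => [|w]; first exact: sqrtr_ge0.
    rewrite -ler_sq ?mulr_ge0 ?hnorm_ge0 ?sqrtr_ge0//.
    rewrite exprMn sqr_sqrtr// !fctE hnormD2 hnormZ innerZr.
    have kw : hnorm (k w) <= hnorm w by exact: contraction.
    have hw : hnorm (h w) <= hnorm w by exact: contraction.
    (* Commutation makes [<k w, h w>] real, and [c] is purely imaginary. *)
    have -> : complex.Re (c^* * inner H (k w) (h w)) = 0.
      have : inner H (k w) (h w) = (inner H (k w) (h w))^*.
        have khw : k (h w) = h (k w) := congr1 (@^~ w) kh.
        by rewrite -innerC (sk w (h w)) khw -sh.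
      rewrite /c; case: (inner H _ _) => a b /= [] hb.
      have {}hb : b = 0 by lra.
      by rewrite hb; ring.
    have cE : cabs c ^+ 2 = t ^+ 2.
      by rewrite /c cabsM cabs_real cabs_i mulr1 real_normK ?num_real.
    rewrite exprMn cE mul0rn addr0 mulrDl mul1r.
    rewrite lerD// ?ler_wpM2l ?sqr_ge0// ler_sq ?hnorm_ge0//.
  have -> : phi k y + c *: T y = phi (k + c *: h) y.
    by rewrite (homD hphi) ?(homZ oM hphi)//; exact: (oaZ oM).
  exact: opnorm_bound (bphi Mc) (le_trans (nphi Mc) n1).
have lim : hnorm (z + c *: T z) <= Num.sqrt (1 + t ^+ 2) * hnorm z.
  apply: (@ler_epsM _ _ _ (hnorm x)) => e e0.
  have [k [Mk sk kh k1 [_ _ kT _]]] := approx e0.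
  have -> : z + c *: T z = (phi k z + c *: T z) - (phi k z - z) by hring.
  apply: le_trans (hnormB _ _) _; rewrite lerD ?kT//.
  exact: bound.
have {lim} : hnorm (z + c *: T z) ^+ 2 <= (1 + t ^+ 2) * hnorm z ^+ 2.
  rewrite -(@sqr_sqrtr _ (1 + t ^+ 2)) ?addr_ge0 ?sqr_ge0// -exprMn.
  by rewrite ler_sq ?mulr_ge0 ?hnorm_ge0 ?sqrtr_ge0.
rewrite hnormD2 innerZr /c rmorphM /= conj_realC.
rewrite -mulrA cReZ; have := sqr_ge0 (hnorm ((t%:C%C * 'i%C) *: T z)).
set X := complex.Re _; lra.
Qed.

(** [range_real] says that the quadratic form of [T' T T - T' T' T] is zero; polarisation then frees
    the second argument. *)
Let range_symm x y : inner K (T (T x)) (T y) = inner K (T x) (T (T y)).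
Proof.
have : (T' \o (T \o T)) - (T' \o (T' \o T)) = 0.
  apply: quad_form_eq0 => [|w].
    apply: bop_linear; apply: bopB; do 2 apply: bop_comp => //.
  rewrite !fctE /= innerBl !(is_adjointC TT') range_real.
  by rewrite subrr.
move=> /(congr1 (@^~ x)) /eqP; rewrite subr_eq0 => /eqP /= E.
by rewrite -(is_adjointC TT') E !(is_adjointC TT').
Qed.

(** This treats vectors [x] orthogonal to the range of [T]. With [z = T (T x)], orthogonality gives
    [|z + s x|^2 = |z|^2 + s^2 |x|^2], and the contraction [S = phi k] cannot increase it. But [S z]
    is close to [z], and since [S x] lies in the range, [range_symm] brings [<z, S x>] close to
    [|T x|^2]. The resulting term [2 s |T x|^2] has to vanish. *)
Let ker_sub x : T' x = 0 -> T x = 0.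
Proof.
move=> Tx0; have orth y : inner K (T y) x = 0 by rewrite TT' Tx0 inner0r.
suff q : forall s : R, 0 <= s ^+ 2 * hnorm x ^+ 2 + s * (- hnorm (T x) ^+ 2 *+ 2).
  have {q}/eqP := quad_ge0_lin0 (sqr_ge0 (hnorm x)) q.
  rewrite mulrn_eq0 /= oppr_eq0 sqrf_eq0 => /eqP; exact: hnorm_eq0.
move=> s; set z := T (T x).
set a := hnorm (T x).
apply: (@ler_epsM _ _ _ (hnorm z * a *+ 2 + `|s| * (a * hnorm x) *+ 4)) => e e0.
have [k [Mk _ _ _ [kc kr kT Tk]]] := approx e0; set S := phi k in kc kr kT Tk.
have [y Sx] := kr x.
have lS : linear S := bop_linear (bphi Mk).
pose d := S z - z; have dn : hnorm d <= e * a by exact: kT.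
have h2 : hnorm (S z + s%:C%C *: S x) ^+ 2 <= hnorm z ^+ 2 + s ^+ 2 * hnorm x ^+ 2.
  have <- : hnorm (z + s%:C%C *: x) ^+ 2 = hnorm z ^+ 2 + s ^+ 2 * hnorm x ^+ 2.
    rewrite hnormD2 innerZr orth mulr0 mul0rn addr0 hnormZ cabs_real exprMn.
    by rewrite real_normK ?num_real.
  rewrite ler_sq ?hnorm_ge0// -(linear_fZ lS) -(linear_fD lS).
  exact: kc.
have h3 : hnorm z ^+ 2 - (hnorm z * (e * a)) *+ 2 <= hnorm (S z) ^+ 2.
  have -> : S z = z - (- d) by rewrite /d; hring.
  rewrite hnormB2; have := cRe_inner_le z (- d); rewrite hnormN => h4.
  have := ler_wpM2l (hnorm_ge0 z) dn; have := sqr_ge0 (hnorm d); lra.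
have h5 : s * complex.Re (inner K (S z) (S x)) >=
    s * a ^+ 2 - `|s| * (e * a * hnorm x) *+ 2.
  have -> : inner K (S z) (S x) = inner K (T x) (T x) +
      (inner K (T x) (T (S x) - T x) + inner K d (S x)).
    have -> : S z = z + d by rewrite /d; hring.
    by rewrite innerDl {1}Sx range_symm -Sx innerBr; ring.
  rewrite hnormE !cReD /= mulrDr lerD2l.
  have b1 : cabs (inner K (T x) (T (S x) - T x)) <= e * a * hnorm x.
    apply: le_trans (CauchySchwarz_hnorm _ _) _.
    by rewrite -/a [e * a]mulrC -mulrA ler_wpM2l ?hnorm_ge0.
  have b2 : cabs (inner K d (S x)) <= e * a * hnorm x.
    apply: le_trans (CauchySchwarz_hnorm _ _) _.
    by rewrite ler_pM ?hnorm_ge0.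
  have Rn (c : R[i]) (b : R) : cabs c <= b -> - (`|s| * b) <= s * complex.Re c.
    move=> cb; have := cRe_le_cabs (- (s%:C%C * c)).
    rewrite cReN cReZ => h6; rewrite lerNl (le_trans h6)//.
    by rewrite cabsN cabsM cabs_real ler_wpM2l.
  by have := lerD (Rn _ _ b1) (Rn _ _ b2); lra.
rewrite hnormD2 innerZr conj_realC cReZ in h2.
have := sqr_ge0 (hnorm (s%:C%C *: S x)).
move: h2 h3 h5; rewrite -/a; lra.
Qed.

(** For the skew operator [S = T - T'], [S S y = 0] implies [S y = 0]. From [T' S T = 0], which is
    [range_symm], [ker_sub] gives [T S T = 0], hence [S S T = 0] and [S T = 0]. Taking adjoints,
    [T' S = 0], and the same two moves give [S = 0]. *)
Lemma contractive_hom_selfadjoint : is_adjoint T T.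
Proof.
pose S : op K := T - T'; have bS : bounded_op S by exact: bopB.
have lS := bop_linear bS.
have skew x y : inner K (S x) y = - inner K x (S y).
  by rewrite /S !fctE innerBl innerBr TT' -(is_adjointC TT') opprB.
have S0 x : S (S x) = 0 -> S x = 0.
  move=> SS; apply: hnorm_eq0; apply/eqP; rewrite -sqrf_eq0 hnorm_sqr skew SS.
  by rewrite inner0r oppr0.
have T'ST x : T' (S (T x)) = 0.
  apply: inner_extr => y; rewrite inner0r -TT' /S !fctE innerBr.
  by rewrite -range_symm TT' subrr.
have ST x : S (T x) = 0.
  apply: S0; rewrite {1}/S !fctE T'ST subr0; apply: ker_sub; exact: T'ST.
have T'S x : T' (S x) = 0.
  apply: inner_extr => y; rewrite inner0r -TT'.
  by apply: oppr_inj; rewrite -skew ST inner0l oppr0.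
have S00 x : S x = 0.
  by apply: S0; rewrite {1}/S !fctE T'S subr0; apply: ker_sub; exact: T'S.
suff E : T = T' by rewrite {2}E.
by apply/funext => x; apply/eqP; rewrite -subr_eq0; apply/eqP; exact: S00.
Qed.

End SelfAdjoint.

(** Scaling extends the previous lemma to all self-adjoint elements; a pair of adjoints [a], [b] is
    recovered from the self-adjoint [a + b] and [i (a - b)]. *)
Lemma contractive_hom_star : star_hom M B phi.
Proof.
have sa h : M h -> is_adjoint h h -> is_adjoint (phi h) (phi h).
  move=> Mh sh; have bh := bM Mh.
  pose r := (opnorm h + 1)^-1; have p0 : 0 < opnorm h + 1 by rewrite ltr_wpDl ?opnorm_ge0.
  have r0 : 0 < r by rewrite invr_gt0.
  have Mr : M (r%:C%C *: h) by exact: (oaZ oM).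
  have sr : is_adjoint (r%:C%C *: h) (r%:C%C *: h).
    by rewrite -{2}conj_realC; exact: is_adjointZ.
  have r1 : opnorm (r%:C%C *: h) <= 1.
    apply: le_trans (opnormZ _ bh) _; rewrite cabs_real gtr0_norm// mulrC.
    by rewrite ler_pdivrMr// mul1r lerDl.
  have := contractive_hom_selfadjoint Mr sr r1.
  rewrite (homZ oM hphi)// => /(is_adjointZ (r^-1)%:C%C).
  by rewrite conj_realC !scalerA -rmorphM mulVf ?gt_eqF// scale1r.
split=> // a b Ma Mb ab; have ba := is_adjointC ab.
have h2C : ((2^-1 : R)%:C%C)^* = (2^-1 : R)%:C%C := conj_realC _.
have s1 : is_adjoint (a + b) (a + b) by rewrite {2}addrC; exact: is_adjointD.
have s2 : is_adjoint ('i%C *: (a - b)) ('i%C *: (a - b)).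
  have {2}-> : 'i%C *: (a - b) = ('i%C : R[i])^* *: (b - a).
    rewrite -[b - a]opprB scalerN -scaleNr; congr (_ *: _).
    by apply: complex_eq; rewrite /= ?oppr0 ?opprK.
  by apply: is_adjointZ; exact: is_adjointB.
have Mab := oaB oM Ma Mb.
have := sa _ (oaD oM Ma Mb) s1; rewrite (homD hphi)// => t1.
have := sa _ (oaZ oM _ Mab) s2; rewrite (homZ oM hphi)// (homB oM hphi)// => t2.
have t3 := is_adjointZ (- 'i%C) t2.
have t4 := is_adjointZ (2^-1 : R)%:C%C (is_adjointD t1 t3).
move: t4; rewrite !scalerA.
have -> : - 'i%C * 'i%C = 1 :> R[i] by apply: complex_eq => /=; ring.
have -> : (- 'i%C)^* * 'i%C = -1 :> R[i] by apply: complex_eq => /=; ring.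
rewrite !scale1r h2C scaleN1r opprB.
have -> : phi a + phi b + (phi a - phi b) = phi a + phi a by rewrite addrACA subrr addr0.
have -> : phi a + phi b + (phi b - phi a) = phi b + phi b by rewrite addrC -addrA addKr.
by rewrite !scalerDr !scale_halfD.
Qed.

End ContractiveHom.

(** * Matrices of operators *)

Section RealCauchySchwarz.
Variables (R : realType) (I : finType).

Lemma sum_CauchySchwarz (a b : I -> R) :
  (\sum_i a i * b i) ^+ 2 <= (\sum_i a i ^+ 2) * (\sum_i b i ^+ 2).
Proof.
set A := \sum_i a i ^+ 2; set B := \sum_i b i ^+ 2; set C := \sum_i a i * b i.
have A0 : 0 <= A by apply: sumr_ge0 => i _; exact: sqr_ge0.
have [Az|An] := eqVneq A 0.
  suff -> : C = 0 by rewrite Az mul0r expr0n.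
  apply: big1 => i _; have /eqP := Az.
  rewrite psumr_eq0 => [/allP/(_ i)|j _]; last exact: sqr_ge0.
  by rewrite mem_index_enum sqrf_eq0 => /(_ isT)/eqP ->; rewrite mul0r.
have Ap : 0 < A by rewrite lt_neqAle eq_sym An.
have : 0 <= \sum_i (A * b i - C * a i) ^+ 2 by apply: sumr_ge0 => i _; exact: sqr_ge0.
have -> : \sum_i (A * b i - C * a i) ^+ 2 = A * (A * B - C ^+ 2).
  rewrite (eq_bigr (fun i => A ^+ 2 * b i ^+ 2 +
    (- (A * C *+ 2) * (a i * b i) + C ^+ 2 * a i ^+ 2))) => [|i _]; last by ring.
  by rewrite !big_split/= -!mulr_sumr -/A -/B -/C; ring.
by rewrite pmulr_rge0// subr_ge0.
Qed.

End RealCauchySchwarz.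

(** A separate name for the function space, so that the square-sum norm can be attached to it. *)
Definition hsum (R : realType) (H : hilbert R) (I : finType) : Type := I -> H.

Section Hsum.
Variables (R : realType) (H : hilbert R) (I : finType).

HB.instance Definition _ := GRing.Lmodule.copy (hsum H I) (I -> hs_sort H).

Implicit Types x y : hsum H I.

Definition hsum_inner x y : R[i] := \sum_i inner H (x i) (y i).

Definition hsum_norm x : R[i] := (Num.sqrt (\sum_i hnorm (x i) ^+ 2))%:C%C.

Let sumsq_ge0 x : 0 <= \sum_i hnorm (x i) ^+ 2.
Proof. by apply: sumr_ge0 => i _; exact: sqr_ge0. Qed.

Lemma hsum_normD x y : hsum_norm (x + y) <= hsum_norm x + hsum_norm y.
Proof.
rewrite /hsum_norm -rmorphD lecR.
rewrite -ler_sq ?addr_ge0 ?sqrtr_ge0//.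
rewrite sqrrD !sqr_sqrtr//.
have h : \sum_i hnorm (x i) * hnorm (y i) <=
    Num.sqrt (\sum_i hnorm (x i) ^+ 2) * Num.sqrt (\sum_i hnorm (y i) ^+ 2).
  rewrite -sqrtrM// -[leLHS]ger0_norm; last first.
    by apply: sumr_ge0 => i _; rewrite mulr_ge0 ?hnorm_ge0.
  by rewrite -sqrtr_sqr ler_wsqrtr// sum_CauchySchwarz.
apply: le_trans (_ : \sum_i (hnorm (x i) ^+ 2 + hnorm (y i) ^+ 2 +
    hnorm (x i) * hnorm (y i) *+ 2) <= _).
  apply: ler_sum => i _; rewrite hnormD2 lerD2l lerMn2r/=.
  exact: cRe_inner_le.
rewrite !big_split/=; lra.
Qed.

Lemma hsum_normZ (c : R[i]) x : hsum_norm (c *: x) = `|c| * hsum_norm x.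
Proof.
rewrite /hsum_norm cabsE -rmorphM/=; congr (_ %:C)%C.
rewrite -[cabs c]ger0_norm ?cabs_ge0// -sqrtr_sqr -sqrtrM ?sqr_ge0//.
by congr Num.sqrt; rewrite mulr_sumr; apply: eq_bigr => i _; rewrite hnormZ exprMn.
Qed.

Lemma hsum_norm_eq0 x : hsum_norm x = 0 -> x = 0.
Proof.
move=> /complexI/eqP; rewrite sqrtr_eq0 => h; apply/funext => i; apply: hnorm_eq0.
apply/eqP; rewrite -sqrf_eq0 eq_le sqr_ge0 andbT (le_trans _ h)//.
by rewrite (bigD1 i)//= lerDl sumr_ge0// => j _; exact: sqr_ge0.
Qed.

HB.instance Definition _ := Lmodule_isNormed.Build R[i] (hsum H I)
  hsum_normD hsum_normZ hsum_norm_eq0.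

Lemma hsum_complete (F : set_system (hsum H I)) :
  ProperFilter F -> cauchy F -> cvg F.
Proof.
move=> FF /cauchy_ballP cF.
have comp i : exists l : H, (fun x : hsum H I => x i) @ F --> l.
  suff /cauchy_cvg/cvg_ex[l hl] : cauchy ((fun x : hsum H I => x i) @ F) by exists l.
  apply/cauchy_ballP => e e0.
  have [[A B] /= [FA FB] AB] := cF e e0.
  exists ((fun x : hsum H I => x i) @` A, (fun x : hsum H I => x i) @` B) => /=.
    split; [apply: filterS FA|apply: filterS FB] => x ?; by exists x.
  move=> [_ _] /= [[x Ax <-] [y By <-]].
  have := AB (x, y) (conj Ax By); rewrite -!ball_normE /= => /(le_lt_trans _); apply.
  rewrite hnormC lecR -[leLHS]ger0_norm ?hnorm_ge0// -sqrtr_sqr ler_wsqrtr//.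
  by rewrite [leRHS](bigD1 i)//= lerDl sumr_ge0// => j _; exact: sqr_ge0.
have /choice[l lP] := comp.
apply/cvg_ex; exists (l : hsum H I); apply/cvgrPdist_lt => -[e ei].
rewrite ltcE /= => /andP[/eqP ei0 e0].
(* The successor keeps the quotient meaningful for empty [I] and makes the sum of [#|I|] copies of
   [d^2] strictly smaller than [e^2]. *)
pose d := e / (#|I|.+1%:R).
have d0 : 0 < d by rewrite divr_gt0.
have : \forall x \near F, forall i, i \in index_enum I -> `|l i - x i| < d%:C%C.
  elim: (index_enum I) => [|i s ih]; first by near=> x.
  have /cvgrPdist_lt/(_ d%:C%C) := lP i; rewrite ltcR => /(_ d0) h.
  near=> x => j; rewrite inE => /orP[/eqP ->|js]; first by near: x.
  by have : forall i, i \in s -> `|l i - x i| < d%:C%C by [near: x]; apply.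
apply: filterS => x hx; rewrite [ltLHS](_ : _ = hsum_norm (l - x))// /hsum_norm.
rewrite ei0 ltcR -(ltr_pXn2r (ltn0Sn 1)) ?nnegrE ?sqrtr_ge0 ?(ltW e0)//.
rewrite sqr_sqrtr//.
apply: le_lt_trans (_ : \sum_(i : I) d ^+ 2 < _).
  apply: ler_sum => i _; rewrite ler_sq ?hnorm_ge0 ?(ltW d0)//.
  by have := hx i (mem_index_enum i); rewrite hnormC ltcR => /ltW.
rewrite sumr_const -mulr_natr /d expr_div_n -mulrA.
rewrite -[ltRHS]mulr1 ltr_pM2l ?exprn_gt0// mulrC ltr_pdivrMr ?exprn_gt0// mul1r.
rewrite -natrX ltr_nat (@leq_trans #|I|.+1)// leq_pmulr//.
Unshelve. all: by end_near. Qed.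

HB.instance Definition _ := Uniform_isComplete.Build (hsum H I) hsum_complete.

Lemma hsum_inner_bilinear :
  bilinear_for *%R (@Num.conj R[i] \; *%R) hsum_inner.
Proof.
split=> z c x y; rewrite /hsum_inner /= mulr_sumr -big_split/=;
  apply: eq_bigr => i _.
  by rewrite innerDl innerZl.
by rewrite innerDr innerZr.
Qed.

HB.instance Definition _ := bilinear_isBilinear.Build R[i] (hsum H I) (hsum H I)
  R[i] *%R (@Num.conj R[i] \; *%R) hsum_inner hsum_inner_bilinear.

Lemma hsum_inner_hermitian x y :
  hsum_inner x y = (-1) ^+ false * (hsum_inner y x)^*.
Proof.
rewrite expr0 mul1r /hsum_inner rmorph_sum/=.
by apply: eq_bigr => i _; rewrite -innerC.
Qed.

HB.instance Definition _ := isHermitianSesquilinear.Build R[i] (hsum H I) false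
  (@Num.conj R[i]) hsum_inner hsum_inner_hermitian.

Lemma hsum_normE x : `|x| ^+ 2 = hsum_inner x x.
Proof.
rewrite [`|x|]/(hsum_norm x) -rmorphXn/= sqr_sqrtr// rmorph_sum/=.
by apply: eq_bigr => i _; rewrite hnormE.
Qed.

Lemma hsum_inner_gt0 x : x != 0 -> 0 < hsum_inner x x.
Proof. by move=> x0; rewrite -hsum_normE exprn_gt0// normr_gt0. Qed.

HB.instance Definition _ := isDotProduct.Build R[i] (hsum H I) hsum_inner
  hsum_inner_gt0.

Definition hsumH : hilbert R := @Hilbert R (hsum H I) hsum_inner hsum_normE.

Lemma hsumH_innerE (x y : hsumH) : inner hsumH x y = \sum_i inner H (x i) (y i).
Proof. by []. Qed.

Lemma hsumH_hnormE (x : hsumH) : hnorm x ^+ 2 = \sum_i hnorm (x i) ^+ 2.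
Proof.
rewrite hnorm_sqr hsumH_innerE cRe_sum; apply: eq_bigr => i _.
by rewrite hnorm_sqr.
Qed.

End Hsum.

Section MatrixBound.
Variable R : realType.

(** For [C >= 0], a bound on the norm of a matrix from the [J]-fold to the [I]-fold sum of [H].
    Matrices are rectangular over arbitrary finite types because compressions of tensors have index
    sets such as [I * Q] and [J * P]; bounds in place of norms avoid suprema. *)
Definition mxbd (H : hilbert R) (I J : finType) (a : I -> J -> op H) (C : R) : Prop :=
  forall x : J -> H, \sum_i hnorm (\sum_j a i j (x j)) ^+ 2 <=
    C ^+ 2 * \sum_j hnorm (x j) ^+ 2.

Definition mxop (H : hilbert R) (I : finType) (a : I -> I -> op H) : op (hsumH H I) :=
  fun x i => \sum_j a i j (x j).

Definition hinj (H : hilbert R) (I : finType) (j : I) (x : H) : hsumH H I :=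
  fun k => if k == j then x else 0.

Definition entry (H : hilbert R) (I : finType) (t : op (hsumH H I)) (i j : I) : op H :=
  fun x => t (hinj j x) i.

Section Entries.
Variables (H : hilbert R) (I : finType).
Implicit Types (t : op (hsumH H I)) (a : I -> I -> op H).

Lemma hinj_linear (j : I) : linear (@hinj H I j).
Proof.
move=> c x y; apply/funext => k; rewrite !fctE /hinj; case: ifP => // _.
by rewrite scaler0 addr0.
Qed.

Lemma hnorm_hinj (j : I) (x : H) : hnorm (hinj j x) = hnorm x.
Proof.
apply/eqP; rewrite -(@eqrXn2 _ 2) ?hnorm_ge0// hsumH_hnormE (bigD1 j)//= /hinj eqxx.
by rewrite big1 ?addr0// => i /negPf ->; rewrite hnorm0 expr0n.
Qed.

Lemma inner_hinj (j : I) (x : H) (y : hsumH H I) :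
  inner (hsumH H I) y (hinj j x) = inner H (y j) x.
Proof.
rewrite hsumH_innerE (bigD1 j)//= /hinj eqxx big1 ?addr0// => i /negPf ->.
by rewrite inner0r.
Qed.

Lemma hsum_decomp (x : hsumH H I) : x = \sum_j hinj j (x j).
Proof.
apply: inner_extl => y; rewrite inner_suml hsumH_innerE; apply: eq_bigr => i _.
by rewrite [RHS]innerC inner_hinj -innerC.
Qed.

Lemma hsum_coord_le (x : hsumH H I) i : hnorm (x i) <= hnorm x.
Proof.
rewrite -ler_sq ?hnorm_ge0// hsumH_hnormE.
by rewrite (bigD1 i)//= lerDl sumr_ge0// => j _; exact: sqr_ge0.
Qed.

Lemma hsum_sumE (J : Type) (s : seq J) (P : pred J) (F : J -> hsumH H I) i :
  (\sum_(j <- s | P j) F j) i = \sum_(j <- s | P j) F j i.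
Proof. exact: (big_morph (fun x : hsumH H I => x i)). Qed.

Lemma entryE t : bounded_op t -> t = mxop (entry t).
Proof.
move=> bt; apply/funext => x; rewrite {1}[x]hsum_decomp.
rewrite (linear_fsum (bop_linear bt)); apply/funext => i.
by rewrite hsum_sumE.
Qed.

Lemma bop_entry t i j : bounded_op t -> bounded_op (entry t i j).
Proof.
move=> bt; apply/bounded_opE; split=> [c x y|].
  by rewrite /entry hinj_linear (bop_linear bt).
exists (opnorm t) => x; rewrite -(hnorm_hinj j x).
apply: le_trans (le_opnorm _ bt); exact: hsum_coord_le.
Qed.

Lemma opnorm_entry t i j : bounded_op t -> opnorm (entry t i j) <= opnorm t.
Proof.
move=> bt; apply: opnorm_ub => [|x]; first exact: opnorm_ge0.
rewrite -(hnorm_hinj j x).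
apply: le_trans (le_opnorm _ bt); exact: hsum_coord_le.
Qed.

Lemma mxop_entry a : (forall i j, linear (a i j)) ->
  forall i j, entry (mxop a) i j = a i j.
Proof.
move=> la i j; apply/funext => x; rewrite /entry /mxop (bigD1 j)//= /hinj eqxx.
by rewrite big1 ?addr0// => k /negPf ->; rewrite (linear_f0 (la i k)).
Qed.

Lemma mxop_bdP a C : 0 <= C ->
  (forall x, hnorm (mxop a x) <= C * hnorm x) <-> mxbd a C.
Proof.
move=> C0; split=> h x.
  have := h x; rewrite -ler_sq ?mulr_ge0 ?hnorm_ge0//.
  by rewrite exprMn !hsumH_hnormE.
rewrite -ler_sq ?mulr_ge0 ?hnorm_ge0//.
by rewrite exprMn !hsumH_hnormE; exact: h.
Qed.

End Entries.

(** The constant is the Hilbert-Schmidt norm of the scalar matrix of entry norms. *)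
Lemma mxbd_exists (H : hilbert R) (I J : finType) (a : I -> J -> op H) :
  (forall i j, bounded_op (a i j)) -> exists2 C, 0 <= C & mxbd a C.
Proof.
move=> ba; pose D := \sum_i \sum_j opnorm (a i j) ^+ 2.
have D0 : 0 <= D by do 2 (apply: sumr_ge0 => ? _); exact: sqr_ge0.
exists (Num.sqrt D); first exact: sqrtr_ge0.
move=> x; rewrite sqr_sqrtr// mulr_suml; apply: ler_sum => i _.
apply: le_trans (sum_CauchySchwarz _ _).
rewrite ler_sq ?hnorm_ge0//; last first.
  by apply: sumr_ge0 => j _; rewrite mulr_ge0 ?hnorm_ge0 ?opnorm_ge0.
by apply: le_trans (hnorm_sum _ _ _) _; apply: ler_sum => j _; exact: le_opnorm.
Qed.

Lemma bop_mxop (H : hilbert R) (I : finType) (a : I -> I -> op H) :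
  (forall i j, bounded_op (a i j)) -> bounded_op (mxop a).
Proof.
move=> ba; apply/bounded_opE; split=> [c x y|].
  apply/funext => i; rewrite /mxop !fctE scaler_sumr -big_split/=.
  by apply: eq_bigr => j _; rewrite (bop_linear (ba i j)).
have [C C0 aC] := mxbd_exists ba.
by exists C; apply/mxop_bdP.
Qed.

Section MatrixAlgebra.
Variables (H K : hilbert R) (I : finType).
Variables (M : set (op H)) (B : set (op K)) (phi : op H -> op K).
Hypotheses (cM : cstar_algebra M) (bB : B `<=` @bounded_op R K)
  (sphi : star_hom M B phi).

Let oM := cM.1.
Let bM := oa_bop oM.
Let hphi := sphi.1.
Let bphi a (Ma : M a) := star_hom_bop bB sphi Ma.

Definition mxalg : set (op (hsumH H I)) :=
  [set t | bounded_op t /\ forall i j, M (entry t i j)].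

Lemma entry_comp (s t : op (hsumH H I)) : bounded_op s -> bounded_op t -> forall i k,
  entry (s \o t) i k = \sum_j (entry s i j \o entry t j k) :> op H.
Proof.
move=> bs bt i k; apply/funext => x; rewrite fct_sumE /=.
by rewrite {1}/entry /= {1}(entryE bs).
Qed.

Lemma is_adjoint_entry (s t : op (hsumH H I)) : is_adjoint s t -> forall i j,
  is_adjoint (entry s i j : op H) (entry t j i).
Proof.
move=> st i j x y; rewrite /entry -inner_hinj st innerC inner_hinj -innerC //.
Qed.

Lemma mxalg_cstar : cstar_algebra mxalg.
Proof.
split; last first.
  move=> s t [bs Ms] st; split=> [|i j]; first exact: is_adjoint_bop st.
  exact: cM.2 (Ms j i) (is_adjoint_entry st j i).
split; first by move=> t [].
- split; first by split=> [|i j]; [exact: bop0 | exact: (oa0 oM)].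
  move=> c s t [bs Ms] [bt Mt]; split=> [|i j]; first exact: bopZD.
  exact: (oaZD oM c (Ms i j) (Mt i j)).
- move=> s t [bs Ms] [bt Mt]; split=> [|i j]; first exact: bop_comp.
  by rewrite entry_comp//; apply: (oa_sum oM) => k _; exact: (oa_comp oM).
- move=> t [bt ht]; split=> // i j; apply: (oa_closed oM); split.
    exact: bop_entry.
  move=> e /ht[s [bs Ms] ts]; exists (entry s i j) => //.
  apply: le_lt_trans ts.
  exact: (opnorm_entry i j (bopB bt bs)).
Qed.

Definition mxamp (t : op (hsumH H I)) : op (hsumH K I) :=
  mxop (fun i j => phi (entry t i j)).

Lemma mxamp_star_hom : star_hom mxalg (@bounded_op R (hsumH K I)) mxamp.
Proof.
have entry_amp t i j : mxalg t -> entry (mxamp t) i j = phi (entry t i j).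
  move=> [bt Mt]; apply: mxop_entry => {}i {}j.
  exact: bop_linear (bphi (Mt i j)).
split; [split|] => [t [bt Mt]|c s t [bs Ms] [bt Mt]|s t [bs Ms] [bt Mt]|].
- by apply: bop_mxop => i j; exact: bphi.
- apply/funext => x; apply/funext => i; rewrite /mxamp /mxop !fctE scaler_sumr.
  rewrite -big_split/=; apply: eq_bigr => j _.
  by rewrite -[entry (c *: s + t) i j]/(c *: entry s i j + entry t i j) (homZD hphi).
- apply/funext => x; apply/funext => i; rewrite /mxamp /mxop /=.
  under eq_bigr => k _.
    rewrite entry_comp// (hom_sum oM hphi); last by move=> l _; exact: (oa_comp oM).
    rewrite fct_sumE.
    over.
  rewrite exchange_big /=; apply: eq_bigr => j _.
  rewrite (linear_fsum (bop_linear (bphi (Ms i j)))); apply: eq_bigr => k _.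
  by rewrite (hom_comp hphi).
- move=> s t [bs Ms] [bt Mt] st x y; rewrite !hsumH_innerE /mxamp /mxop.
  under eq_bigr do rewrite inner_suml.
  under [RHS]eq_bigr do rewrite inner_sumr.
  rewrite exchange_big /=; apply: eq_bigr => j _; apply: eq_bigr => i _.
  by apply: (sphi.2 _ _ (Ms i j) (Mt j i)); exact: is_adjoint_entry.
Qed.

(** Complete contractivity is contractivity one level up: matrices over [M] form the C*-algebra
    [mxalg] on the Hilbert sum, and the entrywise map [mxamp] is a star-homomorphism on it. *)
Lemma star_hom_mxbd_square (a : I -> I -> op H) C : 0 <= C ->
  (forall i j, M (a i j)) -> mxbd a C -> mxbd (fun i j => phi (a i j)) C.
Proof.
move=> C0 Ma aC; have ba : bounded_op (mxop a) by apply: bop_mxop => i j; exact: bM.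
have entE i j : entry (mxop a) i j = a i j.
  by apply: mxop_entry => {}i {}j; exact: bop_linear (bM (Ma i j)).
have Mt : mxalg (mxop a) by split=> // i j; rewrite entE.
have := star_hom_contractive mxalg_cstar (@subset_refl _ _) mxamp_star_hom Mt.
have -> : mxamp (mxop a) = mxop (fun i j => phi (a i j)).
  by rewrite /mxamp; congr mxop; apply/funext => i; apply/funext => j; rewrite entE.
move=> h; apply/mxop_bdP => // x.
apply: opnorm_bound; first by apply: bop_mxop => i j; exact: bphi.
apply: le_trans h _.
by apply/opnormP => //; apply/mxop_bdP.
Qed.

End MatrixAlgebra.

(* [mxopnorm] is only defined for square matrices. *)
Definition mxpad (H : hilbert R) (I J : finType) (a : I -> J -> op H)
    (i j : I + J) : op H :=
  match i, j with inl i, inr j => a i j | _, _ => 0 end.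

Lemma mxpad_bdP (H : hilbert R) (I J : finType) (a : I -> J -> op H) C :
  mxbd (mxpad a) C <-> mxbd a C.
Proof.
have E (x : I + J -> H) : \sum_i hnorm (\sum_j mxpad a i j (x j)) ^+ 2 =
    \sum_i hnorm (\sum_j a i j (x (inr j))) ^+ 2.
  rewrite big_sumType /= [X in _ + X]big1 ?addr0; last first.
    by move=> j _; rewrite big1 ?hnorm0 ?expr0n// => -[].
  apply: eq_bigr => i _; rewrite big_sumType /= big1 ?add0r//.
split=> h x.
  have := h (fun j => if j is inr j then x j else 0); rewrite E => /le_trans; apply.
  rewrite big_sumType /= big1 ?add0r// => i _; by rewrite hnorm0 expr0n.
rewrite E (le_trans (h _))// big_sumType /= mulrDr lerDr.
by rewrite mulr_ge0 ?sqr_ge0 ?sumr_ge0// => i _; exact: sqr_ge0.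
Qed.

Lemma star_hom_mxbd (H K : hilbert R) (M : set (op H)) (B : set (op K)) phi
    (I J : finType) (a : I -> J -> op H) C :
  cstar_algebra M -> B `<=` @bounded_op R K -> star_hom M B phi -> 0 <= C ->
  (forall i j, M (a i j)) -> mxbd a C -> mxbd (fun i j => phi (a i j)) C.
Proof.
move=> cM bB sphi C0 Ma /mxpad_bdP aC; apply/mxpad_bdP.
have -> : mxpad (fun i j => phi (a i j)) = fun i j => phi (mxpad a i j).
  have p0 := hom0 cM.1 sphi.1.
  by apply/funext => -[i|i]; apply/funext => -[j|j].
apply: (star_hom_mxbd_square cM bB sphi C0 _ aC).
have M0 := oa0 cM.1.
by move=> [i|i] [j|j] //; exact: Ma.
Qed.

End MatrixBound.

Section MatrixBoundTopology.
Variables (R : realType) (H : hilbert R) (I J : finType).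
Implicit Types a b : I -> J -> op H.

Local Notation fnorm x := (hnorm (x : hsumH H _)).

Lemma mxbdP a C : 0 <= C ->
  mxbd a C <-> forall x : J -> H,
    fnorm (fun i => \sum_j a i j (x j)) <= C * fnorm x.
Proof.
move=> C0; split=> h x.
  rewrite -ler_sq ?mulr_ge0 ?hnorm_ge0//.
  by rewrite exprMn !hsumH_hnormE.
have := h x; rewrite -ler_sq ?mulr_ge0 ?hnorm_ge0//.
by rewrite exprMn !hsumH_hnormE.
Qed.

Lemma mxbdD a b C D : 0 <= C -> 0 <= D -> mxbd a C -> mxbd b D ->
  mxbd (fun i j => a i j + b i j) (C + D).
Proof.
move=> C0 D0 /mxbdP-/(_ C0) aC /mxbdP-/(_ D0) bD.
apply/mxbdP => [|x]; first exact: addr_ge0.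
rewrite mulrDl; apply: le_trans (lerD (aC x) (bD x)); apply: le_trans (hnormD _ _).
rewrite le_eqVlt; apply/orP; left; apply/eqP; congr hnorm; apply/funext => i.
by rewrite fctE -big_split.
Qed.

Lemma mxbd_small a e : 0 <= e -> (forall i j, bounded_op (a i j)) ->
  (forall i j, opnorm (a i j) <= e) ->
  mxbd a (e * Num.sqrt (#|I|%:R * #|J|%:R)).
Proof.
move=> e0 ba ae x; rewrite exprMn sqr_sqrtr//.
set S := \sum_j hnorm (x j) ^+ 2.
have -> : e ^+ 2 * (#|I|%:R * #|J|%:R) * S = #|I|%:R * (e ^+ 2 * #|J|%:R * S) by ring.
rewrite [leRHS]mulr_natl -sumr_const; apply: ler_sum => i _.
apply: le_trans (_ : (\sum_j e * hnorm (x j)) ^+ 2 <= _).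
  rewrite ler_sq ?hnorm_ge0//; last first.
    by apply: sumr_ge0 => j _; rewrite mulr_ge0 ?hnorm_ge0.
  apply: le_trans (hnorm_sum _ _ _) _; apply: ler_sum => j _.
  exact: opnorm_bound.
apply: le_trans (sum_CauchySchwarz _ _) _.
by rewrite sumr_const -[e ^+ 2 *+ _]mulr_natr lexx.
Qed.

Lemma mxbd_lim a C c : 0 <= C -> 0 <= c ->
  (forall e : R, 0 < e -> mxbd a (C + e * c)) -> mxbd a C.
Proof.
move=> C0 c0 h; apply/mxbdP => // x.
apply: (@ler_epsM _ _ _ (c * fnorm x)) => e e0.
have /mxbdP/(_ x) := h e e0; rewrite mulrDl mulrA; apply.
by rewrite addr_ge0// mulr_ge0// ltW.
Qed.

End MatrixBoundTopology.

(** * Tensor products *)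

Section Extension.
Variables (R : realType) (X Y : hilbert R).

(** A linear relation is extended instead of a function, because a vector may have many expansions
    into elementary tensors. The norm bound applied to differences makes the closed relation [Rc]
    single-valued, so no separate proof of well-definedness is needed. *)
Lemma extend_bounded (Rl : X -> Y -> Prop) (M : R) : 0 <= M ->
  (forall c x y x' y', Rl x y -> Rl x' y' -> Rl (c *: x + x') (c *: y + y')) ->
  (forall x y, Rl x y -> hnorm y <= M * hnorm x) ->
  closure [set x | exists y, Rl x y] = setT ->
  exists f : X -> Y, [/\ bmap f, forall x, hnorm (f x) <= M * hnorm x &
    forall x y, Rl x y -> f x = y].
Proof.
move=> M0 Rlin Rbd dR.
have RB x y x' y' : Rl x y -> Rl x' y' -> Rl (x - x') (y - y').
  move=> r r'; rewrite addrC (addrC y) -scaleN1r -(scaleN1r y'); exact: Rlin.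
pose Rc x y := forall e : R, 0 < e ->
  exists x' y', [/\ Rl x' y', hnorm (x - x') < e & hnorm (y - y') < e].
have Rc_lin c x y x' y' : Rc x y -> Rc x' y' -> Rc (c *: x + x') (c *: y + y').
  move=> r r' e e0; have c1 : 0 < cabs c + 1 by rewrite ltr_wpDl ?cabs_ge0.
  have e2 : 0 < e / 2 by rewrite divr_gt0.
  have [u [v [uv xu yv]]] := r _ (divr_gt0 e2 c1).
  have [u' [v' [uv' xu' yv']]] := r' _ e2.
  exists (c *: u + u'), (c *: v + v').
  by split; [exact: Rlin|exact: hnormZD_close|exact: hnormZD_close].
have Rc_bd x y : Rc x y -> hnorm y <= M * hnorm x.
  move=> r; apply: (@ler_epsM _ _ _ (1 + M)) => e e0.
  have [x' [y' [r' xx yy]]] := r _ e0.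
  have := hnormD (y - y') y'; have := hnormD (x' - x) x; rewrite !subrK hnormBC.
  have := Rbd _ _ r' => h1 h2 h3.
  have : M * hnorm x' <= M * (e + hnorm x) by rewrite ler_wpM2l//; lra.
  lra.
have Rc_fun x y y' : Rc x y -> Rc x y' -> y = y'.
  move=> r r'; apply/eqP; rewrite -subr_eq0; apply/eqP/hnorm_eq0/eqP.
  rewrite eq_le hnorm_ge0 andbT.
  have := Rc_lin (-1) _ _ _ _ r' r; rewrite !scaleN1r addNr addrC => /Rc_bd.
  by rewrite hnorm0 mulr0.
have Rc_tot x : exists y, Rc x y.
  have /choice[s sP] : forall n : nat, exists xy : X * Y,
      Rl xy.1 xy.2 /\ hnorm (x - xy.1) < n.+1%:R^-1.
    move=> n; have : closure [set x | exists y, Rl x y] x by rewrite dR.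
    have n0 : 0 < n.+1%:R^-1 :> R by rewrite invr_gt0.
    by move=> /closure_hnormP/(_ _ n0)[x' [y' r] h]; exists (x', y').
  have small (e : R) : 0 < e -> exists N, forall n, (N <= n)%N -> hnorm (x - (s n).1) < e.
    move=> /inv_small[N hN]; exists N => n Nn; apply: lt_trans (sP n).2 _.
    by rewrite (le_lt_trans _ hN)// lef_pV2 ?posrE ?ltr0n// ler_nat.
  have [y sy] : exists y, cvs (fun n => (s n).2) y.
    apply: hilbert_complete => e e0.
    have M1 : 0 < M *+ 2 + 1 by rewrite ltr_wpDl// mulrn_wge0.
    have [N hN] := small _ (divr_gt0 e0 M1); exists N => m n Nm Nn.
    apply: le_lt_trans (Rbd _ _ (RB _ _ _ _ (sP m).1 (sP n).1)) _.
    have := hN _ Nm; have := hN _ Nn; rewrite !ltr_pdivlMr// => h1 h2.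
    have h3 : hnorm ((s m).1 - (s n).1) <= hnorm (x - (s n).1) + hnorm (x - (s m).1).
      have -> : (s m).1 - (s n).1 = (x - (s n).1) - (x - (s m).1) by hring.
      exact: hnormB.
    have := ler_wpM2l M0 h3; have := hnorm_ge0 (x - (s m).1).
    have := hnorm_ge0 (x - (s n).1); lra.
  exists y => e e0; have [N hN] := small _ e0; have [N' hN'] := sy _ e0.
  exists (s (maxn N N')).1, (s (maxn N N')).2; split; first exact: (sP _).1.
    exact: hN (leq_maxl _ _).
  by rewrite hnormBC; exact: hN' (leq_maxr _ _).
have Rl_Rc x y : Rl x y -> Rc x y.
  by move=> r e e0; exists x, y; rewrite !subrr !hnorm0.
have [f fP] := choice Rc_tot.
exists f; split.
- split; last by exists M => x; exact: Rc_bd.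
  by move=> c x y; apply: Rc_fun (fP _) _; exact: Rc_lin.
- by move=> x; exact: Rc_bd.
- by move=> x y /Rl_Rc; exact: Rc_fun.
Qed.

End Extension.

Section GramSchmidt.
Variables (R : realType) (K : hilbert R).

Definition orthonorm (P : finType) (e : P -> K) : Prop :=
  forall p q, inner K (e p) (e q) = (p == q)%:R.

(** For orthonormal [e] this is membership in the span, in the form that yields the coordinates. *)
Definition in_span (P : finType) (e : P -> K) (y : K) : Prop :=
  y = \sum_p inner K y (e p) *: e p.

Lemma gram_schmidt (s : seq K) : exists (P : finType) (e : P -> K),
  orthonorm e /\ forall y, y \in s -> in_span e y.
Proof.
elim: s => [|y s [P [e [oe es]]]].
  by exists void, (fun x : void => match x with end); split=> [[]|].
pose r := y - \sum_p inner K y (e p) *: e p.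
have re p : inner K r (e p) = 0.
  rewrite /r innerBl inner_suml (bigD1 p)//= innerZl oe eqxx mulr1 big1 ?addr0 ?subrr//.
  by move=> q /negPf qp; rewrite innerZl oe qp mulr0.
have [r0|rn0] := eqVneq r 0.
  exists P, e; split=> // z; rewrite inE => /orP[/eqP ->|]; last exact: es.
  by apply/eqP; rewrite -subr_eq0; apply/eqP.
have rp : hnorm r != 0 by apply: contraNneq rn0 => /hnorm_eq0 ->.
pose u := (hnorm r)^-1%:C%C *: r.
have uu : inner K u u = 1.
  rewrite hnormE hnormZ cabs_real ger0_norm ?invr_ge0 ?hnorm_ge0// mulVf//.
  by rewrite expr1n.
have ue p : inner K u (e p) = 0 by rewrite innerZl re mulr0.
have eu p : inner K (e p) u = 0 by rewrite innerC ue conjC0.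
pose e' (p : option P) := if p is Some p then e p else u.
exists (option P), e'; split.
  by move=> [p|] [q|] //=; rewrite -?oe.
have expand z : \sum_p inner K z (e' p) *: e' p =
    inner K z u *: u + \sum_p inner K z (e p) *: e p.
  rewrite (bigD1 None)//= (reindex_omap Some id) => [|[]//].
  by congr (_ + _); apply: eq_bigl => p; rewrite eqxx.
move=> z; rewrite inE => /orP[/eqP ->|/es zE]; rewrite /in_span expand.
  rewrite -[LHS](subrK (\sum_p inner K y (e p) *: e p)) -/r; congr (_ + _).
  have -> : inner K y u = (hnorm r)%:C%C.
    rewrite -[y](subrK (\sum_p inner K y (e p) *: e p)) -/r innerDl inner_suml.
    rewrite big1 ?addr0 => [|p _]; last by rewrite innerZl eu mulr0.
    by rewrite innerZr conj_realC hnormE -rmorphM/= expr2 mulrA mulVf// mul1r.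
  by rewrite scalerA -rmorphM/= divff// scale1r.
suff -> : inner K z u = 0 by rewrite scale0r add0r.
by rewrite zE inner_suml big1// => p _; rewrite innerZl eu mulr0.
Qed.

Lemma gram_schmidt_family (N : finType) (y : N -> K) :
  exists (P : finType) (e : P -> K), orthonorm e /\ forall n, in_span e (y n).
Proof.
have [P [e [oe es]]] := gram_schmidt [seq y n | n <- enum N].
exists P, e; split=> // n; apply: es; apply/mapP; exists n => //.
by rewrite mem_enum.
Qed.

End GramSchmidt.

Section TensorVectors.
Variables (R : realType) (H K : hilbert R) (T : hilbert_tensor H K).

Lemma tensDl x x' y : tens T (x + x') y = tens T x y + tens T x' y.
Proof. exact: (linear_fD (tens_linearl T y)). Qed.
Lemma tensZl c x y : tens T (c *: x) y = c *: tens T x y.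
Proof. exact: (linear_fZ (tens_linearl T y)). Qed.
Lemma tensZr c x y : tens T x (c *: y) = c *: tens T x y.
Proof. exact: (linear_fZ (tens_linearr T x)). Qed.
Lemma tens_suml I (s : seq I) (P : pred I) (F : I -> H) y :
  tens T (\sum_(i <- s | P i) F i) y = \sum_(i <- s | P i) tens T (F i) y.
Proof. exact: (linear_fsum (tens_linearl T y)). Qed.
Lemma tens_sumr I (s : seq I) (P : pred I) (F : I -> K) x :
  tens T x (\sum_(i <- s | P i) F i) = \sum_(i <- s | P i) tens T x (F i).
Proof. exact: (linear_fsum (tens_linearr T x)). Qed.

Lemma hnorm_tens x y : hnorm (tens T x y) = hnorm x * hnorm y.
Proof.
apply/eqP; rewrite -(@eqrXn2 _ 2) ?mulr_ge0 ?hnorm_ge0// hnorm_sqr tens_inner.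
by rewrite !hnormE -rmorphM exprMn.
Qed.

Lemma hnorm_ortho_sum (P : finType) (e : P -> K) (x : P -> H) : orthonorm e ->
  hnorm (\sum_p tens T (x p) (e p)) ^+ 2 = \sum_p hnorm (x p) ^+ 2.
Proof.
move=> oe; rewrite hnorm_sqr inner_suml cRe_sum; apply: eq_bigr => p _.
rewrite inner_sumr (bigD1 p)//= tens_inner oe eqxx mulr1 big1 ?addr0 -?hnorm_sqr//.
by move=> q /negPf qp; rewrite tens_inner oe eq_sym qp mulr0.
Qed.

Lemma tens_expand (N P : finType) (x : N -> H) (y : N -> K) (e : P -> K) :
  (forall n, in_span e (y n)) ->
  \sum_n tens T (x n) (y n) = \sum_p tens T (\sum_n inner K (y n) (e p) *: x n) (e p).
Proof.
move=> ye; under eq_bigr do rewrite (ye _) tens_sumr.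
rewrite exchange_big; apply: eq_bigr => p _; rewrite tens_suml.
by apply: eq_bigr => n _; rewrite tensZr tensZl.
Qed.

Lemma tens_alg_dense : closure [set t : T | exists (N : finType) x y,
  t = \sum_(n : N) tens T (x n) (y n)] = setT.
Proof.
apply/seteqP; split=> // t _; have : closure (lspan [set tens T p.1 p.2 | p in
  [set: H * K]]) t by rewrite tens_dense.
apply: closure_subset => _ [n [c [s [sP ->]]]].
have /choice[p pE] : forall i, exists p, tens T p.1 p.2 = s i.
  by move=> i; have [p _ <-] := sP i; exists p.
exists 'I_n, (fun i => c i *: (p i).1), (fun i => (p i).2).
by apply: eq_bigr => i _; rewrite -pE tensZl.
Qed.

Definition is_optens (a : op H) (b : op K) (t : op T) : Prop :=
  bounded_op t /\ forall x y, t (tens T x y) = tens T (a x) (b y).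

(** Once the second legs are orthonormalised, a (x) 1 acts on each coordinate by [a], and Pythagoras
    gives the bound [opnorm a]. *)
Lemma optens_exists1 a : bounded_op a -> exists t, is_optens a id t.
Proof.
move=> ba; have la := bop_linear ba.
pose Rl (s t : T) := exists (N : finType) x y,
  s = \sum_(n : N) tens T (x n) (y n) /\ t = \sum_(n : N) tens T (a (x n)) (y n).
have [||||t [bt _ tE]] := @extend_bounded _ _ _ Rl (opnorm a).
- exact: opnorm_ge0.
- move=> c _ _ _ _ [N [x [y [-> ->]]]] [N' [x' [y' [-> ->]]]].
  exists (N + N')%type, (fun n => match n with inl n => c *: x n | inr n => x' n end),
    (fun n => match n with inl n => y n | inr n => y' n end).
  rewrite !big_sumType/= !scaler_sumr; split; congr (_ + _); apply: eq_bigr => n _.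
    by rewrite tensZl.
  by rewrite (linear_fZ la) tensZl.
- move=> _ _ [N [x [y [-> ->]]]].
  have [P [e [oe ye]]] := gram_schmidt_family y.
  rewrite !(tens_expand _ ye).
  rewrite -ler_sq ?mulr_ge0 ?hnorm_ge0 ?opnorm_ge0//.
  rewrite exprMn !hnorm_ortho_sum// mulr_sumr; apply: ler_sum => p _.
  rewrite -exprMn ler_sq ?mulr_ge0 ?hnorm_ge0 ?opnorm_ge0//.
  under eq_bigr do rewrite -(linear_fZ la).
  by rewrite -(linear_fsum la) le_opnorm.
- rewrite -tens_alg_dense; congr closure; apply/seteqP; split=> s /=.
    by move=> [_ [N [x [y [-> _]]]]]; exists N, x, y.
  move=> [N [x [y ->]]]; exists (\sum_(n : N) tens T (a (x n)) (y n)).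
  by exists N, x, y.
exists t; split=> [|x y]; first exact/bounded_opE.
by apply: tE; exists 'I_1, (fun=> x), (fun=> y); rewrite !big_ord1.
Qed.

End TensorVectors.

Section Swap.
Variables (R : realType) (H K : hilbert R) (T : hilbert_tensor H K).

Lemma htswap_inner (y y' : K) (x x' : H) :
  inner T (tens T x y) (tens T x' y') = inner K y y' * inner H x x'.
Proof. by rewrite tens_inner mulrC. Qed.

Lemma htswap_dense :
  closure (lspan [set tens T p.2 p.1 | p in [set: K * H]]) = setT :> set T.
Proof.
rewrite -(tens_dense T); congr (closure (lspan _)).
by apply/seteqP; split=> _ [[a b] _ <-]; exists (b, a).
Qed.

(** The same Hilbert space with the two factors exchanged; results about the first factor then apply
    to the second without a flip unitary. *)
Definition htswap : hilbert_tensor K H :=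
  @HilbertTensor R K H T (fun y x => tens T x y) (tens_linearr T)
    (tens_linearl T) htswap_inner htswap_dense.

End Swap.

Section OperatorTensor.
Variables (R : realType) (H K : hilbert R) (T : hilbert_tensor H K).
Implicit Types (a : op H) (b : op K) (t : op T).

Lemma optens_exists a b : bounded_op a -> bounded_op b -> exists t, is_optens a b t.
Proof.
move=> ba bb; have [t [bt tE]] := optens_exists1 T ba.
have [s [bs sE]] := optens_exists1 (htswap T) bb.
exists (t \o s : op T); split=> [|x y]; first exact: bop_comp.
by rewrite /= (sE y x : s (tens T x y) = tens T x (b y)) tE.
Qed.

Lemma bmap_eq_tens (Z : hilbert R) (f g : T -> Z) : bmap f -> bmap g ->
  (forall x y, f (tens T x y) = g (tens T x y)) -> f = g.
Proof.
move=> bf bg fg; apply: (eq_on_dense bf bg (tens_dense T)) => _ [p _ <-].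
exact: fg.
Qed.

Lemma bop_eq_tens t t' : bounded_op t -> bounded_op t' ->
  (forall x y, t (tens T x y) = t' (tens T x y)) -> t = t'.
Proof. by move=> /bounded_opE bt /bounded_opE bt'; exact: bmap_eq_tens. Qed.

(** A version of [optens] for one tensor product [T], so that it also applies to [htswap T]. At
    [T = tp H K] it is convertible to [optens]; [gspatial] and [gmaptens] relate in the same way to
    [spatial] and [maptens]. *)
Definition gtens a b : op T := xget 0 [set t | is_optens a b t].

Lemma gtensP a b : bounded_op a -> bounded_op b -> is_optens a b (gtens a b).
Proof.
by move=> ba bb; have [t tP] := optens_exists ba bb; rewrite /gtens; case: xgetP => // /(_ t).
Qed.

Lemma bop_gtens a b : bounded_op a -> bounded_op b -> bounded_op (gtens a b).
Proof. by move=> ba bb; case: (gtensP ba bb). Qed.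

Lemma gtensE a b : bounded_op a -> bounded_op b -> forall x y,
  gtens a b (tens T x y) = tens T (a x) (b y).
Proof. by move=> ba bb; case: (gtensP ba bb). Qed.

Lemma gtens_uniq a b t : bounded_op a -> bounded_op b -> is_optens a b t ->
  gtens a b = t.
Proof.
move=> ba bb [bt tE]; apply: bop_eq_tens => // [|x y]; first exact: bop_gtens.
by rewrite tE gtensE.
Qed.

Lemma gtensZDl c a a' b : bounded_op a -> bounded_op a' -> bounded_op b ->
  gtens (c *: a + a') b = c *: gtens a b + gtens a' b.
Proof.
move=> ba ba' bb; apply: gtens_uniq => //; first exact: bopZD.
split=> [|x y]; first by apply: bopZD; exact: bop_gtens.
by rewrite !fctE !gtensE// tensDl tensZl.
Qed.

Lemma gtens_comp a a' b b' : bounded_op a -> bounded_op a' ->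
  bounded_op b -> bounded_op b' ->
  gtens a b \o gtens a' b' = gtens (a \o a') (b \o b').
Proof.
move=> ba ba' bb bb'; apply/esym/gtens_uniq; try exact: bop_comp.
split=> [|x y]; first by apply: bop_comp; exact: bop_gtens.
by rewrite /= !gtensE.
Qed.

Lemma gtensZl c a b : bounded_op a -> bounded_op b ->
  gtens (c *: a) b = c *: gtens a b.
Proof.
move=> ba bb; apply: gtens_uniq => //; first exact: bopZ.
split=> [|x y]; first by apply: bopZ; exact: bop_gtens.
by rewrite !fctE gtensE// tensZl.
Qed.

Lemma tens_inner_ext (u v : T) :
  (forall x y, inner T (tens T x y) u = inner T (tens T x y) v) -> u = v.
Proof.
move=> uv; apply/eqP; rewrite -subr_eq0; apply/eqP/hnorm_eq0/eqP.
have : forall x y, inner T (tens T x y) (u - v) = 0.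
  by move=> x y; rewrite innerBr uv subrr.
move: (u - v) => w w0.
rewrite -sqrf_eq0 eq_le sqr_ge0 andbT.
apply: (@ler_epsM _ _ _ (hnorm w)) => e e0.
have : closure (lspan [set tens T p.1 p.2 | p in [set: H * K]]) w by rewrite tens_dense.
move=> /closure_hnormP/(_ _ e0)[_ [n [c [s [sP ->]]]] we].
have -> : hnorm w ^+ 2 = complex.Re (inner T (w - \sum_i c i *: s i) w).
  rewrite hnorm_sqr innerBl inner_suml big1 ?subr0// => i _; rewrite innerZl.
  by have [p _ <-] := sP i; rewrite w0 mulr0.
rewrite add0r (le_trans (cRe_inner_le _ _))// ler_wpM2r ?hnorm_ge0//.
exact: ltW.
Qed.

Lemma gtens_adjoint a a' b b' : bounded_op a -> bounded_op b ->
  is_adjoint a a' -> is_adjoint b b' -> is_adjoint (gtens a b) (gtens a' b').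
Proof.
move=> ba bb aa bb'; have bt := bop_gtens ba bb.
suff -> : gtens a' b' = adj (gtens a b) by exact: adjP.
apply: gtens_uniq; [exact: is_adjoint_bop aa|exact: is_adjoint_bop bb'|].
split=> [|x y]; first exact: bop_adj.
by apply: tens_inner_ext => x' y'; rewrite -(adjP bt) gtensE// !tens_inner aa bb'.
Qed.

(* Coordinates of a sum of elementary tensors of operators with respect to
   orthonormal families in the second factor. *)
Lemma gtens_expand (N P Q : finType) (a : N -> op H) (b : N -> op K)
    (e : P -> K) (f : Q -> K) (X : P -> H) :
  (forall n, bounded_op (a n)) -> (forall n, bounded_op (b n)) ->
  (forall n p, in_span f (b n (e p))) ->
  (\sum_n gtens (a n) (b n)) (\sum_p tens T (X p) (e p)) =
  \sum_q tens T (\sum_p (\sum_n inner K (b n (e p)) (f q) *: a n) (X p)) (f q).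
Proof.
move=> ba bb bf; have bt : bounded_op (\sum_n gtens (a n) (b n)).
  by apply: bop_sum => n _; exact: bop_gtens.
rewrite (linear_fsum (bop_linear bt)).
under [RHS]eq_bigr do rewrite tens_suml.
rewrite [RHS]exchange_big; apply: eq_bigr => p _; rewrite fct_sumE.
transitivity (\sum_n tens T (a n (X p)) (b n (e p))).
  by apply: eq_bigr => n _; rewrite gtensE.
rewrite (tens_expand _ _ (fun n => bf n p)); apply: eq_bigr => q _.
by rewrite fct_sumE.
Qed.

End OperatorTensor.

Arguments gtens {R H K} T a b.

(** * Completely contractive relations, their tensor amplifications and closures *)

Section CompleteBound.
Variable R : realType.

(** Complete contractivity is stated for relations so that it can be proved before a map is known to
    exist, and for the converse of a map as well. *)
Definition cc_rel (H H' : hilbert R) (Rl : op H -> op H' -> Prop) : Prop :=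
  forall (I J : finType) (a : I -> J -> op H) (a' : I -> J -> op H') C, 0 <= C ->
  (forall i j, Rl (a i j) (a' i j)) -> mxbd a C -> mxbd a' C.

Definition lin_rel (H H' : hilbert R) (Rl : op H -> op H' -> Prop) : Prop :=
  Rl 0 0 /\ forall c a a' b b', Rl a a' -> Rl b b' -> Rl (c *: a + b) (c *: a' + b').

Definition bop_rel (H H' : hilbert R) (Rl : op H -> op H' -> Prop) : Prop :=
  forall a a', Rl a a' -> bounded_op a /\ bounded_op a'.

Lemma lin_rel_sum (H H' : hilbert R) (Rl : op H -> op H' -> Prop) :
  lin_rel Rl -> forall (N : finType) c a a', (forall n, Rl (a n) (a' n)) ->
  Rl (\sum_(n : N) c n *: a n) (\sum_n c n *: a' n).
Proof.
move=> [R0 RZD] N c a a' raa; elim/big_rec2: _ => // n x y _; exact: RZD.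
Qed.

Lemma mxbd_dense (H : hilbert R) (D : set H) (I J : finType) (a : I -> J -> op H) C :
  0 <= C -> (forall i j, bounded_op (a i j)) -> closure D = setT ->
  (forall x : J -> H, (forall j, D (x j)) ->
    \sum_i hnorm (\sum_j a i j (x j)) ^+ 2 <= C ^+ 2 * \sum_j hnorm (x j) ^+ 2) ->
  mxbd a C.
Proof.
move=> C0 ba dD hD; have [M M0 /(mxbdP _ M0) aM] := mxbd_exists ba.
pose F (x : J -> H) : hsumH H I := fun i => \sum_j a i j (x j).
apply/(mxbdP _ C0) => x; rewrite -/(F x).
apply: (@ler_epsM _ _ _ ((M + C) * #|J|%:R)) => e e0.
have /choice[x' xP] : forall j, exists y, D y /\ hnorm (x j - y) < e.
  move=> j; have : closure D (x j) by rewrite dD.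
  by move=> /closure_hnormP/(_ _ e0)[y Dy xy]; exists y.
pose z j := x j - x' j.
have d0 : hnorm (F x') <= C * hnorm (x' : hsumH H J).
  rewrite -ler_sq ?mulr_ge0 ?hnorm_ge0// exprMn !hsumH_hnormE.
  by apply: hD => j; case: (xP j).
have d1 : hnorm (z : hsumH H J) <= #|J|%:R * e.
  rewrite [X in hnorm X]hsum_decomp; apply: le_trans (hnorm_sum _ _ _) _.
  rewrite mulr_natl -sumr_const; apply: ler_sum => j _; rewrite hnorm_hinj ltW//.
  exact: (xP j).2.
have d2 : hnorm (F x) <= hnorm (F x') + hnorm (F z).
  suff -> : F x = F x' + F z by exact: hnormD.
  apply/funext => i; rewrite /F fctE -big_split/=; apply: eq_bigr => j _.
  by rewrite /z (linear_fB (bop_linear (ba i j))) addrC subrK.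
have d3 : hnorm (x' : hsumH H J) <= hnorm (x : hsumH H J) + hnorm (z : hsumH H J).
  suff -> : x' = (x : hsumH H J) - (z : hsumH H J) by exact: hnormB.
  by apply/funext => j; rewrite /z !fctE; hring.
have := aM z; rewrite -/(F z).
have := ler_wpM2l C0 d3; have := ler_wpM2l C0 d1; have := ler_wpM2l M0 d1; lra.
Qed.

Section TensorRelation.
Variables (H H' K : hilbert R) (T : hilbert_tensor H K) (T' : hilbert_tensor H' K).

Definition trel (Rl : op H -> op H' -> Prop) (B : set (op K))
    (s : op T) (s' : op T') : Prop :=
  exists (N : finType) (a : N -> op H) (a' : N -> op H') (b : N -> op K),
  [/\ forall n, Rl (a n) (a' n), forall n, B (b n),
      s = \sum_n gtens T (a n) (b n) & s' = \sum_n gtens T' (a' n) (b n)].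

Variables (Rl : op H -> op H' -> Prop) (B : set (op K)).
Hypotheses (bR : bop_rel Rl) (lR : lin_rel Rl) (bB : B `<=` @bounded_op R K).

Lemma trel_bop : bop_rel (trel Rl B).
Proof.
move=> _ _ [N [a [a' [b [aa Bb -> ->]]]]].
by split; apply: bop_sum => n _; apply: bop_gtens; [case: (bR (aa n))|exact: bB
  |case: (bR (aa n))|exact: bB].
Qed.

(** Both sides of [trel] have the same second legs, so the scalar coefficients of their compressions
    coincide. The compressions [m] and [m'] are therefore related entry by entry through linearity
    of [Rl], and the bound passes from one to the other. *)
Lemma cc_trel : cc_rel Rl -> cc_rel (trel Rl B).
Proof.
move=> cR I J t t' C C0 tt tC.
have bt' i j : bounded_op (t' i j) by case: (trel_bop (tt i j)).
apply: (mxbd_dense C0 bt' (tens_alg_dense T')) => xi xiP.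
have /choice[w wP] : forall p : I * J, exists w : {N : finType & N -> op H * op H' * op K},
    [/\ forall n, Rl (projT2 w n).1.1 (projT2 w n).1.2, forall n, B (projT2 w n).2,
      t p.1 p.2 = \sum_n gtens T (projT2 w n).1.1 (projT2 w n).2 &
      t' p.1 p.2 = \sum_n gtens T' (projT2 w n).1.2 (projT2 w n).2].
  move=> [i j]; have [N [a [a' [b [h1 h2 h3 h4]]]]] := tt i j.
  by exists (existT _ N (fun n => (a n, a' n, b n))).
pose N p := projT1 (w p); pose a p (n : N p) := (projT2 (w p) n).1.1.
pose a' p (n : N p) := (projT2 (w p) n).1.2; pose b p (n : N p) := (projT2 (w p) n).2.
have /choice[v vP] : forall j, exists v : {N : finType & N -> H' * K},
    xi j = \sum_n tens T' (projT2 v n).1 (projT2 v n).2.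
  move=> j; have [N0 [x [y E]]] := xiP j.
  by exists (existT _ N0 (fun n => (x n, y n))).
(* Two families are needed: [e] spans the second legs of the test vectors, and [f] spans the images
   of [e] under all second-leg operators. Both are finite, and with them the compression loses no
   norm on these vectors. *)
have [P [e [oe eP]]] := @gram_schmidt_family _ K {j : J & projT1 (v j)}
  (fun q => (projT2 (v (tag q)) (tagged q)).2).
have [Q [f [of_ fP]]] := @gram_schmidt_family _ K ({p : I * J & N p} * P)%type
  (fun q => b (tag q.1) (tagged q.1) (e q.2)).
pose X j p := \sum_n inner K (projT2 (v j) n).2 (e p) *: (projT2 (v j) n).1.
have xiE j : xi j = \sum_p tens T' (X j p) (e p).
  rewrite vP (tens_expand _ _ (e := e))// => n.
  exact: (eP (Tagged (fun j => projT1 (v j)) n)).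
have bf i j (n : N (i, j)) p : in_span f (b (i, j) n (e p)).
  exact: (fP (Tagged (fun p => N p) n, p)).
pose m (iq : I * Q) (jp : J * P) := \sum_(n : N (iq.1, jp.1))
  inner K (b (iq.1, jp.1) n (e jp.2)) (f iq.2) *: a (iq.1, jp.1) n.
pose m' (iq : I * Q) (jp : J * P) := \sum_(n : N (iq.1, jp.1))
  inner K (b (iq.1, jp.1) n (e jp.2)) (f iq.2) *: a' (iq.1, jp.1) n.
have Rw i j (n : N (i, j)) : Rl (a (i, j) n) (a' (i, j) n).
  by case: (wP (i, j)) => h _ _ _; exact: h.
have Bw i j (n : N (i, j)) : bounded_op (b (i, j) n).
  by apply: bB; case: (wP (i, j)) => _ h _ _; exact: h.
(* Kept generic in the first-leg operators [al], because it is applied once to [t] and once to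
   [t']. *)
have expand (L : hilbert R) (S : hilbert_tensor L K) (s : I -> J -> op S)
    (al : forall p, N p -> op L) (Z : J * P -> L) :
    (forall i j n, bounded_op (al (i, j) n)) ->
    (forall i j, s i j = \sum_n gtens S (al (i, j) n) (b (i, j) n)) ->
    \sum_i hnorm (\sum_j s i j (\sum_p tens S (Z (j, p)) (e p))) ^+ 2 =
    \sum_(iq : I * Q) hnorm (\sum_(jp : J * P) (\sum_(n : N (iq.1, jp.1))
      inner K (b (iq.1, jp.1) n (e jp.2)) (f iq.2) *: al (iq.1, jp.1) n) (Z jp)) ^+ 2.
  move=> bal sE; rewrite -(pair_bigA _ (fun i q => hnorm (\sum_(jp : J * P)
    (\sum_(n : N (i, jp.1)) inner K (b (i, jp.1) n (e jp.2)) (f q) *: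
       al (i, jp.1) n) (Z jp)) ^+ 2)) /=.
  apply: eq_bigr => i _; rewrite -(hnorm_ortho_sum S _ of_); congr (hnorm _ ^+ 2).
  rewrite (eq_bigr _ (fun j _ => etrans (congr1 (@^~ _) (sE i j))
    (@gtens_expand _ _ _ S _ _ _ _ _ e f
       (fun p => Z (j, p)) (bal i j) (Bw i j) (bf i j)))).
  rewrite exchange_big; apply: eq_bigr => q _.
  rewrite -tens_suml; congr tens.
  by rewrite pair_bigA /=; apply: eq_bigr => -[j p] _.
have Sq (L : hilbert R) (S : hilbert_tensor L K) (Z : J * P -> L) :
    \sum_j hnorm (\sum_p tens S (Z (j, p)) (e p)) ^+ 2 = \sum_jp hnorm (Z jp) ^+ 2.
  rewrite (eq_bigr (fun j => \sum_p hnorm (Z (j, p)) ^+ 2)) => [|j _].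
    by rewrite pair_bigA; apply: eq_bigr => -[].
  by rewrite hnorm_ortho_sum.
have mC : mxbd m C.
  move=> Z; rewrite -(Sq _ T) -(expand _ T t a)//.
    by move=> i j n; case: (bR (Rw i j n)).
  by move=> i j; case: (wP (i, j)).
have m'C : mxbd m' C.
  by apply: cR C0 _ mC => iq jp; apply: lin_rel_sum => // n; exact: Rw.
rewrite (eq_bigr _ (fun j _ => congr1 (fun z => hnorm z ^+ 2) (xiE j))).
rewrite (Sq _ T' (fun jp => X jp.1 jp.2)).
under eq_bigr do under eq_bigr do rewrite xiE.
rewrite (expand _ T' t' a' (fun jp => X jp.1 jp.2))//; first exact: m'C.
  by move=> i j n; case: (bR (Rw i j n)).
by move=> i j; case: (wP (i, j)).
Qed.

End TensorRelation.
End CompleteBound.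

Section OpnormMatrix.
Variables (R : realType) (H : hilbert R).

Lemma mxbd1 (a : op H) C : 0 <= C -> bounded_op a ->
  mxbd (fun _ _ : 'I_1 => a) C <-> opnorm a <= C.
Proof.
move=> C0 ba; split=> [h|/(opnormP ba C0) h x].
  apply: opnorm_ub => // x; have := h (fun=> x); rewrite !big_ord1 -exprMn.
  by rewrite ler_sq ?mulr_ge0 ?hnorm_ge0.
by rewrite !big_ord1 -exprMn ler_sq ?mulr_ge0 ?hnorm_ge0.
Qed.

Lemma mxopnormE n (a : 'M[op H]_n) :
  mxopnorm a = opnorm (mxop (fun i j => a i j)).
Proof.
rewrite /mxopnorm /opnorm; congr sup; rewrite eqEsubset; split=> _ [x /= x1 <-].
  exists (x : hsumH H 'I_n) => /=; last first.
    rewrite -[LHS]ger0_norm ?hnorm_ge0// -sqrtr_sqr hsumH_hnormE.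
    by [].
  by rewrite -(@expr_le1 _ 2) ?hnorm_ge0// hsumH_hnormE.
exists x => /=; first by rewrite -(@hsumH_hnormE _ _ _ x) expr_le1 ?hnorm_ge0.
by rewrite -(@hsumH_hnormE _ _ _ (mxop (fun i j => a i j) x)) sqrtr_sqr ger0_norm ?hnorm_ge0.
Qed.

Lemma mxopnorm_bdP n (a : 'M[op H]_n) C : 0 <= C -> (forall i j, bounded_op (a i j)) ->
  mxopnorm a <= C <-> mxbd (fun i j => a i j) C.
Proof.
move=> C0 ba; rewrite mxopnormE.
have bm : bounded_op (mxop (fun i j => a i j)) by exact: bop_mxop.
by split=> [/(opnormP bm C0)/(mxop_bdP _ C0)|/(mxop_bdP _ C0)/(opnormP bm C0)].
Qed.

Lemma mxopnorm_ge0 n (a : 'M[op H]_n) : 0 <= mxopnorm a.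
Proof. by rewrite mxopnormE opnorm_ge0. Qed.

End OpnormMatrix.

Section CompletelyIsometric.
Variables (R : realType) (H K : hilbert R).

Lemma completely_isometricP (A : set (op H)) (phi : op H -> op K) :
  A `<=` @bounded_op R H -> (forall a, A a -> bounded_op (phi a)) ->
  (forall n (a : 'I_n -> 'I_n -> op H) C, 0 <= C -> (forall i j, A (a i j)) ->
    mxbd a C <-> mxbd (fun i j => phi (a i j)) C) -> completely_isometric A phi.
Proof.
move=> bA bphi h n a Aa.
have ba i j : bounded_op (a i j) by exact: bA.
have bp i j : bounded_op (map_mx phi a i j) by rewrite mxE; exact: bphi.
have E C : 0 <= C -> mxopnorm (map_mx phi a) <= C <-> mxopnorm a <= C.
  move=> C0; rewrite !mxopnorm_bdP// (h n a C C0 Aa).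
  have -> // : (fun i j => map_mx phi a i j) = (fun i j => phi (a i j)).
  by apply/funext => i; apply/funext => j; rewrite mxE.
by apply/eqP; rewrite eq_le; apply/andP; split; apply/(E _ (mxopnorm_ge0 _)).
Qed.

Lemma mxbd_reindex (L : hilbert R) (I I' : finType) (f : I' -> I)
    (a : I -> I -> op L) C : bijective f ->
  mxbd (fun i j => a (f i) (f j)) C <-> mxbd a C.
Proof.
move=> bf; have [g gK fK] := bf.
have E (x : I -> L) : (\sum_i hnorm (\sum_j a i j (x j)) ^+ 2 =
      \sum_i hnorm (\sum_j a (f i) (f j) (x (f j))) ^+ 2) /\
    (\sum_j hnorm (x j) ^+ 2 = \sum_j hnorm (x (f j)) ^+ 2).
  split; rewrite [LHS](reindex f (onW_bij _ bf)) //=; apply: eq_bigr => i _.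
  by congr (hnorm _ ^+ 2); rewrite [LHS](reindex f (onW_bij _ bf)).
split=> h x; first by have [-> ->] := E x; exact: h.
have := h (x \o g); have [-> ->] := E (x \o g).
rewrite /=; under eq_bigr do under eq_bigr do rewrite gK.
by under [in leRHS]eq_bigr do rewrite gK.
Qed.

(** Complete isometry concerns square matrices over ordinals. Padding by zeros to [I + J] and
    enumerating that type give the two-sided bound for all rectangular shapes. *)
Lemma completely_isometric_mxbd (A : set (op H)) (B : set (op K)) phi :
  operator_algebra A -> B `<=` @bounded_op R K -> alg_hom A B phi ->
  completely_isometric A phi ->
  forall (I J : finType) (a : I -> J -> op H) C, 0 <= C ->
  (forall i j, A (a i j)) -> mxbd a C <-> mxbd (fun i j => phi (a i j)) C.
Proof.
move=> oA bB hp ci I J a C C0 Aa.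
have A0 := oa0 oA; have p0 := hom0 oA hp; have bA := oa_bop oA.
have bphi d : A d -> bounded_op (phi d) by move=> Ad; exact: bB (hom_in hp Ad).
rewrite -mxpad_bdP -(mxpad_bdP (fun i j => phi (a i j))).
have -> : mxpad (fun i j => phi (a i j)) = fun i j => phi (mxpad a i j).
  by apply/funext => -[i|i]; apply/funext => -[j|j].
have Ap i j : A (mxpad a i j) by case: i j => [i|i] [j|j] //; exact: Aa.
have bij : bijective (@enum_val (I + J)%type predT).
  by exists enum_rank; [exact: enum_valK|exact: enum_rankK].
rewrite -(mxbd_reindex (mxpad a) C bij).
rewrite -(mxbd_reindex (fun i j => phi (mxpad a i j)) C bij).
pose m := \matrix_(i, j) mxpad a (@enum_val (I + J)%type predT i) (@enum_val (I + J)%type predT j).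
have mE : (fun i j => mxpad a (enum_val i) (enum_val j)) = (fun i j => m i j).
  by apply/funext => i; apply/funext => j; rewrite mxE.
have pE : (fun i j => phi (mxpad a (enum_val i) (enum_val j))) = (fun i j => map_mx phi m i j).
  by apply/funext => i; apply/funext => j; rewrite !mxE.
rewrite mE pE -!mxopnorm_bdP// => [|i j|i j]; first by rewrite ci// => i j; rewrite mxE.
  by rewrite !mxE; exact: bphi.
by rewrite mxE; exact: bA.
Qed.

End CompletelyIsometric.

Lemma cc_rel_opnorm (R : realType) (H K : hilbert R) (Q : op H -> op K -> Prop) s s' :
  bop_rel Q -> cc_rel Q -> Q s s' -> opnorm s' <= opnorm s.
Proof.
move=> bQ cQ q; have [bs bs'] := bQ _ _ q.
apply/(mxbd1 (opnorm_ge0 _) bs').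
by apply: (cQ _ _ _ _ _ (opnorm_ge0 s) (fun _ _ => q)); apply/(mxbd1 (opnorm_ge0 _) bs).
Qed.

Section ClosureRelation.
Variables (R : realType) (H K : hilbert R) (Q : op H -> op K -> Prop).

Definition clrel (s : op H) (s' : op K) : Prop :=
  [/\ bounded_op s, bounded_op s' & forall e : R, 0 < e -> exists t t',
    [/\ Q t t', opnorm (s - t) < e & opnorm (s' - t') < e]].

Hypotheses (bQ : bop_rel Q) (lQ : lin_rel Q) (cQ : cc_rel Q).

Lemma clrel_bop : bop_rel clrel.
Proof. by move=> s s' []. Qed.

Lemma sub_clrel s s' : Q s s' -> clrel s s'.
Proof.
move=> q; have [bs bs'] := bQ q; split=> // e e0; exists s, s'.
by rewrite !subrr !opnorm0.
Qed.

Lemma clrel_lin : lin_rel clrel.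
Proof.
split; first exact: sub_clrel lQ.1.
move=> c a a' b b' [ba ba' ha] [bb bb' hb].
split=> [||e e0]; [exact: bopZD|exact: bopZD|].
have c1 : 0 < cabs c + 1 by rewrite ltr_wpDl ?cabs_ge0.
have e2 : 0 < e / 2 by rewrite divr_gt0.
have [u [u' [qu au au']]] := ha _ (divr_gt0 e2 c1).
have [v [v' [qv bv bv']]] := hb _ e2.
have [bu bu'] := bQ qu; have [bv0 bv0'] := bQ qv.
exists (c *: u + v), (c *: u' + v').
by split; [exact: lQ.2|exact: opnormZD_close|exact: opnormZD_close].
Qed.

(** Entries are replaced by related ones at distance below [e]. On each side the matrix of errors
    has norm at most [e * c] with [c = sqrt (#|I| #|J|)], whence the slack [e * (c *+ 2)], which
    tends to 0. *)
Lemma clrel_cc : cc_rel clrel.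
Proof.
move=> I J a a' C C0 aa aC.
pose c := Num.sqrt (#|I|%:R * #|J|%:R : R); have c0 : 0 <= c by exact: sqrtr_ge0.
apply: (@mxbd_lim _ _ _ _ _ _ (c *+ 2)) => //; first exact: mulrn_wge0.
move=> e e0; have e0' := ltW e0.
have /choice[w wP] : forall p : I * J, exists w : op H * op K,
    [/\ Q w.1 w.2, opnorm (a p.1 p.2 - w.1) < e & opnorm (a' p.1 p.2 - w.2) < e].
  by move=> [i j]; have [_ _ /(_ e e0)[t [t' h]]] := aa i j; exists (t, t').
have ba i j : bounded_op (a i j) by case: (aa i j).
have ba' i j : bounded_op (a' i j) by case: (aa i j).
have bw p : bounded_op (w p).1 by case: (wP p) => /bQ[].
have bw' p : bounded_op (w p).2 by case: (wP p) => /bQ[].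
have ec : 0 <= e * c by exact: mulr_ge0.
have h1 : mxbd (fun i j => (w (i, j)).1) (C + e * c).
  have -> : (fun i j => (w (i, j)).1) = fun i j => a i j + ((w (i, j)).1 - a i j).
    by apply/funext => i; apply/funext => j; rewrite addrC subrK.
  apply: mxbdD => //; apply: mxbd_small => // i j; first exact: bopB.
  by rewrite opnormBC; have [_ /ltW h _] := wP (i, j).
have Cec : 0 <= C + e * c by exact: addr_ge0.
have h2 : mxbd (fun i j => (w (i, j)).2) (C + e * c).
  by apply: cQ Cec _ h1 => i j; case: (wP (i, j)).
have -> : a' = fun i j => (w (i, j)).2 + (a' i j - (w (i, j)).2).
  by apply/funext => i; apply/funext => j; rewrite addrC subrK.
rewrite mulr2n mulrDr addrA.
apply: mxbdD => //; apply: mxbd_small => // i j; first exact: bopB.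
by have [_ _ /ltW] := wP (i, j).
Qed.

Lemma clrel_opnorm s s' : clrel s s' -> opnorm s' <= opnorm s.
Proof. by move=> q; exact: (cc_rel_opnorm clrel_bop clrel_cc q). Qed.

Lemma clrel_fun s t t' : clrel s t -> clrel s t' -> t = t'.
Proof.
move=> q q'; have [_ bt] := clrel_bop q; have [_ bt'] := clrel_bop q'.
apply/eqP; rewrite -subr_eq0; apply/eqP/opnorm_eq0; first exact: bopB.
apply/eqP; rewrite eq_le opnorm_ge0 andbT.
have := clrel_lin.2 (-1) _ _ _ _ q' q; rewrite !scaleN1r addNr addrC.
by move=> /clrel_opnorm; rewrite opnorm0.
Qed.

Lemma clrel_total s : opclosure [set t | exists t', Q t t'] s ->
  exists s', clrel s s'.
Proof.
move=> [bs hs].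
have /choice[w wP] : forall n : nat, exists w : op H * op K,
    Q w.1 w.2 /\ opnorm (s - w.1) < n.+1%:R^-1.
  move=> n; have n0 : 0 < n.+1%:R^-1 :> R by rewrite invr_gt0.
  by have [t [t' q] st] := hs _ n0; exists (t, t').
have bw n : bounded_op (w n).1 by case: (bQ (wP n).1).
have bw' n : bounded_op (w n).2 by case: (bQ (wP n).1).
have small (e : R) : 0 < e -> exists N, forall n, (N <= n)%N -> opnorm (s - (w n).1) < e.
  move=> /inv_small[N hN]; exists N => n Nn; apply: lt_trans (wP n).2 _.
  by rewrite (le_lt_trans _ hN)// lef_pV2 ?posrE ?ltr0n// ler_nat.
have [s' bs' ss'] : exists2 a, bounded_op a &
    forall e : R, 0 < e -> exists N, forall n, (N <= n)%N -> opnorm ((w n).2 - a) < e.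
  apply: op_complete => // e e0; have e2 : 0 < e / 2 by rewrite divr_gt0.
  have [N hN] := small _ e2; exists N => m n /andP[Nm mn]; have Nn := leq_trans Nm mn.
  have q : Q ((w m).1 - (w n).1) ((w m).2 - (w n).2).
    rewrite [(w m).1 - _]addrC [(w m).2 - _]addrC -scaleN1r -[- (w n).2]scaleN1r.
    by apply: lQ.2; [exact: (wP n).1|exact: (wP m).1].
  apply: le_lt_trans (cc_rel_opnorm bQ cQ q) _.
  apply: le_lt_trans (opnorm_dist_triangle (bw m) bs (bw n)) _.
  by rewrite [ltRHS]splitr ltrD// ?hN// opnormBC hN.
exists s'; split=> // e e0; have [N hN] := small _ e0; have [N' hN'] := ss' _ e0.
exists (w (maxn N N')).1, (w (maxn N N')).2; split; first exact: (wP _).1.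
  exact: hN (leq_maxl _ _).
by rewrite opnormBC; exact: hN' (leq_maxr _ _).
Qed.

Lemma clrel_comp : (forall a a' b b', Q a a' -> Q b b' -> Q (a \o b) (a' \o b')) ->
  forall a a' b b', clrel a a' -> clrel b b' -> clrel (a \o b) (a' \o b').
Proof.
move=> QM a a' b b' [ba ba' ha] [bb bb' hb].
split=> [||e e0]; [exact: bop_comp|exact: bop_comp|].
pose D := opnorm a + opnorm a' + opnorm b + opnorm b' + 2.
have D0 : 2 <= D by rewrite /D lerDr !addr_ge0 ?opnorm_ge0.
pose d := Num.min 1 (e / (2 * D)).
have Dp : 0 < D by apply: lt_le_trans D0.
have d0 : 0 < d by rewrite lt_min ltr01 divr_gt0// mulr_gt0.
have d1 : d <= 1 by rewrite ge_min lexx.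
have dD : d * D <= e / 2.
  have : d <= e / (2 * D) by rewrite ge_min lexx orbT.
  by rewrite invfM mulrA ler_pdivlMr.
have [u [u' [qu au au']]] := ha _ d0; have [v [v' [qv bv bv']]] := hb _ d0.
have [bu bu'] := bQ qu; have [bv0 bv0'] := bQ qv.
have aux (L : hilbert R) (x y x1 y1 : op L) : bounded_op x -> bounded_op y ->
    bounded_op x1 -> bounded_op y1 -> opnorm (x - x1) < d ->
    opnorm (y - y1) < d -> opnorm x + opnorm y + 1 <= D ->
    opnorm ((x \o y) - (x1 \o y1)) < e.
  move=> bx by_ bx1 by1 h h' hD.
  apply: le_lt_trans (opnorm_comp_close bx by_ bx1 by1 d1 h h') _.
  have : d * (opnorm x + opnorm y + 1) <= e / 2.
    by apply: le_trans dD; rewrite ler_wpM2l// ltW.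
  lra.
have := opnorm_ge0 a; have := opnorm_ge0 b.
have := opnorm_ge0 a'; have := opnorm_ge0 b' => p1 p2 p3 p4.
exists (u \o v), (u' \o v'); split; first exact: QM.
  by apply: aux => //; rewrite /D; lra.
by apply: aux => //; rewrite /D; lra.
Qed.

Lemma clrel_adj : (forall a a', Q a a' -> Q (adj a) (adj a')) ->
  forall a a', clrel a a' -> clrel (adj a) (adj a').
Proof.
move=> QA a a' [ba ba' ha]; split=> [||e /ha[u [u' [q au au']]]]; try exact: bop_adj.
have [bu bu'] := bQ q; exists (adj u), (adj u'); split; first exact: QA.
  apply: le_lt_trans au; apply: is_adjoint_opnorm; first exact: bopB.
  by apply: is_adjointB; exact: adjP.
apply: le_lt_trans au'; apply: is_adjoint_opnorm; first exact: bopB.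
by apply: is_adjointB; exact: adjP.
Qed.

End ClosureRelation.

(** Closing commutes with taking the converse, so complete contractivity of the converse relation
    yields the reverse matrix bounds of an isometry. *)
Lemma clrel_inv (R : realType) (H K : hilbert R) (Q : op H -> op K -> Prop) s s' :
  clrel (fun t' t => Q t t') s' s <-> clrel Q s s'.
Proof.
by split=> -[b b' h]; split=> // e /h[t [t' [q h1 h2]]]; exists t', t.
Qed.

Section Lspan.
Variables (R : realType) (V : lmodType R[i]) (S : set V).

Lemma sub_lspan : S `<=` lspan S.
Proof.
move=> x Sx; exists 1%N, (fun=> 1), (fun=> x); split=> //.
by rewrite big_ord1 scale1r.
Qed.

Lemma lspan0 : lspan S 0.
Proof. by exists 0%N, (fun=> 0), (fun=> 0); split=> [[]|]//; rewrite big_ord0. Qed.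

Lemma lspanZD c x y : lspan S x -> lspan S y -> lspan S (c *: x + y).
Proof.
move=> [n [a [s [Ss ->]]]] [m [b [t [St ->]]]].
exists (n + m)%N, (fun i => match fintype.split i with inl i => c * a i | inr j => b j end),
  (fun i => match fintype.split i with inl i => s i | inr j => t j end); split.
  by move=> i; case: (fintype.split i).
rewrite big_split_ord/= scaler_sumr; congr (_ + _); apply: eq_bigr => i _.
  by rewrite (unsplitK (inl _ i : 'I_n + 'I_m)) scalerA.
by rewrite (unsplitK (inr _ i : 'I_n + 'I_m)).
Qed.

Lemma lspan_sub (W : set V) : W 0 -> (forall c x y, W x -> W y -> W (c *: x + y)) ->
  S `<=` W -> lspan S `<=` W.
Proof.
move=> W0 WZD SW _ [n [c [s [Ss ->]]]].
by elim/big_rec: _ => // i x _ Wx; apply: WZD => //; exact: SW.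
Qed.

End Lspan.

(** * Spatial tensor products and tensor products of maps *)

Section SpatialTensor.
Variables (R : realType) (H K : hilbert R) (T : hilbert_tensor H K).
Variables (A : set (op H)) (B : set (op K)).
Hypotheses (oA : operator_algebra A) (oB : operator_algebra B).

Let bA := oa_bop oA.
Let bB := oa_bop oB.

Definition elem_tens : set (op T) :=
  [set t | exists a b, [/\ A a, B b & t = gtens T a b]].

Definition gspatial : set (op T) := opclosure (lspan elem_tens).

Definition alg_tens : set (op T) := [set t | exists (N : finType) a b,
  [/\ forall n : N, A (a n), forall n, B (b n) & t = \sum_n gtens T (a n) (b n)]].

Lemma lspan_elem_tens : lspan elem_tens = alg_tens.
Proof.
apply/seteqP; split.
  apply: lspan_sub.
  - exists 'I_0, (fun=> 0), (fun=> 0); rewrite big_ord0; split=> //.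
      by move=> ?; exact: (oa0 oA).
    by move=> ?; exact: (oa0 oB).
  - move=> c _ _ [N [a [b [Aa Bb ->]]]] [N' [a' [b' [Aa' Bb' ->]]]].
    exists (N + N')%type, (fun n => match n with inl n => c *: a n | inr n => a' n end),
      (fun n => match n with inl n => b n | inr n => b' n end); split.
    + by move=> [n|n] //; exact: (oaZ oA).
    + by case.
    + rewrite big_sumType/= scaler_sumr; congr (_ + _); apply: eq_bigr => n _.
      by rewrite gtensZl//; [exact: bA|exact: bB].
  - move=> _ [a [b [Aa Bb ->]]]; exists 'I_1, (fun=> a), (fun=> b).
    by rewrite big_ord1.
move=> _ [N [a [b [Aa Bb ->]]]]; elim/big_rec: _ => [|n x _ hx].
  exact: lspan0.
rewrite -[gtens _ _ _]scale1r; apply: lspanZD => //.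
by apply: sub_lspan; exists (a n), (b n).
Qed.

Lemma alg_tens_bop : alg_tens `<=` @bounded_op R T.
Proof.
move=> _ [N [a [b [Aa Bb ->]]]]; apply: bop_sum => n _.
by apply: bop_gtens; [exact: bA|exact: bB].
Qed.

Lemma alg_tens0 : alg_tens 0.
Proof. by rewrite -lspan_elem_tens; exact: lspan0. Qed.

Lemma alg_tensZD c s t : alg_tens s -> alg_tens t -> alg_tens (c *: s + t).
Proof. by rewrite -lspan_elem_tens; exact: lspanZD. Qed.

Lemma sum_gtens_comp (L : hilbert R) (S : hilbert_tensor H L) (N N' : finType)
    (a : N -> op H) (b : N -> op L) (a' : N' -> op H) (b' : N' -> op L) :
  (forall n, bounded_op (a n)) -> (forall n, bounded_op (b n)) ->
  (forall n, bounded_op (a' n)) -> (forall n, bounded_op (b' n)) ->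
  (\sum_n gtens S (a n) (b n)) \o (\sum_n gtens S (a' n) (b' n)) =
  \sum_(p : N * N') gtens S (a p.1 \o a' p.2) (b p.1 \o b' p.2).
Proof.
move=> ba bb ba' bb'; apply/funext => z; rewrite /= !fct_sumE.
rewrite -(pair_bigA _ (fun n n' => gtens S (a n \o a' n') (b n \o b' n') z)) /=.
apply: eq_bigr => n _.
rewrite (linear_fsum (bop_linear (bop_gtens S (ba n) (bb n)))).
by apply: eq_bigr => n' _; rewrite -gtens_comp.
Qed.

Lemma alg_tens_comp s t : alg_tens s -> alg_tens t -> alg_tens (s \o t).
Proof.
move=> [N [a [b [Aa Bb ->]]]] [N' [a' [b' [Aa' Bb' ->]]]].
exists (N * N')%type, (fun p => a p.1 \o a' p.2), (fun p => b p.1 \o b' p.2); split.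
- by move=> p; exact: (oa_comp oA).
- by move=> p; exact: (oa_comp oB).
- by apply: sum_gtens_comp => n; [exact: bA|exact: bB|exact: bA|exact: bB].
Qed.

Lemma gspatialE : gspatial = opclosure alg_tens.
Proof. by rewrite /gspatial lspan_elem_tens. Qed.

Lemma gspatial_operator_algebra : operator_algebra gspatial.
Proof.
rewrite gspatialE; apply: opclosure_operator_algebra.
- exact: alg_tens_bop.
- exact: alg_tens0.
- exact: alg_tensZD.
- exact: alg_tens_comp.
Qed.

Lemma gspatial_elem a b : A a -> B b -> gspatial (gtens T a b).
Proof.
move=> Aa Bb; rewrite gspatialE; apply: sub_opclosure; first exact: alg_tens_bop.
by exists 'I_1, (fun=> a), (fun=> b); rewrite big_ord1.
Qed.

End SpatialTensor.

Arguments elem_tens {R H K} T A B.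
Arguments alg_tens {R H K} T A B.
Arguments gspatial {R H K} T A B.

Lemma gspatial_cstar (R : realType) (H K : hilbert R) (T : hilbert_tensor H K)
    (A : set (op H)) (B : set (op K)) : cstar_algebra A -> cstar_algebra B ->
  cstar_algebra (gspatial T A B).
Proof.
move=> cA cB; have oA := cA.1; have oB := cB.1.
rewrite gspatialE//; apply: opclosure_cstar_algebra.
- exact: alg_tens_bop.
- exact: alg_tens0.
- exact: alg_tensZD.
- exact: alg_tens_comp.
- move=> _ [N [a [b [Aa Bb ->]]]].
  exists N, (fun n => adj (a n)), (fun n => adj (b n)); split=> [n|n|].
  + exact: cs_adj.
  + exact: cs_adj.
  + apply: is_adjoint_adj; apply: is_adjoint_sum => n _.
    have ba := oa_bop oA (Aa n); have bb := oa_bop oB (Bb n).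
    by apply: gtens_adjoint => //; exact: adjP.
Qed.

Section MapTensor.
Variables (R : realType) (H H' K K' : hilbert R).
Variables (T : hilbert_tensor H K) (T' : hilbert_tensor H' K').
Variables (A : set (op H)) (B : set (op K)) (phi : op H -> op H') (psi : op K -> op K').
Variables (A' : set (op H')) (B' : set (op K')).
Hypotheses (oA : operator_algebra A) (oB : operator_algebra B)
  (bA' : A' `<=` @bounded_op R H') (bB' : B' `<=` @bounded_op R K')
  (hphi : alg_hom A A' phi) (hpsi : alg_hom B B' psi).

Let bA := oa_bop oA.
Let bB := oa_bop oB.
Let bphi a (Aa : A a) : bounded_op (phi a) := bA' (hom_in hphi Aa).
Let bpsi b (Bb : B b) : bounded_op (psi b) := bB' (hom_in hpsi Bb).

Definition gmaptens : op T -> op T' :=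
  xget (fun=> 0) [set Phi : op T -> op T' |
    [/\ set_fun (gspatial T A B) (@bounded_op R T') Phi,
        linear_on (gspatial T A B) Phi,
        exists M : R, forall t, gspatial T A B t -> opnorm (Phi t) <= M * opnorm t
      & forall a b, A a -> B b -> Phi (gtens T a b) = gtens T' (phi a) (psi b)]].

Definition mrel (s : op T) (s' : op T') : Prop :=
  exists (N : finType) a b, [/\ forall n : N, A (a n), forall n, B (b n),
    s = \sum_n gtens T (a n) (b n) & s' = \sum_n gtens T' (phi (a n)) (psi (b n))].

Lemma mrel_bop : bop_rel mrel.
Proof.
move=> _ _ [N [a [b [Aa Bb -> ->]]]]; split; apply: bop_sum => n _.
  by apply: bop_gtens; [exact: bA|exact: bB].
by apply: bop_gtens; [exact: bphi|exact: bpsi].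
Qed.

Lemma mrel_lin : lin_rel mrel.
Proof.
split.
  exists 'I_0, (fun=> 0), (fun=> 0); rewrite !big_ord0; split=> // _.
    exact: (oa0 oA).
  exact: (oa0 oB).
move=> c _ _ _ _ [N [a [b [Aa Bb -> ->]]]] [N' [a' [b' [Aa' Bb' -> ->]]]].
exists (N + N')%type, (fun n => match n with inl n => c *: a n | inr n => a' n end),
  (fun n => match n with inl n => b n | inr n => b' n end); split.
- by move=> [n|n] //; exact: (oaZ oA).
- by case.
- rewrite big_sumType/= scaler_sumr; congr (_ + _); apply: eq_bigr => n _.
  by rewrite gtensZl//; [exact: bA|exact: bB].
- rewrite big_sumType/= scaler_sumr; congr (_ + _); apply: eq_bigr => n _.
  by rewrite (homZ oA hphi)// gtensZl//; [exact: bphi|exact: bpsi].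
Qed.

Lemma mrel_comp s s' t t' : mrel s s' -> mrel t t' -> mrel (s \o t) (s' \o t').
Proof.
move=> [N [a [b [Aa Bb -> ->]]]] [N' [a' [b' [Aa' Bb' -> ->]]]].
exists (N * N')%type, (fun p => a p.1 \o a' p.2), (fun p => b p.1 \o b' p.2); split.
- by move=> p; exact: (oa_comp oA).
- by move=> p; exact: (oa_comp oB).
- by apply: sum_gtens_comp => n; [exact: bA|exact: bB|exact: bA|exact: bB].
- rewrite sum_gtens_comp; [|by move=> n; exact: bphi|by move=> n; exact: bpsi|
    by move=> n; exact: bphi|by move=> n; exact: bpsi].
  by apply: eq_bigr => p _; rewrite (hom_comp hphi)// (hom_comp hpsi).
Qed.

Lemma mrel_dom : [set s | exists s', mrel s s'] = alg_tens T A B.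
Proof.
apply/seteqP; split=> s; first by move=> [_ [N [a [b [Aa Bb -> _]]]]]; exists N, a, b.
move=> [N [a [b [Aa Bb ->]]]].
by exists (\sum_n gtens T' (phi (a n)) (psi (b n))), N, a, b.
Qed.

Hypothesis cc : cc_rel mrel.

(** Values picked from the closure of [mrel] form a map with the required properties, so the choice
    in [gmaptens] does not fall back on its default. *)
Lemma gmaptens_prop :
  [/\ set_fun (gspatial T A B) (@bounded_op R T') gmaptens,
      linear_on (gspatial T A B) gmaptens,
      exists M : R, forall t, gspatial T A B t -> opnorm (gmaptens t) <= M * opnorm t
    & forall a b, A a -> B b -> gmaptens (gtens T a b) = gtens T' (phi a) (psi b)].
Proof.
have /choice[F FP] : forall t, exists t', gspatial T A B t -> clrel mrel t t'.
  move=> t; have [St|nSt] := pselect (gspatial T A B t); last by exists 0 => /nSt.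
  have [|t' tt'] := clrel_total mrel_bop mrel_lin cc (s := t); last by exists t'.
  by rewrite mrel_dom -gspatialE.
rewrite /gmaptens; case: xgetP => // /(_ F) []; split.
- by move=> t /FP[].
- move=> c s t Ss St; have oS := gspatial_operator_algebra T oA oB.
  apply: (clrel_fun mrel_bop mrel_lin cc (FP _ (oaZD oS c Ss St))).
  by apply: (clrel_lin mrel_bop mrel_lin).2; exact: FP.
- by exists 1 => t /FP tt; rewrite mul1r; exact: clrel_opnorm mrel_bop cc _ _ tt.
- move=> a b Aa Bb.
  apply: (clrel_fun mrel_bop mrel_lin cc (FP _ (gspatial_elem T oA oB Aa Bb))).
  apply: (sub_clrel mrel_bop); exists 'I_1, (fun=> a), (fun=> b).
  by rewrite !big_ord1.
Qed.

Lemma gmaptens_elem a b : A a -> B b ->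
  gmaptens (gtens T a b) = gtens T' (phi a) (psi b).
Proof. by case: gmaptens_prop => _ _ _; apply. Qed.

(** The choice operator may return any map that meets the specification. Linearity fixes it on
    algebraic tensors and boundedness, with an unknown constant [M], on the closure; from here on
    everything is read off the relation. *)
Lemma gmaptens_rel t : gspatial T A B t -> clrel mrel t (gmaptens t).
Proof.
move=> St; have [Fb FZD [M FM] FE] := gmaptens_prop.
have oS := gspatial_operator_algebra T oA oB.
have aS s : alg_tens T A B s -> gspatial T A B s.
  by rewrite gspatialE//; apply: sub_opclosure; exact: alg_tens_bop.
have FrelE s s' : mrel s s' -> gmaptens s = s'.
  move=> [N [a [b [Aa Bb -> ->]]]].
  have F0 : gmaptens 0 = 0.
    have S0 := oa0 oS; have := FZD 1 0 0 S0 S0.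
    by rewrite !scale1r addr0 => /(congr1 (fun z => z - gmaptens 0)); rewrite addrK subrr.
  suff [] : gspatial T A B (\sum_n gtens T (a n) (b n)) /\
    gmaptens (\sum_n gtens T (a n) (b n)) = \sum_n gtens T' (phi (a n)) (psi (b n)) by [].
  elim/big_rec2: _ => [|n y x _ [Sx xE]]; first by split=> //; exact: (oa0 oS).
  have Sg := gspatial_elem T oA oB (Aa n) (Bb n).
  split; first exact: (oaD oS).
  by rewrite -[gtens T _ _]scale1r FZD// !scale1r FE// xE.
split=> [||e e0]; [exact: oa_bop oS _ St|exact: Fb|].
have M1 : 0 < `|M| + 1 by rewrite ltr_wpDl.
move: (St); rewrite gspatialE// -mrel_dom => -[_ /(_ _ (divr_gt0 e0 M1))[s [s' q] ts]].
have Ss : gspatial T A B s by apply: aS; rewrite -mrel_dom; exists s'.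
exists s, s'; split=> //.
  by apply: lt_le_trans ts _; rewrite ler_pdivrMr// ler_peMr ?(ltW e0)// lerDr.
have -> : gmaptens t - s' = gmaptens (t - s).
  rewrite -(FrelE _ _ q); have := FZD (-1) s t Ss St.
  by rewrite !scaleN1r (addrC (- s)) => ->; exact: addrC.
apply: le_lt_trans (FM _ (oaB oS St Ss)) _; rewrite ltr_pdivlMr// mulrC in ts.
apply: le_lt_trans ts; rewrite ler_wpM2r ?opnorm_ge0//.
by rewrite (le_trans (ler_norm _))// lerDl.
Qed.

Lemma gmaptens_alg_hom : alg_hom (gspatial T A B) (@bounded_op R T') gmaptens.
Proof.
have [Fb FZD _ _] := gmaptens_prop; split=> // s t Ss St.
have oS := gspatial_operator_algebra T oA oB.
apply: (clrel_fun mrel_bop mrel_lin cc (gmaptens_rel (oa_comp oS Ss St))).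
by apply: (clrel_comp mrel_bop mrel_comp); exact: gmaptens_rel.
Qed.

Lemma gmaptens_mxbd (I J : finType) (a : I -> J -> op T) C : 0 <= C ->
  (forall i j, gspatial T A B (a i j)) -> mxbd a C ->
  mxbd (fun i j => gmaptens (a i j)) C.
Proof.
move=> C0 Sa; apply: (clrel_cc mrel_bop cc C0) => i j; exact: gmaptens_rel.
Qed.

Lemma gmaptens_opnorm t : gspatial T A B t -> opnorm (gmaptens t) <= opnorm t.
Proof. by move=> St; exact: (clrel_opnorm mrel_bop cc (gmaptens_rel St)). Qed.

Lemma gmaptens_mxbd_inv (I J : finType) (a : I -> J -> op T) C :
  cc_rel (fun s' s => mrel s s') -> 0 <= C ->
  (forall i j, gspatial T A B (a i j)) -> mxbd (fun i j => gmaptens (a i j)) C ->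
  mxbd a C.
Proof.
move=> cc' C0 Sa.
have br : bop_rel (fun s' s => mrel s s') by move=> s' s /mrel_bop[].
apply: (clrel_cc br cc' C0) => i j; apply/clrel_inv; exact: gmaptens_rel.
Qed.

Hypotheses (cA : cstar_algebra A) (cB : cstar_algebra B)
  (sphi : star_hom A A' phi) (spsi : star_hom B B' psi).

Lemma mrel_adj s s' : mrel s s' ->
  mrel (adj s) (adj s').
Proof.
move=> [N [a [b [Aa Bb -> ->]]]].
exists N, (fun n => adj (a n)), (fun n => adj (b n)); split=> [n|n||].
- exact: cs_adj.
- exact: cs_adj.
- apply: is_adjoint_adj; apply: is_adjoint_sum => n _.
  have ba := bA (Aa n); have bb := bB (Bb n).
  by apply: gtens_adjoint => //; exact: adjP.
- apply: is_adjoint_adj; apply: is_adjoint_sum => n _.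
  have ba := star_hom_bop bA' sphi (Aa n); have bb := star_hom_bop bB' spsi (Bb n).
  rewrite (star_hom_adj cA sphi)// (star_hom_adj cB spsi)//.
  by apply: gtens_adjoint => //; exact: adjP.
Qed.

Lemma gmaptens_star_hom : star_hom (gspatial T A B) (@bounded_op R T') gmaptens.
Proof.
split; first exact: gmaptens_alg_hom.
move=> s t Ss St st; have rs := gmaptens_rel Ss; have rt := gmaptens_rel St.
have := clrel_adj mrel_bop mrel_adj rs; rewrite (is_adjoint_adj st).
move=> /(clrel_fun mrel_bop mrel_lin cc rt) ->; apply: adjP; exact: (clrel_bop rs).2.
Qed.

End MapTensor.

Arguments mrel {R H H' K K'} T T' A B phi psi.
Arguments gmaptens {R H H' K K'} T T' A B phi psi.

Section MapTensorCC.
Variables (R : realType) (H H' K : hilbert R).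
Variables (T : hilbert_tensor H K) (T' : hilbert_tensor H' K).
Variables (A : set (op H)) (B : set (op K)) (phi : op H -> op H').
Hypotheses (oA : operator_algebra A) (bB : B `<=` @bounded_op R K)
  (lphi : linear_on A phi) (bphi : forall a, A a -> bounded_op (phi a)).

Let Rl a a' := A a /\ a' = phi a.

Let Rl_phi (I J : finType) (a : I -> J -> op H) a' :
  (forall i j, Rl (a i j) (a' i j)) ->
  a' = (fun i j => phi (a i j)) /\ forall i j, A (a i j).
Proof.
move=> aa; split=> [|i j]; last by case: (aa i j).
by apply/funext => i; apply/funext => j; case: (aa i j).
Qed.

Let bR : bop_rel Rl.
Proof. by move=> a _ [Aa ->]; split; [exact: oa_bop Aa|exact: bphi]. Qed.

Let lR : lin_rel Rl.
Proof.
split=> [|c a _ b _ [Aa ->] [Ab ->]].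
  have A0 := oa0 oA; split=> //; have := lphi 1 A0 A0.
  by rewrite !scale1r addr0 => /(congr1 (fun z => z - phi 0)); rewrite addrK subrr.
by split; [exact: oaZD|rewrite lphi].
Qed.

Lemma mrel_cc_l :
  (forall (I J : finType) (a : I -> J -> op H) C, 0 <= C ->
    (forall i j, A (a i j)) -> mxbd a C -> mxbd (fun i j => phi (a i j)) C) ->
  cc_rel (mrel T T' A B phi id).
Proof.
move=> h I J t t' C C0 tt; have cR : cc_rel Rl.
  by move=> I' J' a a' D D0 /Rl_phi[-> Aa]; exact: h.
apply: (cc_trel bR lR bB cR C0) => i j.
have [N [a [b [Aa Bb h1 h2]]]] := tt i j.
by exists N, a, (fun n => phi (a n)), b.
Qed.

Lemma mrel_cc_l_inv :
  (forall (I J : finType) (a : I -> J -> op H) C, 0 <= C ->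
    (forall i j, A (a i j)) -> mxbd (fun i j => phi (a i j)) C -> mxbd a C) ->
  cc_rel (fun s' s => mrel T T' A B phi id s s').
Proof.
move=> h I J t t' C C0 tt; pose Rl' a' a := Rl a a'.
have cR : cc_rel Rl' by move=> I' J' a' a D D0 /Rl_phi[-> Aa]; exact: h.
have bR' : bop_rel Rl' by move=> a' a /bR[].
have lR' : lin_rel Rl' by split=> [|c a a' b b']; [exact: lR.1|exact: lR.2].
apply: (cc_trel bR' lR' bB cR C0) => i j.
have [N [a [b [Aa Bb h1 h2]]]] := tt i j.
by exists N, (fun n => phi (a n)), a, b.
Qed.

End MapTensorCC.

Lemma gtens_swap (R : realType) (H K : hilbert R) (T : hilbert_tensor H K) (a : op H) (b : op K) :
  bounded_op a -> bounded_op b -> gtens (htswap T) b a = gtens T a b.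
Proof.
move=> ba bb; apply: gtens_uniq => //; split; first exact: (bop_gtens T ba bb).
by move=> y x; exact: (gtensE T ba bb).
Qed.

(** Reduced to [mrel_cc_l] by viewing both tensor products with their factors exchanged. *)
Lemma mrel_cc_r (R : realType) (H K K' : hilbert R) (T : hilbert_tensor H K) (T' : hilbert_tensor H K')
    (A : set (op H)) (B : set (op K)) (psi : op K -> op K') :
  A `<=` @bounded_op R H -> operator_algebra B ->
  linear_on B psi -> (forall b, B b -> bounded_op (psi b)) ->
  (forall (I J : finType) (b : I -> J -> op K) C, 0 <= C ->
    (forall i j, B (b i j)) -> mxbd b C -> mxbd (fun i j => psi (b i j)) C) ->
  cc_rel (mrel T T' A B id psi).
Proof.
move=> bA oB lpsi bpsi h I J t t' C C0 tt.
have cc : cc_rel (mrel (htswap T) (htswap T') B A psi id).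
  exact: mrel_cc_l oB bA lpsi bpsi h.
refine (cc I J t t' C C0 _) => i j.
have [N [a [b [Aa Bb -> ->]]]] := tt i j.
exists N, b, a; split=> //; apply: eq_bigr => n _; rewrite gtens_swap//.
- exact: bA.
- exact: oa_bop (Bb n).
- exact: bA.
- exact: bpsi.
Qed.

(** * Associativity and cosystems *)

Section Unitary.
Variables (R : realType) (X Y : hilbert R).

Lemma isometry_inner (f : X -> Y) : linear f -> (forall x, hnorm (f x) = hnorm x) ->
  forall x y, inner Y (f x) (f y) = inner X x y.
Proof.
move=> lf nf.
have re x y : complex.Re (inner Y (f x) (f y)) = complex.Re (inner X x y).
  have := nf (x + y); rewrite (linear_fD lf) => /(congr1 (fun r => r ^+ 2)).
  rewrite !hnormD2 !nf => /addrI; rewrite -mulr_natr -[RHS]mulr_natr.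
  by apply: mulIf; rewrite pnatr_eq0.
move=> x y; apply: complex_eq => //.
have := re ('i%C *: x) y; rewrite (linear_fZ lf) !innerZl !cReMi.
exact: oppr_inj.
Qed.

Lemma unitary_adjoint (f : X -> Y) (g : Y -> X) : bmap f -> bmap g ->
  (forall x, hnorm (f x) <= hnorm x) -> (forall y, hnorm (g y) <= hnorm y) ->
  cancel f g -> cancel g f -> forall x y, inner Y (f x) y = inner X x (g y).
Proof.
move=> bf bg nf ng fK gK x y; rewrite -{1}[y]gK.
apply: isometry_inner => [|z]; first exact: bf.1.
by apply/eqP; rewrite eq_le nf -{1}[z]fK ng.
Qed.

Lemma conj_star_hom (f : X -> Y) (g : Y -> X) : bmap f -> bmap g ->
  cancel f g -> cancel g f -> (forall x y, inner Y (f x) y = inner X x (g y)) ->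
  star_hom (@bounded_op R X) (@bounded_op R Y) (fun t => f \o t \o g).
Proof.
move=> bf bg fK gK fg; split; [split|].
- move=> t bt; apply/bounded_opE; apply: bmap_comp bg; apply: bmap_comp bf _.
  exact/bounded_opE.
- by move=> c a b _ _; apply/funext => y; rewrite /= !fctE bf.1.
- by move=> a b _ _; apply/funext => y; rewrite /= fK.
- by move=> a b _ _ ab y y'; rewrite /= fg ab [RHS]innerC fg -innerC.
Qed.

End Unitary.

Section Associativity.
Variables (R : realType) (H K L : hilbert R).

Definition alg_tens3 (S : hilbert_tensor K L) (T : hilbert_tensor H S) : set T :=
  [set t : T | exists (N : finType) x y z,
    t = \sum_(n : N) tens T (x n) (tens S (y n) (z n))].

Arguments alg_tens3 {S} T.

Lemma alg_tens3_dense (S : hilbert_tensor K L) (T : hilbert_tensor H S) :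
  closure (alg_tens3 T) = setT.
Proof.
apply/seteqP; split=> // t _; apply/closure_hnormP => e e0.
have e2 : 0 < e / 2 by rewrite divr_gt0.
have : closure [set t : T | exists (N : finType) x y,
  t = \sum_(n : N) tens T (x n) (y n)] t by rewrite tens_alg_dense.
move=> /closure_hnormP/(_ _ e2)[_ [N [x [w ->]]] tw].
pose M := \sum_n hnorm (x n) + 1.
have s0 : 0 <= \sum_n hnorm (x n) by apply: sumr_ge0 => n _; exact: hnorm_ge0.
have M0 : 0 < M by rewrite ltr_wpDl.
have /choice[v vP] : forall n, exists v : {P : finType & P -> K * L},
    hnorm (w n - \sum_p tens S (projT2 v p).1 (projT2 v p).2) < e / 2 / M.
  move=> n; have : closure [set t : S | exists (N : finType) x y,
    t = \sum_(n : N) tens S (x n) (y n)] (w n) by rewrite tens_alg_dense.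
  move=> /closure_hnormP/(_ _ (divr_gt0 e2 M0))[_ [P [y [z ->]]] h].
  by exists (existT _ P (fun p => (y p, z p))).
exists (\sum_n tens T (x n) (\sum_p tens S (projT2 (v n) p).1 (projT2 (v n) p).2)).
  exists {n : N & projT1 (v n)}, (fun q => x (tag q)),
    (fun q => (projT2 (v (tag q)) (tagged q)).1),
    (fun q => (projT2 (v (tag q)) (tagged q)).2).
  rewrite (eq_bigr _ (fun n _ => tens_sumr _ _ _ _ _)).
  by rewrite (sig_big_dep _ _ (fun n (p : projT1 (v n)) =>
    tens T (x n) (tens S (projT2 (v n) p).1 (projT2 (v n) p).2))).
set u := \sum_n tens T (x n) (w n) in tw *.
rewrite -(subrKA u) (le_lt_trans (hnormD _ _))// [ltRHS]splitr ltr_leD//.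
rewrite /u -sumrB (le_trans (hnorm_sum _ _ _))//.
apply: le_trans (_ : \sum_n hnorm (x n) * (e / 2 / M) <= _).
  apply: ler_sum => n _; rewrite -(linear_fB (tens_linearr T (x n))) hnorm_tens.
  by rewrite ler_wpM2l ?hnorm_ge0// ltW.
rewrite -mulr_suml mulrA ler_pdivrMr// mulrC ler_wpM2l ?(ltW e2)//.
by rewrite /M lerDl.
Qed.

Lemma eq_on_alg_tens3 (Z : hilbert R) (S : hilbert_tensor K L)
    (T : hilbert_tensor H S) (f g : T -> Z) : bmap f -> bmap g ->
  (forall x y z, f (tens T x (tens S y z)) = g (tens T x (tens S y z))) -> f = g.
Proof.
move=> bf bg fg.
apply: (eq_on_dense (S := [set tens T p.1 (tens S p.2.1 p.2.2) |
  p in [set: H * (K * L)]]) bf bg) => [|_ [p _ <-]]; last exact: fg.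
apply/seteqP; split=> // t _; have : closure (alg_tens3 T) t by rewrite alg_tens3_dense.
apply: closure_subset => _ [N [x [y [z ->]]]].
elim/big_rec: _ => [|n s _ hs]; first exact: lspan0.
rewrite -[tens _ _ _]scale1r; apply: lspanZD => //; apply: sub_lspan.
by exists (x n, (y n, z n)).
Qed.

End Associativity.

(* Two bracketings of a triple tensor product are identified by the isometric
   extension of the obvious correspondence of elementary tensors. *)
Lemma assoc_exists (R : realType) (H K L H1 K1 L1 : hilbert R)
    (S : hilbert_tensor K L) (T : hilbert_tensor H S)
    (S1 : hilbert_tensor K1 L1) (T1 : hilbert_tensor H1 S1)
    (f1 : H * K * L -> H1) (f2 : H * K * L -> K1) (f3 : H * K * L -> L1) :
  (forall c x y z, tens T1 (f1 (c *: x, y, z)) (tens S1 (f2 (c *: x, y, z)) (f3 (c *: x, y, z))) =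
    c *: tens T1 (f1 (x, y, z)) (tens S1 (f2 (x, y, z)) (f3 (x, y, z)))) ->
  (forall p q, inner T1 (tens T1 (f1 p) (tens S1 (f2 p) (f3 p)))
      (tens T1 (f1 q) (tens S1 (f2 q) (f3 q))) =
    inner T (tens T p.1.1 (tens S p.1.2 p.2)) (tens T q.1.1 (tens S q.1.2 q.2))) ->
  exists W : T -> T1, [/\ bmap W, forall t, hnorm (W t) <= hnorm t &
    forall x y z, W (tens T x (tens S y z)) =
      tens T1 (f1 (x, y, z)) (tens S1 (f2 (x, y, z)) (f3 (x, y, z)))].
Proof.
move=> hZ hI; pose F p := tens T1 (f1 p) (tens S1 (f2 p) (f3 p)).
pose Rl (s : T) (t : T1) := exists (N : finType) x y z,
  s = \sum_(n : N) tens T (x n) (tens S (y n) (z n)) /\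
  t = \sum_n F (x n, y n, z n).
have [||||W [bW nW WE]] := @extend_bounded _ _ _ Rl 1 _.
- by [].
- move=> c _ _ _ _ [N [x [y [z [-> ->]]]]] [N' [x' [y' [z' [-> ->]]]]].
  exists (N + N')%type, (fun n => match n with inl n => c *: x n | inr n => x' n end),
    (fun n => match n with inl n => y n | inr n => y' n end),
    (fun n => match n with inl n => z n | inr n => z' n end).
  rewrite !big_sumType/= !scaler_sumr; split; congr (_ + _); apply: eq_bigr => n _.
    by rewrite tensZl.
  by rewrite /F hZ.
- move=> _ _ [N [x [y [z [-> ->]]]]]; rewrite mul1r.
  rewrite le_eqVlt; apply/orP; left.
  rewrite -(@eqrXn2 _ 2) ?hnorm_ge0// !hnorm_sqr !inner_suml !cRe_sum; apply/eqP.
  apply: eq_bigr => n _; rewrite !inner_sumr !cRe_sum.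
  by apply: eq_bigr => m _; rewrite hI.
- rewrite -(alg_tens3_dense T); congr closure; apply/seteqP; split=> s /=.
    by move=> [_ [N [x [y [z [-> _]]]]]]; exists N, x, y, z.
  move=> [N [x [y [z ->]]]]; exists (\sum_(n : N) F (x n, y n, z n)).
  by exists N, x, y, z.
exists W; split=> // [t|x y z]; first by have := nW t; rewrite mul1r.
by apply: WE; exists 'I_1, (fun=> x), (fun=> y), (fun=> z); rewrite !big_ord1.
Qed.

Section TensorAssoc.
Variable R : realType.
Variable tp : forall H K : hilbert R, hilbert_tensor H K.
Variables H K L : hilbert R.

Let X := tp H (tp K L).
Let Y := tp (tp H K) L.

(** [assoc_exists] expects products nested to the right. Through [htswap] the target is read as L
    (x) (H (x) K), with the three vectors permuted accordingly. *)
Lemma tassocP : [/\ bmap (@tassoc R tp H K L), forall t, hnorm (@tassoc R tp H K L t) <= hnorm t &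
  forall x y z, @tassoc R tp H K L (tens X x (tens (tp K L) y z)) =
    tens Y (tens (tp H K) x y) z].
Proof.
have [||W [bW nW WE]] := @assoc_exists R H K L L H K (tp K L) X (tp H K) (htswap Y)
  (fun p => p.2) (fun p => p.1.1) (fun p => p.1.2).
- by move=> c x y z /=; rewrite tensZl tensZl.
- by move=> [[x y] z] [[x' y'] z'] /=; rewrite !tens_inner mulrA.
suff -> : @tassoc R tp H K L = W by [].
have bmapP f : linear f -> continuous f -> @bmap R X Y f.
  by move=> lf /(linear_continuousP lf).
rewrite /tassoc; case: xgetP => [V _ [lV cV VE]|/(_ W)]; last first.
  by case; split=> //; [exact: bW.1|apply/linear_continuousP; [exact: bW.1|exact: bW.2]].
by apply: eq_on_alg_tens3 => // [|x y z]; [exact: bmapP|rewrite VE WE].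
Qed.

Lemma tassoc_invP : [/\ bmap (@tassoc_inv R tp H K L),
  forall t, hnorm (@tassoc_inv R tp H K L t) <= hnorm t &
  forall x y z, @tassoc_inv R tp H K L (tens Y (tens (tp H K) x y) z) =
    tens X x (tens (tp K L) y z)].
Proof.
have [||W [bW nW WE]] := @assoc_exists R L H K H K L (tp H K) (htswap Y) (tp K L) X
  (fun p => p.1.2) (fun p => p.2) (fun p => p.1.1).
- by move=> c x y z /=; rewrite tensZr tensZr.
- move=> [[x y] z] [[x' y'] z'] /=; rewrite !tens_inner; ring.
suff -> : @tassoc_inv R tp H K L = W by split=> // x y z; exact: WE.
have bmapP f : linear f -> continuous f -> @bmap R Y X f.
  by move=> lf /(linear_continuousP lf).
rewrite /tassoc_inv; case: xgetP => [V _ [lV cV VE]|/(_ W)]; last first.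
  case; split; [exact: bW.1|apply/linear_continuousP; [exact: bW.1|exact: bW.2]|].
  by move=> x y z; exact: WE.
apply: (@eq_on_alg_tens3 _ _ _ _ _ _ (htswap Y)) => // [|x y z]; first exact: bmapP.
by rewrite WE; exact: VE.
Qed.

Lemma tassocK : cancel (@tassoc R tp H K L) (@tassoc_inv R tp H K L).
Proof.
have [b1 _ E1] := tassocP; have [b2 _ E2] := tassoc_invP => t.
suff /(congr1 (@^~ t)) : @tassoc_inv R tp H K L \o @tassoc R tp H K L = id by [].
apply: eq_on_alg_tens3 => [||x y z]; first exact: bmap_comp.
  by split=> //; exists 1 => x; rewrite mul1r.
by rewrite /= E1 E2.
Qed.

Lemma tassoc_invK : cancel (@tassoc_inv R tp H K L) (@tassoc R tp H K L).
Proof.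
have [b1 _ E1] := tassocP; have [b2 _ E2] := tassoc_invP => t.
suff /(congr1 (@^~ t)) : @tassoc R tp H K L \o @tassoc_inv R tp H K L = id by [].
apply: (@eq_on_alg_tens3 _ _ _ _ _ _ (htswap Y)) => [||x y z]; first exact: bmap_comp.
  by split=> //; exists 1 => x; rewrite mul1r.
by rewrite /= E2 E1.
Qed.

Definition tconj (t : op X) : op Y :=
  @tassoc R tp H K L \o t \o @tassoc_inv R tp H K L.

Lemma tconj_star_hom : star_hom (@bounded_op R X) (@bounded_op R Y) tconj.
Proof.
have [b1 n1 _] := tassocP; have [b2 n2 _] := tassoc_invP.
apply: conj_star_hom => //; first exact: tassocK.
  exact: tassoc_invK.
by apply: unitary_adjoint => //; [exact: tassocK|exact: tassoc_invK].
Qed.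

Lemma tconj_elem a b c : bounded_op a -> bounded_op b -> bounded_op c ->
  tconj (gtens X a (gtens (tp K L) b c)) = gtens Y (gtens (tp H K) a b) c.
Proof.
move=> ba bb bc; have [b1 _ E1] := tassocP; have [b2 _ E2] := tassoc_invP.
have bbc := bop_gtens (tp K L) bb bc; have bab := bop_gtens (tp H K) ba bb.
have bt := hom_in tconj_star_hom.1 (bop_gtens X ba bbc).
apply: (@eq_on_alg_tens3 _ _ _ _ _ _ (htswap Y)).
- exact/(@bounded_opE _ Y).
- by apply/(@bounded_opE _ Y); exact: bop_gtens.
- by move=> z x y; rewrite /tconj /= E2 !gtensE// E1.
Qed.

End TensorAssoc.

Section HomLemmas.
Variable R : realType.
Implicit Types H K L : hilbert R.

Lemma alg_hom_comp H K L (A : set (op H)) (B : set (op K)) (D : set (op L)) f g :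
  alg_hom A B f -> alg_hom B D g -> alg_hom A D (g \o f).
Proof.
move=> hf hg; split=> [a Aa|c a b Aa Ab|a b Aa Ab].
- exact: (hom_in hg (hom_in hf Aa)).
- by rewrite /= (homZD hf)// (homZD hg)//; exact: (hom_in hf).
- by rewrite /= (hom_comp hf)// (hom_comp hg)//; exact: (hom_in hf).
Qed.

Lemma star_hom_comp H K L (A : set (op H)) (B : set (op K)) (D : set (op L)) f g :
  star_hom A B f -> star_hom B D g -> star_hom A D (g \o f).
Proof.
move=> sf sg; split; first exact: alg_hom_comp sf.1 sg.1.
move=> a b Aa Ab ab; apply: sg.2; [exact: (hom_in sf.1)|exact: (hom_in sf.1)|].
exact: sf.2.
Qed.

Lemma star_hom_sub H K (A A' : set (op H)) (B : set (op K)) f : A' `<=` A ->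
  star_hom A B f -> star_hom A' B f.
Proof.
move=> AA sf; split=> [|a b /AA Aa /AA Ab]; last exact: sf.2.
split=> [a /AA Aa|c a b /AA Aa /AA Ab|a b /AA Aa /AA Ab].
- exact: (hom_in sf.1).
- exact: (homZD sf.1).
- exact: (hom_comp sf.1).
Qed.

(** Contractivity makes the preimage closed. This is how a star-homomorphism is shown to map a
    generated C*-algebra into [N] by looking at generators only. *)
Lemma star_hom_preim_cstar H K (M : set (op H)) (B N : set (op K)) f :
  cstar_algebra M -> B `<=` @bounded_op R K -> star_hom M B f ->
  cstar_algebra N -> cstar_algebra [set a | M a /\ N (f a)].
Proof.
move=> cM bB sf cN; have oM := cM.1; have oN := cN.1; have hf := sf.1.
have bM := oa_bop oM.
split; last first.
  move=> a b [Ma Na] ab; have Mb := cM.2 _ _ Ma ab; split=> //.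
  exact: cN.2 Na (sf.2 _ _ Ma Mb ab).
split; first by move=> a [/bM].
- split; first by split; [exact: (oa0 oM)|rewrite (hom0 oM hf); exact: (oa0 oN)].
  move=> c a b [Ma Na] [Mb Nb]; split; first exact: (oaZD oM).
  by rewrite (homZD hf)//; exact: (oaZD oN).
- move=> a b [Ma Na] [Mb Nb]; split; first exact: (oa_comp oM).
  by rewrite (hom_comp hf)//; exact: (oa_comp oN).
- move=> a ha; have Ma : M a.
    by apply: (oa_closed oM); apply: opclosure_sub ha => x [].
  split=> //; apply: (oa_closed oN); split; first exact: (star_hom_bop bB sf).
  move=> e /(proj2 ha)[s [Ms Ns] as_]; exists (f s) => //.
  apply: le_lt_trans as_; rewrite -(homB oM hf)//.
  exact: star_hom_contractive cM bB sf (oaB oM Ma Ms).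
Qed.

Section Dense.
Variables (H : hilbert R) (A S : set (op H)).
Hypotheses (oA : operator_algebra A) (SA : S `<=` A)
  (dA : A `<=` opclosure (lspan S)).

Lemma dense_eq K (B B' : set (op K)) f g :
  B `<=` @bounded_op R K -> B' `<=` @bounded_op R K ->
  alg_hom A B f -> alg_hom A B' g -> (forall a, A a -> opnorm (f a) <= opnorm a) ->
  (forall a, A a -> opnorm (g a) <= opnorm a) ->
  (forall a, S a -> f a = g a) -> forall a, A a -> f a = g a.
Proof.
move=> bB bB' hf hg nf ng fg a Aa.
have bf x : A x -> bounded_op (f x) by move=> Ax; exact: bB (hom_in hf Ax).
have bg x : A x -> bounded_op (g x) by move=> Ax; exact: bB' (hom_in hg Ax).
have fgs : lspan S `<=` [set s | A s /\ f s = g s].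
  apply: lspan_sub; first by split; [exact: (oa0 oA)|rewrite (hom0 oA hf) (hom0 oA hg)].
    move=> c x y [Ax Ex] [Ay Ey]; split; first exact: (oaZD oA).
    by rewrite (homZD hf)// (homZD hg)// Ex Ey.
  by move=> s Ss; split; [exact: SA|exact: fg].
apply/eqP; rewrite -subr_eq0; apply/eqP/opnorm_lim0 => [|e e0].
  by apply: bopB; [exact: bf|exact: bg].
have e2 : 0 < e / 2 by rewrite divr_gt0.
have [s /fgs[As Es] as_] := (dA Aa).2 _ e2; have as' := ltW as_.
apply: le_trans (opnorm_dist_triangle (bf _ Aa) (bf _ As) (bg _ Aa)) _.
rewrite [leRHS]splitr {2}Es -(homB oA hf)// -(homB oA hg)// lerD//.
  exact: le_trans (nf _ (oaB oA Aa As)) as'.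
by apply: le_trans (ng _ (oaB oA As Aa)) _; rewrite opnormBC.
Qed.

Lemma dense_in K (B N : set (op K)) f :
  B `<=` @bounded_op R K -> alg_hom A B f ->
  (forall a, A a -> opnorm (f a) <= opnorm a) -> operator_algebra N ->
  (forall a, S a -> N (f a)) -> forall a, A a -> N (f a).
Proof.
move=> bB hf nf oN SN a Aa.
have fs : lspan S `<=` [set s | A s /\ N (f s)].
  apply: lspan_sub.
  - by split; [exact: (oa0 oA)|rewrite (hom0 oA hf); exact: (oa0 oN)].
  - move=> c x y [Ax Nx] [Ay Ny]; split; first exact: (oaZD oA).
    by rewrite (homZD hf)//; exact: (oaZD oN).
  - by move=> s Ss; split; [exact: SA|exact: SN].
apply: (oa_closed oN); split; first exact: bB (hom_in hf Aa).
move=> e /(proj2 (dA Aa))[s /fs[As Ns] as_]; exists (f s) => //.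
apply: le_lt_trans as_; rewrite -(homB oA hf)//; apply: nf; exact: (oaB oA).
Qed.

End Dense.

Lemma mxbd_contractive H K (A : set (op H)) (f : op H -> op K) :
  A `<=` @bounded_op R H -> (forall a, A a -> bounded_op (f a)) ->
  (forall (I J : finType) (a : I -> J -> op H) C, 0 <= C ->
    (forall i j, A (a i j)) -> mxbd a C -> mxbd (fun i j => f (a i j)) C) ->
  forall a, A a -> opnorm (f a) <= opnorm a.
Proof.
move=> bA bf h a Aa; have := opnorm_ge0 a => a0.
apply/(mxbd1 a0 (bf _ Aa)); apply: (h _ _ (fun _ _ => a)) => //.
by apply/(mxbd1 a0 (bA _ Aa)).
Qed.

End HomLemmas.

(** * Group representations, amplifications and spectral subspaces *)

Section UnitaryRep.
Variables (R : realType) (G : groupType) (K : hilbert R) (u : G -> op K).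
Hypothesis ru : unitary_rep u.

Lemma unitary_rep_bop g : bounded_op (u g).
Proof. by case: ru => /(_ g)[]. Qed.

(** An invertible idempotent is the identity. *)
Lemma unitary_rep1 : u 1%g = id.
Proof.
have [ug uM] := ru; have [_ [b [_ ub bu]]] := ug 1%g.
have uu : u 1%g \o u 1%g = u 1%g by rewrite -uM mulg1.
by rewrite -[LHS]/(id \o u 1%g) -bu -[LHS]/(b \o (u 1%g \o u 1%g)) uu bu.
Qed.

Lemma unitary_rep_adj g : is_adjoint (u g) (u g^-1%g).
Proof.
have [ug uM] := ru; have [_ [b [ab ub bu]]] := ug g.
suff -> : u g^-1%g = b by [].
have E : u g \o u g^-1%g = id by rewrite -uM mulgV unitary_rep1.
by rewrite -[LHS]/(id \o u g^-1%g) -bu -[LHS]/(b \o (u g \o u g^-1%g)) E.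
Qed.

Lemma group_cstar_cstar : cstar_algebra (group_cstar u).
Proof. by apply: cstar_gen_cstar => _ [g _ <-]; exact: unitary_rep_bop. Qed.

Lemma group_cstar_in g : group_cstar u (u g).
Proof. by apply: sub_cstar_gen; exists g. Qed.

End UnitaryRep.

Section TensorOne.
Variables (R : realType) (H K : hilbert R) (T : hilbert_tensor H K).

Lemma gtens_id_star_hom : star_hom (@bounded_op R H) (@bounded_op R T)
  (fun t => gtens T t id).
Proof.
split; [split|].
- by move=> t bt; apply: bop_gtens => //; exact: bop_id.
- by move=> c a b ba bb; apply: gtensZDl => //; exact: bop_id.
- by move=> a b ba bb; rewrite gtens_comp//; exact: bop_id.
- by move=> a b ba bb ab; apply: gtens_adjoint => //; exact: bop_id.
Qed.

Lemma gtens_id_mxbd (I J : finType) (a : I -> J -> op H) C y : hnorm (y : K) = 1 ->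
  (forall i j, bounded_op (a i j)) -> mxbd (fun i j => gtens T (a i j) id) C ->
  mxbd a C.
Proof.
move=> y1 ba h x; have := h (fun j => tens T (x j) y).
under [X in _ <= _ * X]eq_bigr do rewrite hnorm_tens y1 mulr1.
have -> // : \sum_i hnorm (\sum_j gtens T (a i j) id (tens T (x j) y)) ^+ 2 =
  \sum_i hnorm (\sum_j a i j (x j)) ^+ 2.
apply: eq_bigr => i _; congr (_ ^+ 2).
rewrite -[RHS]mulr1 -y1 -(hnorm_tens T) tens_suml; congr hnorm; apply: eq_bigr => j _.
by rewrite gtensE//; exact: bop_id.
Qed.

Lemma tens_trivial : (forall y : K, y = 0) -> forall t : T, t = 0.
Proof.
move=> K0 t; have : closure [set t : T | exists (N : finType) x y,
  t = \sum_(n : N) tens T (x n) (y n)] t by rewrite tens_alg_dense.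
move=> /closure_hnormP h; apply: hnorm_eq0; apply/eqP; rewrite eq_le hnorm_ge0 andbT.
apply/ler_addgt0Pl => e /h[_ [N [x [y ->]]]]; rewrite addr0 big1 ?subr0 => [/ltW//|n _].
by rewrite (K0 (y n)) (linear_f0 (tens_linearr T (x n))).
Qed.

End TensorOne.

Lemma alg_hom_id (R : realType) (K : hilbert R) (B : set (op K)) : alg_hom B B id.
Proof. by split. Qed.

Lemma star_hom_id (R : realType) (K : hilbert R) (B : set (op K)) : star_hom B B id.
Proof. by split; first exact: alg_hom_id. Qed.

Section AmplificationIsometric.
Variables (R : realType) (H L K : hilbert R).
Variables (T : hilbert_tensor H K) (T' : hilbert_tensor L K).
Variables (A : set (op H)) (A' : set (op L)) (B : set (op K)) (phi : op H -> op L).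
Hypotheses (oA : operator_algebra A) (oB : operator_algebra B)
  (bA' : A' `<=` @bounded_op R L) (hp : alg_hom A A' phi)
  (ci : completely_isometric A phi).

Let bphi a (Aa : A a) : bounded_op (phi a) := bA' (hom_in hp Aa).
Let cci := completely_isometric_mxbd oA bA' hp ci.

Let cc : cc_rel (mrel T T' A B phi id).
Proof.
apply: mrel_cc_l => //; [exact: oa_bop|by case: hp|].
by move=> I J a C C0 Aa /(cci C0 Aa).
Qed.

Let cc' : cc_rel (fun s' s => mrel T T' A B phi id s s').
Proof.
apply: mrel_cc_l_inv => //; [exact: oa_bop|by case: hp|].
by move=> I J a C C0 Aa /(cci C0 Aa).
Qed.

Lemma amp_hom : alg_hom (gspatial T A B) (@bounded_op R T') (gmaptens T T' A B phi id).
Proof. exact: (gmaptens_alg_hom oA oB bA' (oa_bop oB) hp (alg_hom_id B) cc). Qed.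

Lemma amp_elem a b : A a -> B b ->
  gmaptens T T' A B phi id (gtens T a b) = gtens T' (phi a) b.
Proof. exact: (gmaptens_elem oA oB bA' (oa_bop oB) hp (alg_hom_id B) cc). Qed.

Lemma amp_mxbd (I J : finType) (a : I -> J -> op T) C : 0 <= C ->
  (forall i j, gspatial T A B (a i j)) ->
  mxbd a C <-> mxbd (fun i j => gmaptens T T' A B phi id (a i j)) C.
Proof.
move=> C0 Sa; split.
  exact: (gmaptens_mxbd oA oB bA' (oa_bop oB) hp (alg_hom_id B) cc).
exact: (gmaptens_mxbd_inv oA oB bA' (oa_bop oB) hp (alg_hom_id B) cc cc').
Qed.

Lemma amp_opnorm t : gspatial T A B t ->
  opnorm (gmaptens T T' A B phi id t) <= opnorm t.
Proof. exact: (gmaptens_opnorm oA oB bA' (oa_bop oB) hp (alg_hom_id B) cc). Qed.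

End AmplificationIsometric.

Section AmplificationStar.
Variables (R : realType).

Lemma amp_star_hom_l (H L K : hilbert R) (T : hilbert_tensor H K)
    (T' : hilbert_tensor L K) (A : set (op H)) (A' : set (op L)) (B : set (op K)) phi :
  cstar_algebra A -> cstar_algebra B -> A' `<=` @bounded_op R L -> star_hom A A' phi ->
  star_hom (gspatial T A B) (@bounded_op R T') (gmaptens T T' A B phi id) /\
  forall a b, A a -> B b -> gmaptens T T' A B phi id (gtens T a b) = gtens T' (phi a) b.
Proof.
move=> cA cB bA' sp; have bB := oa_bop cB.1.
have cc : cc_rel (mrel T T' A B phi id).
  apply: mrel_cc_l => //; [exact: cA.1|by case: sp.1| |].
    by move=> a; exact: (star_hom_bop bA' sp).
  by move=> I J a C C0 Aa; exact: (star_hom_mxbd cA bA' sp C0 Aa).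
split; first exact: (gmaptens_star_hom cA.1 cB.1 bA' bB sp.1 (alg_hom_id B) cc cA cB sp (star_hom_id B)).
exact: (gmaptens_elem cA.1 cB.1 bA' bB sp.1 (alg_hom_id B) cc).
Qed.

Lemma amp_star_hom_r (H K K' : hilbert R) (T : hilbert_tensor H K)
    (T' : hilbert_tensor H K') (A : set (op H)) (B : set (op K)) (B' : set (op K')) psi :
  cstar_algebra A -> cstar_algebra B -> B' `<=` @bounded_op R K' -> star_hom B B' psi ->
  star_hom (gspatial T A B) (@bounded_op R T') (gmaptens T T' A B id psi) /\
  forall a b, A a -> B b -> gmaptens T T' A B id psi (gtens T a b) = gtens T' a (psi b).
Proof.
move=> cA cB bB' sp; have bA := oa_bop cA.1.
have cc : cc_rel (mrel T T' A B id psi).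
  apply: mrel_cc_r => //; [exact: cB.1|by case: sp.1| |].
    by move=> b; exact: (star_hom_bop bB' sp).
  by move=> I J a C C0 Aa; exact: (star_hom_mxbd cB bB' sp C0 Aa).
split; first exact: (gmaptens_star_hom cA.1 cB.1 bA bB' (alg_hom_id A) sp.1 cc cA cB (star_hom_id A) sp).
exact: (gmaptens_elem cA.1 cB.1 bA bB' (alg_hom_id A) sp.1 cc).
Qed.

End AmplificationStar.

Section SpectralSubspaces.
Variables (R : realType) (tp : forall H K : hilbert R, hilbert_tensor H K).
Variables (G : groupType) (K : hilbert R) (u : G -> op K).
Hypothesis ru : unitary_rep u.
Variables (L : hilbert R) (M : set (op L)) (d : op L -> op (tp L K)).
Hypotheses (cM : cstar_algebra M) (sd : star_hom M (@bounded_op R (tp L K)) d).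

Let oM := cM.1.
Let bM := oa_bop oM.
Let bu g : bounded_op (u g) := unitary_rep_bop ru g.
Let Sp := \bigcup_g spectral u M d g.

Let spectral_comp a b : Sp a -> Sp b -> Sp (a \o b).
Proof.
move=> [g _ [Ma Ea]] [h _ [Mb Eb]]; exists (g * h)%g => //; split.
  exact: (oa_comp oM).
have [_ uM] := ru.
rewrite (hom_comp sd.1)// Ea Eb uM; apply: gtens_comp => //; exact: bM.
Qed.

Let spectral_adj a : Sp a -> Sp (adj a).
Proof.
move=> [g _ [Ma Ea]]; exists (g^-1)%g => //; split; first exact: cs_adj.
rewrite (star_hom_adj cM sd)// Ea; apply: is_adjoint_adj.
apply: gtens_adjoint => //; [exact: bM|exact: adjP (bM Ma)|exact: unitary_rep_adj].
Qed.

Let Sp_sub : Sp `<=` M. Proof. by move=> a [g _ []]. Qed.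

(** Spectral subspaces multiply along the group, and taking adjoints inverts the degree. Density of
    their span in a generated C*-algebra then only has to be checked on generators. *)
Lemma spectral_span_cstar : cstar_algebra (opclosure (lspan Sp)).
Proof.
have lM : lspan Sp `<=` M.
  by apply: lspan_sub => //; [exact: (oa0 oM)|move=> c x y; exact: (oaZD oM)].
apply: opclosure_cstar_algebra; [|exact: lspan0|move=> c a b; exact: lspanZD| |].
- by move=> a /lM/bM.
- move=> a b la lb.
  suff h : lspan Sp `<=` [set a : op L | lspan Sp (a \o b)] by exact: h.
  apply: lspan_sub; first exact: lspan0.
    by move=> c x y hx hy; exact: (lspanZD c hx hy).
  move=> {la}{}a Sa; have ba := bM (Sp_sub Sa).
  suff h : lspan Sp `<=` [set b : op L | lspan Sp (a \o b)] by exact: h.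
  apply: lspan_sub.
  + rewrite /=; have -> : a \o (0 : op L) = 0 by apply/funext => x; exact: (linear_f0 (bop_linear ba)).
    exact: lspan0.
  + move=> c x y hx hy /=.
    have -> : a \o (c *: x + y) = c *: (a \o x) + (a \o y).
      by apply/funext => z; exact: (bop_linear ba).
    exact: lspanZD.
  + by move=> {lb}{}b Sb; apply: sub_lspan; exact: spectral_comp.
- suff h : lspan Sp `<=` [set a : op L | M a /\ lspan Sp (adj a)] by move=> a /h[].
  apply: lspan_sub.
  + by split; [exact: (oa0 oM)|rewrite (is_adjoint_adj (@is_adjoint0 _ _)); exact: lspan0].
  + move=> c x y [Mx hx] [My hy]; split; first exact: (oaZD oM).
    rewrite (is_adjoint_adj (is_adjointZD c (adjP (bM Mx)) (adjP (bM My)))).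
    exact: lspanZD.
  + by move=> a Sa; split; [exact: Sp_sub|apply: sub_lspan; exact: spectral_adj].
Qed.

End SpectralSubspaces.

(** * Identification of the C*-envelope of the cosystem *)

Theorem theorem3p8 (R : realType)
  (tp : forall H K : hilbert R, hilbert_tensor H K)
  (G : groupType) (K : hilbert R) (u : G -> op K) (Hu : full_group_rep u)
  (Delta : op K -> op (tp K K)) (HDelta : comultiplication u Delta)
  (H : hilbert R) (A : set (op H)) (delta : op H -> op (tp H K))
  (Hdelta : cosystem u A delta)
  (E : hilbert R) (C : set (op E)) (iota : op H -> op E)
  (Henv : cstar_envelope A C iota) :
  cosystem_envelope u A delta
    (spectral_cstar u A delta iota)
    (fun a => maptens A (group_cstar u) iota id (delta a))
    (id_tens_comult u C Delta).
Proof.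
have ss L := @subset_refl _ (@bounded_op R L).
have [ru Huniv] := Hu; have [sDelta _ DeltaE] := HDelta.
have [oA hdelta cidelta densA] := Hdelta.
have [[cC hiota ciiota CE] Cuniv] := Henv.
set B := group_cstar u; have cB : cstar_algebra B := group_cstar_cstar ru.
have oB := cB.1; have bA := oa_bop oA; have bB := oa_bop oB; have bC := oa_bop cC.1.
have Bu g : B (u g) by exact: group_cstar_in.
have bu g : bounded_op (u g) := unitary_rep_bop ru g.
set Sg : set (op (tp E K)) := [set t | exists g a,
  spectral u A delta g a /\ t = optens (iota a) (u g)].
set D := spectral_cstar u A delta iota.
set iE := fun a => maptens A B iota id (delta a).
set dE := id_tens_comult u C Delta.
have CI a : A a -> C (iota a) by move=> Aa; exact: (hom_in hiota).
have bSg : Sg `<=` @bounded_op R (tp E K).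
  move=> _ [g [a [[Aa _] ->]]]; apply: bop_gtens => //; exact: bC (CI _ Aa).
have cD : cstar_algebra D := cstar_gen_cstar bSg.
have oD := cD.1; have bD := oa_bop oD.
have oSA : operator_algebra (gspatial (tp H K) A B) := gspatial_operator_algebra (tp H K) oA oB.
have bSA := oa_bop oSA.
set SpA := \bigcup_g spectral u A delta g.
have SpAsub : SpA `<=` A by move=> a [g _ []].
have hiE0 : alg_hom A (@bounded_op R (tp E K)) iE.
  apply: (alg_hom_comp hdelta); exact: (amp_hom _ _ oA oB bC hiota ciiota).
have mxdelta := completely_isometric_mxbd oA bSA hdelta cidelta.
have mxiE (I J : finType) (a : I -> J -> op H) r : 0 <= r -> (forall i j, A (a i j)) ->
    mxbd a r <-> mxbd (fun i j => iE (a i j)) r.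
  move=> r0 Aa; rewrite mxdelta//.
  exact: (@amp_mxbd _ _ _ _ (tp H K) (tp E K) _ _ _ _ oA oB bC hiota ciiota _ _
    (fun i j => delta (a i j)) _ r0 (fun i j => hom_in hdelta (Aa i j))).
have iEE g a : spectral u A delta g a -> iE a = gtens (tp E K) (iota a) (u g).
  move=> [Aa aE]; rewrite /iE aE.
  exact: (amp_elem _ _ oA oB bC hiota ciiota Aa (Bu g)).
have niE a : A a -> opnorm (iE a) <= opnorm a.
  apply: (mxbd_contractive bA) => {a} [a Aa|I J a r r0 Aa]; first exact: (hom_in hiE0).
  by move/(mxiE _ _ _ _ r0 Aa).
have ndelta a : A a -> opnorm (delta a) <= opnorm a.
  apply: (mxbd_contractive bA) => {a} [a Aa|I J a r r0 Aa].
    exact: bSA (hom_in hdelta Aa).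
  by move/(mxdelta _ _ _ _ r0 Aa).
(* The amplified map is so far known only to take bounded operators as values; density of the
   spectral subspaces places them in [D]. *)
have iED a : A a -> D (iE a).
  apply: (dense_in oA SpAsub densA (ss _) hiE0 niE oD) => {}a [g _ Sa].
  by apply: sub_cstar_gen; exists g, a; rewrite (iEE g).
have hiE : alg_hom A D iE.
  by case: hiE0 => _ h1 h2; split.
have coverD : cstar_cover A D iE.
  split=> //.
    apply: completely_isometricP => // [a Aa|n a r r0 Aa]; first exact: (hom_in hiE0).
    exact: mxiE.
  have bim : iE @` A `<=` @bounded_op R (tp E K) by move=> _ [a Aa <-]; exact: (hom_in hiE0).
  apply/seteqP; split.
    apply: cstar_gen_min; first exact: cstar_gen_cstar.
    move=> _ [g [a [Sa ->]]]; apply: sub_cstar_gen; exists a; first by case: Sa.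
    exact: (iEE g).
  by apply: cstar_gen_min => // _ [a Aa <-]; exact: iED.
have cSB : cstar_algebra (gspatial (tp K K) B B) by exact: gspatial_cstar.
have [sID IDE] := amp_star_hom_r (tp E K) (tp E (tp K K)) cC cB (oa_bop cSB.1) sDelta.
have sdE0 : star_hom (gspatial (tp E K) C B) (@bounded_op R (tp (tp E K) K)) dE.
  exact: star_hom_comp sID (tconj_star_hom tp E K K).
have dEE c g : C c -> dE (gtens (tp E K) c (u g)) =
    gtens (tp (tp E K) K) (gtens (tp E K) c (u g)) (u g).
  move=> Cc; rewrite -(tconj_elem tp (bC _ Cc) (bu g) (bu g)).
  rewrite -[gtens (tp K K) _ _]/(optens (u g) (u g)) -DeltaE.
  by rewrite -(IDE c (u g) Cc (Bu g)).
have cSC : cstar_algebra (gspatial (tp E K) C B) by exact: gspatial_cstar.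
have DSC : D `<=` gspatial (tp E K) C B.
  apply: cstar_gen_min => // _ [g [a [[Aa _] ->]]].
  exact: (gspatial_elem (tp E K) cC.1 oB (CI _ Aa) (Bu g)).
have sdE : star_hom D (@bounded_op R (tp (tp E K) K)) dE.
  exact: star_hom_sub DSC sdE0.
have cSD : cstar_algebra (gspatial (tp (tp E K) K) D B) by exact: gspatial_cstar.
(* The right side is a C*-algebra by [spectral_span_cstar], and each generator iota a (x) u_g is
   itself of degree [g]. *)
have densD : D `<=` opclosure (lspan (\bigcup_g spectral u D dE g)).
  have cSp := spectral_span_cstar ru cD sdE.
  apply: cstar_gen_min => // s Ss; have Ds : D s by exact: sub_cstar_gen.
  apply: sub_opclosure.
    apply: lspan_sub; [exact: bop0|exact: bopZD|by move=> t [g _ [/bD]]].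
  apply: sub_lspan; move: Ss Ds => [g [a [[Aa _] ->]]] Ds; exists g => //; split=> //.
  exact: dEE (CI _ Aa).
have SpDsub : \bigcup_g spectral u D dE g `<=` D by move=> t [g _ []].
have ndE t : D t -> opnorm (dE t) <= opnorm t.
  exact: (star_hom_contractive cD (ss _) sdE).
have dED t : D t -> gspatial (tp (tp E K) K) D B (dE t).
  apply: (dense_in oD SpDsub densD (ss _) sdE.1 ndE cSD.1).
  by move=> s [g _ [Ds ->]]; exact: (gspatial_elem _ oD oB Ds (Bu g)).
have hdE : alg_hom D (gspatial (tp (tp E K) K) D B) dE.
  by case: sdE.1 => _ h1 h2; split.
have mxdE n (a : 'I_n -> 'I_n -> op (tp E K)) r : 0 <= r -> (forall i j, D (a i j)) ->
    mxbd a r <-> mxbd (fun i j => dE (a i j)) r.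
  move=> r0 Da; split; first exact: (star_hom_mxbd cD (ss _) sdE r0 Da).
  (* The left inverse below returns t (x) 1, and removing the factor 1 takes a unit vector of [K].
     If [K] is zero, so is the whole tensor product. *)
  move=> dr; have [[y y0]|K0] := pselect (exists y : K, y <> 0); last first.
    have K0' (y : K) : y = 0 by apply: contrapT => y0; apply: K0; exists y.
    have T0 (t : tp E K) : t = 0 by exact: (tens_trivial K0').
    by move=> x; rewrite !big1 ?mulr0// => i _; rewrite [X in hnorm X]T0 hnorm0 expr0n.
  have y0' : hnorm y != 0 by apply: contra_notN y0 => /eqP/hnorm_eq0.
  pose y1 := (hnorm y)^-1%:C%C *: y.
  have ny1 : hnorm y1 = 1.
    by rewrite hnormZ cabs_real ger0_norm ?invr_ge0 ?hnorm_ge0// mulVf.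
  (* The trivial representation is realised on [K] itself, so that id (x) [pi] acts between copies
     of the same tensor product and sends s (x) u_g to s (x) 1. *)
  have rid : unitary_rep (fun _ : G => id : op K).
    split=> // _; split; first exact: bop_id.
    by exists id; split=> // a b.
  have [pi spi piE] := Huniv K (fun=> id) rid.
  have [sPi PiE] := amp_star_hom_r (tp (tp E K) K) (tp (tp E K) K) cD cB
    (ss _) spi.
  have E1 t : D t -> gmaptens (tp (tp E K) K) (tp (tp E K) K) D B id pi (dE t) =
      gtens (tp (tp E K) K) t id.
    have s1 := star_hom_comp (conj hdE sdE.2 : star_hom D _ dE) sPi.
    have s2 := star_hom_sub bD (gtens_id_star_hom (tp (tp E K) K)).
    apply: (dense_eq oD SpDsub densD (ss _) (ss _) s1.1 s2.1).
    + by move=> s Ds; exact: (star_hom_contractive cD (ss _) s1 Ds).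
    + by move=> s Ds; exact: (star_hom_contractive cD (ss _) s2 Ds).
    + by move=> s [g _ [Ds sE]]; rewrite /= sE PiE// piE.
  apply: (gtens_id_mxbd (T := tp (tp E K) K) ny1) => [i j|]; first exact: bD.
  have -> : (fun i j => gtens (tp (tp E K) K) (a i j) id) = fun i j =>
      gmaptens (tp (tp E K) K) (tp (tp E K) K) D B id pi (dE (a i j)).
    by apply/funext => i; apply/funext => j; rewrite E1.
  apply: (star_hom_mxbd cSD (ss _) sPi r0) => // i j; exact: dED.
have cosD : cosystem u D dE.
  split=> //.
    apply: completely_isometricP => // t Dt; exact: (hom_in sdE.1).
have ciiE : completely_isometric A iE by case: coverD.
split.
  split=> // a Aa.
  have h1 := alg_hom_comp hiE sdE.1.
  have h2 := alg_hom_comp hdelta (amp_hom (tp H K) (tp (tp E K) K) oA oB bD hiE ciiE).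
  (* Both sides are contractive homomorphisms; on a spectral element [b] of degree [g] both equal
     (iota b (x) u_g) (x) u_g. *)
  apply: (dense_eq oA SpAsub densA (ss _) (ss _) h1 h2) Aa.
  - move=> b Ab; apply: le_trans (niE _ Ab).
    exact: (star_hom_contractive cD (ss _) sdE (iED _ Ab)).
  - move=> b Ab; apply: le_trans (ndelta _ Ab).
    exact: (amp_opnorm (tp (tp E K) K) oA oB bD hiE ciiE (hom_in hdelta Ab)).
  - move=> b [g _ Sb]; have [Ab bE] := Sb; rewrite /= (iEE g)// dEE; last exact: CI.
    rewrite bE -[optens b (u g)]/(gtens (tp H K) b (u g)).
    by rewrite (amp_elem _ _ oA oB bD hiE ciiE Ab (Bu g)) (iEE g).
move=> H' C' iota' delta' [[oC' hdelta' cidelta' densC'] cover' equi'].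
have [cC' hiota' ciiota' C'E] := cover'.
have [phi0 [sphi0 _] phi0E] := Cuniv _ _ _ cover'.
have bC' := oa_bop oC'.
have cSC' : cstar_algebra (gspatial (tp H' K) C' B) by exact: gspatial_cstar.
have bSC' := oa_bop cSC'.1.
have mxdelta' := completely_isometric_mxbd oC' bSC' hdelta' cidelta'.
have ndelta' c : C' c -> opnorm (delta' c) <= opnorm c.
  apply: (mxbd_contractive bC') => {c} [c Cc|I J a r r0 Cc].
    exact: bSC' (hom_in hdelta' Cc).
  by move/(mxdelta' _ _ _ _ r0 Cc).
(* Adjoints have to be respected here, since [phi] must be a star-homomorphism on all of [C'], not
   merely on the image of [A]. *)
have sdelta' : star_hom C' (gspatial (tp H' K) C' B) delta'.
  exact: contractive_hom_star cC' bSC' hdelta' ndelta'.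
have [sPhi PhiE] := amp_star_hom_l (tp H' K) (tp E K) cC' cB bC sphi0.
set Phi := gmaptens _ _ _ _ _ _ in sPhi PhiE.
set SpC := \bigcup_g spectral u C' delta' g in densC'.
have SpCsub : SpC `<=` C' by move=> c [g _ []].
pose phi c := Phi (delta' c).
have sphi : star_hom C' (@bounded_op R (tp E K)) phi := star_hom_comp sdelta' sPhi.
have nphi c : C' c -> opnorm (phi c) <= opnorm c.
  exact: (star_hom_contractive cC' (ss _) sphi).
have I'C a : A a -> C' (iota' a) by move=> Aa; exact: (hom_in hiota').
have niota' a : A a -> opnorm (iota' a) <= opnorm a.
  apply: (mxbd_contractive bA) => {a} [a Aa|I J a r r0 Aa]; first exact: bC' (I'C _ Aa).
  by move/(completely_isometric_mxbd oA bC' hiota' ciiota' r0 Aa).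
have phiE a : A a -> phi (iota' a) = iE a.
  move=> Aa; have h1 := alg_hom_comp hiota' sphi.1.
  apply: (dense_eq oA SpAsub densA (ss _) bD h1 hiE) Aa.
  - by move=> b Ab; apply: le_trans (niota' _ Ab); exact: nphi (I'C _ Ab).
  - exact: niE.
  - move=> b [g _ Sb]; have [Ab bE] := Sb; rewrite /= (iEE g)// /phi equi'// bE.
    rewrite -[optens b (u g)]/(gtens (tp H K) b (u g)).
    have -> : maptens A B iota' id (gtens (tp H K) b (u g)) =
        gtens (tp H' K) (iota' b) (u g).
      exact: (amp_elem _ _ oA oB bC' hiota' ciiota' Ab (Bu g)).
    by rewrite PhiE ?phi0E//; exact: I'C.
(* The preimage of [D] is a C*-algebra containing the image of [A], which generates [C']. *)
have phiD c : C' c -> D (phi c).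
  have cP := star_hom_preim_cstar cC' (ss _) sphi cD.
  rewrite {1}C'E => /(cstar_gen_min cP)[] // _ [a Aa <-]; split; first exact: I'C.
  by rewrite phiE//; exact: iED.
have sphiD : star_hom C' D phi.
  by case: sphi => -[_ h1 h2] h3; split=> //; split.
exists phi; split; [split|move=> c Cc|exact: phiE] => //.
- apply: cstar_gen_min; first exact: (star_hom_range_cstar cC' (ss _) sphi).
  move=> _ [g [a [Sa ->]]]; have [Aa _] := Sa; exists (iota' a); first exact: I'C.
  by rewrite phiE// (iEE g).
- have [sAmp AmpE] := amp_star_hom_l (tp H' K) (tp (tp E K) K) cC' cB bD sphiD.
  have h1 := alg_hom_comp sphiD.1 sdE.1.
  have h2 := star_hom_comp sdelta' sAmp.
  (* Equivariance is tested on the spectral subspaces of [C']: for [b] of degree [g], [phi b] is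
     phi0 b (x) u_g, and both sides become phi b (x) u_g. *)
  apply: (dense_eq oC' SpCsub densC' (ss _) (ss _) h1 h2.1) Cc.
  + move=> b Cb; apply: le_trans (nphi _ Cb).
    exact: (star_hom_contractive cD (ss _) sdE (phiD _ Cb)).
  + move=> b Cb; exact: (star_hom_contractive cC' (ss _) h2 Cb).
  + move=> b [g _ [Cb bE]]; have phib : phi b = gtens (tp E K) (phi0 b) (u g).
      by rewrite /phi bE -[optens b (u g)]/(gtens (tp H' K) b (u g)) PhiE.
    rewrite /= phib dEE; last exact: (hom_in sphi0.1).
    rewrite -phib bE -[optens b (u g)]/(gtens (tp H' K) b (u g)).
    by rewrite AmpE.
Qed.
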